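(* Let $A$ be the Glaisher–Kinkelin constant. Then $$\log A=\frac{1+\log(2\pi)}{12}-\frac{1}{2\pi^2}\int_0^\infty\frac{x\log x}{e^x-1}\,dx.$$
   Context: The Glaisher–Kinkelin constant $A>0$ is defined by $\log A=\frac1{12}-\zeta'(-1)$, where $\zeta$ is the Riemann zeta function. *)

(* Defs.v *)
From Stdlib Require Export Reals.
From Coquelicot Require Export Coquelicot.
Open Scope R_scope.

(* x^s for a real base x > 0, i.e. exp (s * ln x) with the real logarithm. *)
Definition Rpow_C (x : R) (s : C) : C :=
  (exp (Re s * ln x) * cos (Im s * ln x),
   exp (Re s * ln x) * sin (Im s * ln x)).

Definition analytic_at (f : C -> C) (s0 : C) : Prop :=
  exists (a : nat -> C) (r : R), 0 < r /\
    forall s : C, Cmod (s - s0)%C < r ->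
      @is_pseries C_AbsRing C_NormedModule a (s - s0)%C (f s).

(* The analytic continuation to C \ {1} of the Dirichlet series of n^(-s).  It
   is unique since C \ {1} is connected; the value at the pole 1 is irrelevant. *)
Definition is_Riemann_zeta (zeta : C -> C) : Prop :=
  (forall s : C, 1 < Re s ->
     @is_series C_AbsRing C_NormedModule
       (fun n : nat => Rpow_C (INR (S n)) (- s)%C) (zeta s)) /\
  (forall s : C, s <> RtoC 1 -> analytic_at zeta s).

(* An equation in C, so it also says that zeta'(-1) is real. *)
Definition is_Glaisher_Kinkelin (zeta : C -> C) (A : R) : Prop :=
  0 < A /\
  RtoC (ln A) = (RtoC (1 / 12) - C_derive zeta (RtoC (-1)))%C.

(* Main.v *)
(* The functional equation in Mellin form.  Put b(t) = 1/(e^(2 pi t) - 1).  The partial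
   fractions b(t) + 1/2 - 1/(2 pi t) = (1/pi) sum_n t/(n^2 + t^2) and the integral
   int_0^oo t^(1-s)/(1 + t^2) dt = (pi/2)/sin(pi s/2) give, for 1 < s < 2,
     zeta(s) = 2 sin(pi s/2) int_0^oo t^(-s) (b(t) + 1/2 - 1/(2 pi t)) dt.
   Removing (atan t)/pi + t/(2 pi (1 + t^2)), which contributes 1/(s-1) + 1/2, leaves a
   remainder r(t) that is O(t) at 0 and O(t^(-3)) at infinity, so that
     1/(s-1) + 1/2 + 2 sin(pi s/2) int_0^oo t^(-s) r(t) dt
   is analytic on |Re s| < 2 except at 1.  It agrees with zeta near 3/2, hence, along a
   path avoiding 1, near -1.  Since cos(-pi/2) = 0, differentiating at -1 yields
   zeta'(-1) = -1/4 + 2 int t ln t r(t) dt = 2 int t ln t b(t) dt; the substitution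
   x = 2 pi t and int t b(t) dt = zeta(2)/(4 pi^2) = 1/24 finish the proof. *)

Require Import Defs.
From Stdlib Require Import Lra Lia.

(** * Finite sums and duplication identities *)

(** No general theorem exchanges sums with integrals here: an expansion is cut after [N] terms, the
    finite part is integrated term by term, and the tail gets an explicit bound that tends to 0 with
    [N]. The bounds are therefore quantitative from the start. The partial fractions come from one
    finite duplication identity shared by (sinh, cosh) and (sin, cos). The hyperbolic case expands
    b(t); the trigonometric case gives the cotangent, hence the cosecant, which is what evaluates
    the integral of t^(1-s)/(1+t^2). For the continuation, sin(pi s/2) is not treated as a separate
    analytic factor. It is split into the phases e^(i pi s/2) and e^(-i pi s/2), which enter the
    exponent of t^(-s), so analyticity only requires expanding one exponential under the integral.
    Since analyticity means local power series, the identity theorem is proved along segments, where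
    it reduces to real power series in the parameter. *)

Fixpoint bsum (f : nat -> R) (n : nat) : R :=
  match n with O => 0 | S m => bsum f m + f m end.

Lemma bsum_ext f g n : (forall k, (k < n)%nat -> f k = g k) -> bsum f n = bsum g n.
Proof.
  induction n as [|n IH]; intros H; simpl; [easy|].
  rewrite IH, H; auto.
Qed.

Lemma bsum_split f n m : bsum f (n + m) = bsum f n + bsum (fun k => f (n + k)%nat) m.
Proof.
  induction m as [|m IH]; simpl; [rewrite Nat.add_0_r; ring|].
  rewrite Nat.add_succ_r; simpl; rewrite IH; ring.
Qed.

Lemma bsum_plus f g n : bsum (fun k => f k + g k) n = bsum f n + bsum g n.
Proof. induction n as [|n IH]; simpl; [ring|rewrite IH; ring]. Qed.

Lemma bsum_scal c f n : bsum (fun k => c * f k) n = c * bsum f n.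
Proof. induction n as [|n IH]; simpl; [ring|rewrite IH; ring]. Qed.

Lemma bsum_shift f n : bsum f (S n) = f O + bsum (fun k => f (S k)) n.
Proof. exact (eq_trans (bsum_split f 1 n) (f_equal2 Rplus (Rplus_0_l _) eq_refl)). Qed.

Lemma bsum_rev f n : bsum (fun k => f (n - k)%nat) n = bsum (fun k => f (S k)) n.
Proof.
  induction n as [|n IH]; [easy|].
  rewrite bsum_shift.
  change (f (S n) + bsum (fun k => f (n - k)%nat) n = bsum (fun k => f (S k)) (S n)).
  rewrite IH; simpl; ring.
Qed.

Lemma bsum_Rabs_le f g n :
  (forall k, (k < n)%nat -> Rabs (f k) <= g k) -> Rabs (bsum f n) <= bsum g n.
Proof.
  induction n as [|n IH]; intros H; simpl; [rewrite Rabs_R0; lra|].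
  eapply Rle_trans; [apply Rabs_triang|].
  apply Rplus_le_compat; auto.
Qed.

Lemma bsum_sum_n f n : sum_n f n = bsum f (S n).
Proof.
  induction n as [|n IH]; [rewrite sum_O; symmetry; apply Rplus_0_l|].
  rewrite sum_Sn, IH; reflexivity.
Qed.

Lemma is_lim_seq_bsum (f : nat -> nat -> R) (l : nat -> R) n :
  (forall k, (k < n)%nat -> is_lim_seq (fun m => f m k) (l k)) ->
  is_lim_seq (fun m => bsum (f m) n) (bsum l n).
Proof.
  induction n as [|n IH]; intros H; simpl; [apply is_lim_seq_const|].
  apply (is_lim_seq_plus' _ _ _ _ (IH (fun k Hk => H k (Nat.lt_lt_succ_r _ _ Hk))) (H n (Nat.lt_succ_diag_r n))).
Qed.

Lemma INR_pow2 m : INR (2 ^ m) = 2 ^ m.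
Proof. rewrite pow_INR; reflexivity. Qed.

Lemma pow2_pos m : 0 < 2 ^ m.
Proof. apply pow_lt; lra. Qed.

(* Herglotz's duplication: pairing [k] with [k + 2^m] turns [(a, th)] into [(2 a, 2 th)]. *)
Lemma duplication_sum (S C : R -> R)
  (HS : forall x, S (2 * x) = 2 * S x * C x)
  (HC : forall x, C (2 * x) = 2 * C x ^ 2 - 1) m :
  forall a th,
  (forall k, (k < 2 ^ m)%nat -> C a <> cos (th + 2 * PI * INR k / 2 ^ m)) ->
  C (2 ^ m * a) <> cos (2 ^ m * th) /\
  bsum (fun k => S a / (C a - cos (th + 2 * PI * INR k / 2 ^ m))) (2 ^ m) =
  2 ^ m * S (2 ^ m * a) / (C (2 ^ m * a) - cos (2 ^ m * th)).
Proof.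
  induction m as [|m IH]; intros a th H.
  - simpl in *; rewrite !Rmult_1_l.
    specialize (H O (Nat.lt_0_succ 0)).
    simpl in H; replace (th + 2 * PI * 0 / 1) with th in * by field.
    split; [easy|]. field; lra.
  - assert (P := pow2_pos m).
    (* Shifting the index by half the number of nodes adds PI to the angle, so each pair has
       denominators [C a - c] and [C a + c], whose product is half of [C (2 * a) - cos] of the
       doubled angle. *)
    assert (E : forall k, cos (th + 2 * PI * INR (2 ^ m + k) / 2 ^ Datatypes.S m) =
                     - cos (th + 2 * PI * INR k / 2 ^ Datatypes.S m)).
    { intros k; rewrite <- neg_cos; f_equal.
      rewrite plus_INR, INR_pow2; simpl; field; lra. }
    assert (D : forall x, cos (2 * x) = 2 * cos x ^ 2 - 1).
    { intros x; rewrite cos_2a_cos; ring. }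
    assert (N : forall k, (k < 2 ^ m)%nat ->
       C a - cos (th + 2 * PI * INR k / 2 ^ Datatypes.S m) <> 0 /\
       C a + cos (th + 2 * PI * INR k / 2 ^ Datatypes.S m) <> 0).
    { intros k Hk; split.
      - assert (Q := H k ltac:(simpl; lia)); lra.
      - assert (Q := H (2 ^ m + k)%nat ltac:(simpl; lia)); rewrite E in Q; lra. }
    assert (F : forall k, cos (2 * th + 2 * PI * INR k / 2 ^ m) =
       2 * cos (th + 2 * PI * INR k / 2 ^ Datatypes.S m) ^ 2 - 1).
    { intros k; rewrite <- D; f_equal; simpl; field; lra. }
    destruct (IH (2 * a) (2 * th)) as [I1 I2].
    { intros k Hk; rewrite F, HC; intros Q.
      destruct (N k Hk) as [N1 N2].
      apply (Rmult_integral_contrapositive_currified _ _ N1 N2); nra. }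
    replace (2 ^ m * (2 * a)) with (2 ^ Datatypes.S m * a) in * by (simpl; ring).
    replace (2 ^ m * (2 * th)) with (2 ^ Datatypes.S m * th) in * by (simpl; ring).
    split; [easy|].
    replace (2 ^ Datatypes.S m)%nat with (2 ^ m + 2 ^ m)%nat by (simpl; lia).
    rewrite bsum_split, <- bsum_plus.
    transitivity (bsum (fun k => 2 * (S (2 * a) / (C (2 * a) - cos (2 * th + 2 * PI * INR k / 2 ^ m)))) (2 ^ m)).
    + apply bsum_ext; intros k Hk.
      destruct (N k Hk) as [N1 N2].
      rewrite E, F, HS, HC.
      set (c := cos (th + _)) in *.
      assert (2 * C a ^ 2 - 1 - (2 * c ^ 2 - 1) <> 0).
      { intros Q; apply (Rmult_integral_contrapositive_currified _ _ N1 N2); nra. }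
      field; repeat split; try lra.
    + rewrite bsum_scal, I2; simpl; field; simpl in I1; lra.
Qed.

(** At [th = 0] the nodes are symmetric under k -> 2^(m+1) - k. The fixed nodes k = 0 and k = 2^m
    give the two isolated terms; all others occur twice. Folding leaves indices small against
    2^(m+1), for which the summands have termwise limits. *)
Lemma folded_duplication_sum (S C : R -> R)
  (HS : forall x, S (2 * x) = 2 * S x * C x)
  (HC : forall x, C (2 * x) = 2 * C x ^ 2 - 1) m a :
  (forall k, (k < 2 ^ Datatypes.S m)%nat -> C a <> cos (2 * PI * INR k / 2 ^ Datatypes.S m)) ->
  S a / (C a - 1) + S a / (C a + 1) +
  bsum (fun k => 2 * (S a / (C a - cos (2 * PI * INR (Datatypes.S k) / 2 ^ Datatypes.S m)))) (2 ^ m - 1) =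
  2 ^ Datatypes.S m * S (2 ^ Datatypes.S m * a) / (C (2 ^ Datatypes.S m * a) - 1).
Proof.
  intros H.
  assert (P := pow2_pos m).
  destruct (duplication_sum S C HS HC (Datatypes.S m) a 0) as [_ E].
  { intros k Hk; rewrite Rplus_0_l; auto. }
  rewrite Rmult_0_r, cos_0 in E; rewrite <- E; clear E.
  set (f := fun k => S a / (C a - cos (0 + 2 * PI * INR k / 2 ^ Datatypes.S m))).
  replace (2 ^ Datatypes.S m)%nat with (2 ^ m + 2 ^ m)%nat by (simpl; lia).
  rewrite bsum_split.
  assert (Q : (0 < 2 ^ m)%nat) by (apply Nat.neq_0_lt_0, Nat.pow_nonzero; lia).
  (* The upper half is reflected onto the lower one: cos(x + PI) = cos(PI - x). *)
  rewrite (bsum_ext (fun k => f (2 ^ m + k)%nat) (fun k => f (2 ^ m - k)%nat)).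
  2:{ intros k Hk; unfold f; do 2 f_equal.
      rewrite plus_INR, minus_INR, INR_pow2 by lia.
      replace (0 + _) with (2 * PI * INR k / 2 ^ Datatypes.S m + PI) by (simpl; field; lra).
      rewrite neg_cos, <- (cos_neg (2 * PI * INR k / 2 ^ Datatypes.S m)), <- neg_cos.
      f_equal; simpl; field; lra. }
  rewrite bsum_rev.
  set (n := (2 ^ m - 1)%nat).
  assert (Hn : (2 ^ m = Datatypes.S n)%nat) by (unfold n; lia).
  assert (F0 : f O = S a / (C a - 1)).
  { unfold f; replace (0 + _) with 0 by (simpl; field; lra). rewrite cos_0; reflexivity. }
  assert (FL : f (2 ^ m)%nat = S a / (C a + 1)).
  { unfold f; rewrite INR_pow2.
    replace (0 + _) with PI by (simpl; field; lra). rewrite cos_PI; replace (C a - -1) with (C a + 1) by ring; reflexivity. }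
  rewrite Hn at 1; rewrite bsum_shift; rewrite F0.
  rewrite Hn, bsum_scal; cbn [bsum]; rewrite <- Hn, FL.
  rewrite (bsum_ext (fun k => f (Datatypes.S k)) (fun k => S a / (C a - cos (2 * PI * INR (Datatypes.S k) / 2 ^ Datatypes.S m)))).
  2:{ intros; unfold f; rewrite Rplus_0_l; reflexivity. }
  unfold Rdiv. ring.
Qed.

(** * Partial fractions of coth and cot *)

(** Telescoping: 1/(x+1)^2 <= 1/(x(x+1)) = 1/x - 1/(x+1). *)
Lemma bsum_inv_sqr_tail N n : (1 <= N)%nat ->
  bsum (fun k => / INR (S (N + k)) ^ 2) n <= / INR N - / INR (N + n).
Proof.
  intros HN.
  assert (HP : forall k, 0 < INR (N + k)) by (intros; apply lt_0_INR; lia).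
  induction n as [|n IH]; cbn [bsum].
  - rewrite Nat.add_0_r; lra.
  - assert (H : / INR (S (N + n)) ^ 2 <= / INR (N + n) - / INR (S (N + n))).
    { rewrite S_INR; assert (P := HP n); set (x := INR (N + n)) in *.
      replace (/ x - / (x + 1)) with (/ (x * (x + 1))) by (field; lra).
      apply Rinv_le_contravar; nra. }
    rewrite Nat.add_succ_r; lra.
Qed.

(** Tannery's theorem with a rate: beyond [N] all summands are dominated uniformly in [m] by
    K/(k+1)^2, whose tail is at most K/N, and the first [N] summands converge individually. *)
Lemma tannery_inv_sqr (f : nat -> nat -> R) (g : nat -> R) (L : nat -> nat) (V K : R) (N : nat) :
  (1 <= N)%nat -> 0 <= K ->
  (forall k, is_lim_seq (fun m => f m k) (g k)) ->
  is_lim_seq (fun m => bsum (f m) (L m)) V ->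
  eventually (fun m => (N <= L m)%nat) ->
  eventually (fun m => forall k, (N <= k < L m)%nat -> Rabs (f m k) <= K / INR (S k) ^ 2) ->
  Rabs (V - bsum g N) <= K / INR N.
Proof.
  intros HN HK Hf HV HL HB.
  assert (HNp : 0 < INR N) by (apply lt_0_INR; lia).
  assert (H : is_lim_seq (fun m => Rabs (bsum (f m) (L m) - bsum (f m) N)) (Rabs (V - bsum g N))).
  { apply (is_lim_seq_abs _ (V - bsum g N)), is_lim_seq_minus'; [easy|].
    apply is_lim_seq_bsum; auto. }
  assert (Q : Rbar_le (Rabs (V - bsum g N)) (K / INR N)); [|exact Q].
  refine (is_lim_seq_le_loc _ _ _ _ _ H (is_lim_seq_const (K / INR N))).
  generalize (filter_and _ _ HL HB); apply filter_imp; intros m [H1 H2].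
  replace (L m) with (N + (L m - N))%nat at 1 by lia.
  set (n := (L m - N)%nat).
  rewrite bsum_split.
  replace (_ + _ - _) with (bsum (fun k => f m (N + k)%nat) n) by ring.
  apply Rle_trans with (bsum (fun k => K * / INR (S (N + k)) ^ 2) n).
  - apply bsum_Rabs_le; intros k Hk; apply H2; unfold n in Hk; lia.
  - rewrite bsum_scal.
    apply Rmult_le_compat_l; [easy|].
    eapply Rle_trans; [apply bsum_inv_sqr_tail; easy|].
    assert (0 < / INR (N + n)) by (apply Rinv_0_lt_compat, lt_0_INR; lia).
    lra.
Qed.

(** This is the derivative of [f] at 0 read along the steps kappa/2^(m+1), so it yields the limit of
    every scaled sine or hyperbolic sine below. *)
Lemma is_lim_seq_pow2_mult (f : R -> R) (f0 : f 0 = 0) (d : R) (Df : is_derive f 0 d) kappa :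
  is_lim_seq (fun m => 2 ^ S m * f (kappa / 2 ^ S m)) (d * kappa).
Proof.
  destruct (Req_dec kappa 0) as [->|Hk].
  { rewrite Rmult_0_r; apply is_lim_seq_ext with (fun _ => 0); [|apply is_lim_seq_const].
    intros m; unfold Rdiv; rewrite Rmult_0_l, f0, Rmult_0_r; reflexivity. }
  assert (P : forall m, 0 < 2 ^ m) by apply pow2_pos.
  apply is_derive_Reals in Df.
  apply is_lim_seq_Reals; intros eps He.
  destruct (Df (eps / Rabs kappa)) as [del Hd].
  { apply Rdiv_lt_0_compat; [easy|]. now apply Rabs_pos_lt. }
  assert (L : is_lim_seq (fun m => kappa * (/ 2) ^ S m) 0).
  { apply is_lim_seq_incr_1 with (u := fun m => kappa * (/ 2) ^ m).
    replace (Finite 0) with (Rbar_mult kappa 0) by (simpl; f_equal; ring).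
    apply is_lim_seq_scal_l, is_lim_seq_geom; rewrite Rabs_pos_eq; lra. }
  apply is_lim_seq_spec in L; destruct (L del) as [n Hn].
  exists n; intros m Hm; specialize (Hn m Hm).
  assert (E : kappa * (/ 2) ^ S m = kappa / 2 ^ S m) by (rewrite pow_inv; reflexivity).
  rewrite Rminus_0_r, E in Hn.
  assert (Q := P (S m)).
  assert (Hk' : kappa / 2 ^ S m <> 0).
  { apply Rmult_integral_contrapositive_currified; [easy|]. apply Rinv_neq_0_compat; lra. }
  specialize (Hd _ Hk' Hn).
  rewrite Rplus_0_l, f0, Rminus_0_r in Hd.
  unfold Rdist.
  replace (_ - _) with (kappa * (f (kappa / 2 ^ S m) / (kappa / 2 ^ S m) - d)).
  2:{ field; split; lra. }
  rewrite Rabs_mult.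
  apply Rmult_lt_compat_l with (r := Rabs kappa) in Hd; [|now apply Rabs_pos_lt].
  replace (Rabs kappa * (eps / Rabs kappa)) with eps in Hd; [easy|].
  field; now apply Rabs_no_R0.
Qed.

Lemma is_lim_seq_inv_pow2 : is_lim_seq (fun m => / 2 ^ S m) 0.
Proof.
  apply is_lim_seq_incr_1 with (u := fun m => / 2 ^ m).
  apply is_lim_seq_ext with (fun m => (/ 2) ^ m).
  { intros m; apply pow_inv. }
  apply is_lim_seq_geom; rewrite Rabs_pos_eq; lra.
Qed.

Lemma is_lim_seq_replace (u : nat -> R) (l l' : R) :
  is_lim_seq u l -> l = l' -> is_lim_seq u l'.
Proof. intros H <-; exact H. Qed.

(** [e = 1] with (sinh, cosh) leads to coth, [e = -1] with (sin, cos) to cot. The sign enters only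
    through [HCS], the half-argument formula. [Hne] keeps the finite denominators away from 0 and
    [Hden] those of the limit. *)
Section PartialFractions.
Variables (S C : R -> R) (e y : R).
Hypothesis HS : forall x, S (2 * x) = 2 * S x * C x.
Hypothesis HC : forall x, C (2 * x) = 2 * C x ^ 2 - 1.
Hypothesis HCS : forall x, C (2 * x) = 1 + 2 * e * S x ^ 2.
Hypothesis S0 : S 0 = 0.
Hypothesis DS : is_derive S 0 1.
Hypothesis He : e <> 0.
Hypothesis Hy : 0 < y.
Hypothesis Hne : forall m k, (k < 2 ^ Datatypes.S m)%nat ->
  C (2 * PI * y / 2 ^ Datatypes.S m) <> cos (2 * PI * INR k / 2 ^ Datatypes.S m).
Hypothesis Hden : forall k, INR (Datatypes.S k) ^ 2 + e * y ^ 2 <> 0.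

Let M m := 2 ^ Datatypes.S m.
Let a m := 2 * PI * y / M m.

Let M_pos m : 0 < M m.
Proof. apply pow2_pos. Qed.

Let lim_MS kappa : is_lim_seq (fun m => M m * S (kappa / M m)) kappa.
Proof.
  apply is_lim_seq_replace with (1 * kappa); [|ring].
  now apply is_lim_seq_pow2_mult.
Qed.

Let lim_S kappa : is_lim_seq (fun m => S (kappa / M m)) 0.
Proof.
  apply is_lim_seq_ext with (fun m => (M m * S (kappa / M m)) * / M m).
  { intros m; field. assert (H := M_pos m); lra. }
  apply is_lim_seq_replace with (kappa * 0); [|ring].
  apply is_lim_seq_mult'; [apply lim_MS|apply is_lim_seq_inv_pow2].
Qed.

Let lim_C kappa : is_lim_seq (fun m => C (kappa / M m)) 1.
Proof.
  apply is_lim_seq_ext with (fun m => 1 + 2 * e * (S (kappa / 2 / M m) * S (kappa / 2 / M m))).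
  { intros m; replace (kappa / M m) with (2 * (kappa / 2 / M m)).
    - rewrite HCS; ring.
    - field. assert (H := M_pos m); lra. }
  apply is_lim_seq_replace with (1 + 2 * e * (0 * 0)); [|ring].
  apply is_lim_seq_plus'; [apply is_lim_seq_const|].
  apply is_lim_seq_mult'; [apply is_lim_seq_const|].
  apply is_lim_seq_mult'; apply lim_S.
Qed.

(** Half-argument formulas turn the difference into 2e S(u)^2 + 2 sin(v)^2 with u and v of order
    1/M, so multiplying by M^2 gives a finite limit. *)
Let lim_den k : is_lim_seq
  (fun m => M m ^ 2 * (C (a m) - cos (2 * PI * INR k / M m)))
  (2 * PI ^ 2 * (INR k ^ 2 + e * y ^ 2)).
Proof.
  apply is_lim_seq_ext with (fun m =>
    2 * e * ((M m * S (PI * y / M m)) * (M m * S (PI * y / M m))) +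
    2 * ((M m * sin (PI * INR k / M m)) * (M m * sin (PI * INR k / M m)))).
  { intros m; assert (H := M_pos m).
    replace (a m) with (2 * (PI * y / M m)) by (unfold a; field; lra).
    replace (2 * PI * INR k / M m) with (2 * (PI * INR k / M m)) by (field; lra).
    rewrite HCS, cos_2a_sin; ring. }
  apply is_lim_seq_replace with
   (2 * e * ((PI * y) * (PI * y)) + 2 * ((1 * (PI * INR k)) * (1 * (PI * INR k)))); [|ring].
  assert (L : is_lim_seq (fun m => M m * sin (PI * INR k / M m)) (1 * (PI * INR k))).
  { apply (is_lim_seq_pow2_mult sin sin_0).
    apply is_derive_Reals; rewrite <- cos_0; apply derivable_pt_lim_sin. }
  apply is_lim_seq_plus'; apply is_lim_seq_mult'; try apply is_lim_seq_const;
    apply is_lim_seq_mult'; auto.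
Qed.

(** The folded summand times PI / M, arranged so that numerator and denominator converge
    separately. *)
Let f m k := 2 * PI * (M m * S (a m)) *
  / (M m ^ 2 * (C (a m) - cos (2 * PI * INR (Datatypes.S k) / M m))).

Let lim_f k : is_lim_seq (fun m => f m k) (2 * y / (INR (Datatypes.S k) ^ 2 + e * y ^ 2)).
Proof.
  assert (P := PI_neq0).
  apply is_lim_seq_replace with
    (2 * PI * (2 * PI * y) * / (2 * PI ^ 2 * (INR (Datatypes.S k) ^ 2 + e * y ^ 2))).
  2:{ field; split; [apply Hden|easy]. }
  apply is_lim_seq_mult'.
  - apply is_lim_seq_mult'; [apply is_lim_seq_const|apply lim_MS].
  - apply (is_lim_seq_inv _ (2 * PI ^ 2 * (INR (Datatypes.S k) ^ 2 + e * y ^ 2)));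
      [apply lim_den|].
    intros Q; injection Q; intros Q'.
    apply Rmult_integral in Q'; destruct Q' as [Q'|Q'].
    + assert (0 < PI ^ 2) by (apply pow_lt, PI_RGT_0); lra.
    + apply (Hden k Q').
Qed.

(** After multiplication by PI / M the closed form is constant in [m], because M times [a m] is 2 PI
    y. The node k = 0 contributes PI C(a/2)/(e M S(a/2)), which tends to 1/(e y), and the opposite
    node is O(M^(-2)). *)
Let lim_sum : is_lim_seq (fun m => bsum (f m) (2 ^ m - 1))
  (PI * S (2 * PI * y) / (C (2 * PI * y) - 1) - / (e * y)).
Proof.
  assert (P := PI_RGT_0).
  apply is_lim_seq_ext with (fun m =>
    PI * S (2 * PI * y) / (C (2 * PI * y) - 1)
    - PI * C (PI * y / M m) * / (e * (M m * S (PI * y / M m)))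
    - PI * (M m * S (a m)) * (/ M m * / M m) * / (C (a m) + 1)).
  - intros m; assert (H := M_pos m).
    rewrite (bsum_ext (f m) (fun k => PI / M m * (2 * (S (a m) / (C (a m) - cos (2 * PI * INR (Datatypes.S k) / M m)))))).
    2:{ intros k Hk; unfold f.
        assert (C (a m) - cos (2 * PI * INR (Datatypes.S k) / M m) <> 0).
        { assert (Q := Hne m (Datatypes.S k) ltac:(simpl; lia)).
          intros Q'; apply Q; unfold a, M in *; lra. }
        field; split; lra. }
    rewrite bsum_scal.
    assert (E := folded_duplication_sum S C HS HC m (a m) (Hne m)).
    fold (M m) in E.
    replace (M m * a m) with (2 * PI * y) in E by (unfold a; field; lra).
    assert (E1 : C (a m) - 1 = 2 * e * S (PI * y / M m) ^ 2).
    { replace (a m) with (2 * (PI * y / M m)) by (unfold a; field; lra).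
      rewrite HCS; ring. }
    assert (E2 : S (a m) = 2 * S (PI * y / M m) * C (PI * y / M m)).
    { replace (a m) with (2 * (PI * y / M m)) by (unfold a; field; lra).
      apply HS. }
    assert (N1 : C (a m) - 1 <> 0).
    { assert (Q := Hne m 0%nat ltac:(apply Nat.neq_0_lt_0, Nat.pow_nonzero; lia)).
      replace (2 * PI * INR 0 / _) with 0 in Q by (simpl INR; field; apply pow_nonzero; lra).
      rewrite cos_0 in Q; fold (M m) in Q; fold (a m) in Q; lra. }
    assert (N2 : C (a m) + 1 <> 0).
    { assert (Q := Hne m (2 ^ m)%nat ltac:(simpl; assert (2 ^ m <> 0)%nat by (apply Nat.pow_nonzero; lia); lia)).
      replace (2 * PI * INR (2 ^ m) / _) with PI in Q.
      - rewrite cos_PI in Q; fold (M m) in Q; fold (a m) in Q; lra.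
      - rewrite INR_pow2; assert (Q' := pow2_pos m); simpl; field; lra. }
    assert (N3 : S (PI * y / M m) <> 0).
    { intros Q; apply N1; rewrite E1, Q; ring. }
    assert (E3 : S (a m) / (C (a m) - 1) = C (PI * y / M m) / (e * S (PI * y / M m))).
    { rewrite E1, E2; field; split; easy. }
    rewrite E3 in E.
    set (B := bsum _ _) in *.
    apply Rplus_eq_reg_l with (PI / M m * (C (PI * y / M m) / (e * S (PI * y / M m)) + S (a m) / (C (a m) + 1))).
    rewrite <- Rmult_plus_distr_l, E.
    unfold Rdiv. rewrite !Rinv_mult. field.
    repeat split; try assumption; try lra.
    replace (2 * PI * y) with (2 ^ Datatypes.S m * a m) by (unfold a, M; field; apply pow_nonzero; lra).
    destruct (duplication_sum S C HS HC (Datatypes.S m) (a m) 0) as [Q _].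
    { intros k Hk; rewrite Rplus_0_l; apply (Hne m k Hk). }
    rewrite Rmult_0_r, cos_0 in Q; lra.
  - apply is_lim_seq_replace with
      (PI * S (2 * PI * y) / (C (2 * PI * y) - 1)
       - PI * 1 * / (e * (PI * y)) - PI * (2 * PI * y) * (0 * 0) * / (1 + 1)).
    2:{ generalize (PI * S (2 * PI * y) / (C (2 * PI * y) - 1)); intros z.
        field; repeat split; try assumption; lra. }
    assert (N : e * (PI * y) <> 0).
    { apply Rmult_integral_contrapositive_currified; [easy|]. apply Rgt_not_eq, Rmult_lt_0_compat; easy. }
    apply is_lim_seq_minus'; [apply is_lim_seq_minus'|].
    + apply is_lim_seq_const.
    + apply is_lim_seq_mult'.
      * apply is_lim_seq_mult'; [apply is_lim_seq_const|apply lim_C].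
      * apply (is_lim_seq_inv _ (e * (PI * y))).
        -- apply is_lim_seq_mult'; [apply is_lim_seq_const|apply lim_MS].
        -- intros Q; injection Q; exact N.
    + apply is_lim_seq_mult'.
      * apply is_lim_seq_mult'.
        -- apply is_lim_seq_mult'; [apply is_lim_seq_const|apply lim_MS].
        -- apply is_lim_seq_mult'; apply is_lim_seq_inv_pow2.
      * apply (is_lim_seq_inv _ (1 + 1)).
        -- apply is_lim_seq_plus'; [apply lim_C|apply is_lim_seq_const].
        -- intros Q; injection Q; lra.
Qed.

(** The assumption on [c0] is the domination required by [tannery_inv_sqr]. The threshold [N0]
    exists because in the trigonometric case the available estimate fails for the first term. *)
Lemma partial_fractions_gen (c0 : R) (N0 : nat) : 0 < c0 ->
  (forall m k, (N0 <= k < 2 ^ m - 1)%nat ->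
    c0 * INR (Datatypes.S k) ^ 2 <= (2 ^ Datatypes.S m) ^ 2 *
     (C (2 * PI * y / 2 ^ Datatypes.S m) - cos (2 * PI * INR (Datatypes.S k) / 2 ^ Datatypes.S m))) ->
  exists K, 0 <= K /\ forall N, (1 <= N)%nat -> (N0 <= N)%nat ->
    Rabs (PI * S (2 * PI * y) / (C (2 * PI * y) - 1) - / (e * y)
          - bsum (fun k => 2 * y / (INR (Datatypes.S k) ^ 2 + e * y ^ 2)) N) <= K / INR N.
Proof.
  intros Hc H.
  assert (P := PI_RGT_0).
  (* The numerator M S(a) tends to 2 PI y, so it is eventually at most 2 PI y + 1 in absolute
     value. *)
  exists (2 * PI * (2 * PI * y + 1) / c0).
  assert (HK : 0 <= 2 * PI * (2 * PI * y + 1)).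
  { assert (0 < PI * y) by (apply Rmult_lt_0_compat; easy).
    apply Rmult_le_pos; lra. }
  assert (HK' : 0 <= 2 * PI * (2 * PI * y + 1) / c0) by (apply Rdiv_le_0_compat; easy).
  split; [easy|]. intros N HN HN0.
  apply tannery_inv_sqr with (f := f) (L := fun m => (2 ^ m - 1)%nat); auto.
  - exists N; intros m Hm.
    assert (m < 2 ^ m)%nat by (apply Nat.pow_gt_lin_r; lia). lia.
  - assert (L := lim_MS (2 * PI * y)).
    apply is_lim_seq_spec in L.
    destruct (L (mkposreal 1 Rlt_0_1)) as [m0 Hm0]; exists m0; intros m Hm k Hk.
    specialize (Hm0 m Hm); simpl in Hm0.
    specialize (H m k ltac:(lia)); fold (M m) in H; fold (a m) in H, Hm0.
    assert (Hk1 : 0 < INR (Datatypes.S k) ^ 2) by (apply pow_lt, lt_0_INR; lia).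
    assert (Hck : 0 < c0 * INR (Datatypes.S k) ^ 2) by (apply Rmult_lt_0_compat; easy).
    unfold f; rewrite !Rabs_mult.
    rewrite (Rabs_pos_eq 2), (Rabs_pos_eq PI), (Rabs_pos_eq (/ _)) by
      (try apply Rlt_le, Rinv_0_lt_compat; lra).
    replace (2 * PI * (2 * PI * y + 1) / c0 / INR (Datatypes.S k) ^ 2) with
      (2 * PI * (2 * PI * y + 1) * / (c0 * INR (Datatypes.S k) ^ 2)).
    2:{ field; split; try lra; apply not_0_INR; lia. }
    apply Rmult_le_compat.
    + apply Rmult_le_pos; [lra|]. rewrite <- Rabs_mult; apply Rabs_pos.
    + apply Rlt_le, Rinv_0_lt_compat; lra.
    + apply Rmult_le_compat_l; [lra|]. rewrite <- Rabs_mult.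
      assert (0 < PI * y) by (apply Rmult_lt_0_compat; easy).
      apply Rlt_le in Hm0; revert Hm0; unfold Rabs; do 2 destruct Rcase_abs; intros; lra.
    + apply Rinv_le_contravar; lra.
Qed.
End PartialFractions.

Lemma is_lim_seq_div_INR_S K : is_lim_seq (fun n => K / INR (S n)) 0.
Proof.
  apply is_lim_seq_replace with (K * 0); [|ring].
  apply is_lim_seq_mult'; [apply is_lim_seq_const|].
  apply (is_lim_seq_incr_1 (fun n => / INR n)).
  apply is_lim_seq_inv with (l := p_infty); [apply is_lim_seq_INR|easy].
Qed.

Lemma is_series_of_bound (g : nat -> R) (V K : R) (N0 : nat) :
  (forall N, (1 <= N)%nat -> (N0 <= N)%nat -> Rabs (V - bsum g N) <= K / INR N) ->
  is_series g V.
Proof.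
  intros H.
  assert (L := is_lim_seq_div_INR_S K).
  assert (Q : is_lim_seq (sum_n g) V); [|exact Q].
  apply is_lim_seq_le_le_loc with (u := fun n => V - K / INR (S n)) (w := fun n => V + K / INR (S n)).
  - exists N0; intros n Hn; rewrite bsum_sum_n.
    specialize (H (S n) ltac:(lia) ltac:(lia)).
    apply Rabs_le_between in H; lra.
  - apply is_lim_seq_replace with (V - 0); [|ring].
    apply is_lim_seq_minus'; [apply is_lim_seq_const|easy].
  - apply is_lim_seq_replace with (V + 0); [|ring].
    apply is_lim_seq_plus'; [apply is_lim_seq_const|easy].
Qed.

(** * Sine and cosine bounds, and the two instances: coth (the Bose kernel) and cot *)

(** 1 - cos x = 2 sin(x/2)^2, and for z = x/2 <= 2 the cubic Taylor bound gives sin z >= z - z^3/6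
    >= z/3; squaring x/6 and doubling yields the 18. *)
Lemma cos_one_minus_lower x : 0 <= x <= PI -> x ^ 2 / 18 <= 1 - cos x.
Proof.
  intros H; assert (P4 := PI_4).
  assert (B : x / 2 / 3 <= sin (x / 2)).
  { destruct (pre_sin_bound (x / 2) 0) as [B _]; try lra.
    unfold sin_approx, sin_term in B; simpl in B.
    set (z := x / 2) in *.
    assert (z * (z * z) <= z * 4) by (apply Rmult_le_compat_l; unfold z; nra).
    lra. }
  replace (cos x) with (cos (2 * (x / 2))) by (f_equal; field).
  rewrite cos_2a_sin. nra.
Qed.

Lemma sqr_sin_le x : sin x ^ 2 <= x ^ 2.
Proof.
  assert (H : Rabs (sin x) <= Rabs x).
  { assert (A : forall z, 0 < z -> sin z < z) by (intros; now apply sin_lt_x).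
    destruct (Rtotal_order x 0) as [H|[->|H]].
    - assert (B := A (- x) ltac:(lra)); assert (B' := A (- sin x)).
      rewrite (Rabs_left x) by easy. rewrite sin_neg in B.
      apply Rabs_le; split; [lra|].
      destruct (Rle_dec (sin x) 0); [lra|].
      destruct (Rle_dec (- x) 1); [|assert (Q := SIN_bound x); lra].
      assert (0 < sin (- x)). { apply sin_gt_0; [lra|]. assert (Q := PI2_1); lra. }
      rewrite sin_neg in *; lra.
    - rewrite sin_0; lra.
    - assert (B := A x H).
      rewrite (Rabs_pos_eq x) by lra.
      apply Rabs_le; split; [|lra].
      destruct (Rle_dec x 1); [|assert (Q := SIN_bound x); lra].
      assert (0 < sin x). { apply sin_gt_0; [lra|]. assert (Q := PI2_1); lra. }
      lra. }
  rewrite <- (pow2_abs (sin x)), <- (pow2_abs x).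
  apply pow_incr; split; [apply Rabs_pos|easy].
Qed.

Lemma exp_2PI_gt_1 t : 0 < t -> 1 < exp (2 * PI * t).
Proof.
  intros H; rewrite <- exp_0; apply exp_increasing.
  assert (P := PI_RGT_0). apply Rmult_lt_0_compat; lra.
Qed.

Definition bose (t : R) := / (exp (2 * PI * t) - 1).
Definition bose_reg (t : R) := bose t + / 2 - / (2 * PI * t).

Lemma cosh_gt_1 x : 0 < x -> 1 < cosh x.
Proof.
  intros H; unfold cosh; rewrite exp_Ropp.
  assert (E : 1 < exp x) by (rewrite <- exp_0; now apply exp_increasing).
  set (z := exp x) in *.
  apply Rmult_lt_reg_r with (2 * z); [lra|].
  replace ((z + / z) / 2 * (2 * z)) with (z ^ 2 + 1) by (field; lra). nra.
Qed.

(** The case [e = 1]: 2 PI times [bose_reg t] is PI coth(PI t) - 1/t. Here [K] depends on [t], so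
    the bound only identifies the sum of the series; [bose_reg_tail] then supplies a tail estimate
    explicit in [t]. *)
Lemma bose_reg_series_bound t : 0 < t -> exists K, 0 <= K /\ forall N, (1 <= N)%nat ->
  Rabs (2 * PI * bose_reg t - bsum (fun k => 2 * t / (INR (S k) ^ 2 + t ^ 2)) N) <= K / INR N.
Proof.
  intros Ht.
  assert (P := PI_RGT_0).
  assert (Hd : forall x, cosh (2 * x) = 1 + 2 * 1 * sinh x ^ 2 /\
     cosh (2 * x) = 2 * cosh x ^ 2 - 1 /\ sinh (2 * x) = 2 * sinh x * cosh x).
  { intros x; unfold cosh, sinh.
    replace (- (2 * x)) with (- x + - x) by ring. replace (2 * x) with (x + x) by ring.
    rewrite !exp_plus, !exp_Ropp.
    assert (Q := exp_pos x); repeat split; field; lra. }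
  assert (Ha : forall m, 0 < 2 * PI * t / 2 ^ S m).
  { intros m; apply Rdiv_lt_0_compat; [|apply pow2_pos].
    apply Rmult_lt_0_compat; lra. }
  (* Since cosh >= 1, the denominator is at least 1 - cos x with x = 2 PI (k+1)/M; this explains
     [c0]. *)
  destruct (partial_fractions_gen sinh cosh 1 t) with (c0 := (2 * PI) ^ 2 / 18) (N0 := O)
    as [K [HK H]]; try (intros; apply Hd); try lra.
  - apply sinh_0.
  - apply is_derive_Reals; rewrite <- cosh_0; apply derivable_pt_lim_sinh.
  - intros m k Hk Q.
    assert (B := COS_bound (2 * PI * INR k / 2 ^ S m)).
    assert (B' := cosh_gt_1 _ (Ha m)). lra.
  - intros k; assert (0 < t ^ 2) by (apply pow_lt; easy).
    assert (0 <= INR (S k) ^ 2) by apply pow2_ge_0. lra.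
  - assert (0 < (2 * PI) ^ 2) by (apply pow_lt; lra). lra.
  - intros m k Hk.
    assert (B' := cosh_gt_1 _ (Ha m)).
    assert (M := pow2_pos (S m)).
    assert (Hx : 0 <= 2 * PI * INR (S k) / 2 ^ S m <= PI).
    { assert (0 <= INR (S k)) by apply pos_INR.
      split.
      - apply Rdiv_le_0_compat; [|easy]. apply Rmult_le_pos; lra.
      - apply Rle_div_l; [easy|]. cbn [pow].
        assert (INR (S k) <= 2 ^ m) by (rewrite <- INR_pow2; apply le_INR; lia). nra. }
    assert (B := cos_one_minus_lower _ Hx).
    set (x := 2 * PI * INR (S k) / 2 ^ S m) in *.
    replace ((2 * PI) ^ 2 / 18 * INR (S k) ^ 2) with ((2 ^ S m) ^ 2 * (x ^ 2 / 18)).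
    2:{ unfold x; field; lra. }
    apply Rmult_le_compat_l; [apply pow2_ge_0|lra].
  - exists K; split; [easy|]. intros N HN; specialize (H N HN (Nat.le_0_l _)).
    rewrite (bsum_ext (fun k => 2 * t / (INR (S k) ^ 2 + t ^ 2)) (fun k => 2 * t / (INR (S k) ^ 2 + 1 * t ^ 2))).
    2:{ intros; rewrite Rmult_1_l; reflexivity. }
    replace (2 * PI * bose_reg t) with
      (PI * sinh (2 * PI * t) / (cosh (2 * PI * t) - 1) - / (1 * t)); [easy|].
    unfold bose_reg, bose, sinh, cosh.
    rewrite exp_Ropp.
    assert (E := exp_2PI_gt_1 t Ht). set (z := exp _) in *.
    field; repeat split; try lra.
    intros Q. assert (D : 0 < (z - 1) ^ 2) by (apply pow_lt; lra). nra.
Qed.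

(** The range y <= 1/2 suffices for the cosecant, which uses the arguments x/2 and (1-x)/2 with 0 <
    x < 1. *)
Lemma cot_series y : 0 < y <= 1 / 2 ->
  is_series (fun k => 2 * y / (INR (S k) ^ 2 - y ^ 2)) (/ y - PI * cos (PI * y) / sin (PI * y)).
Proof.
  intros Hy.
  assert (P := PI_RGT_0).
  assert (Hs : sin (PI * y) <> 0).
  { apply Rgt_not_eq, sin_gt_0; nra. }
  (* The scaled denominator is at least (2 PI)^2/18 (k+1)^2 - 2 PI^2 y^2, and y <= 1/2 with k+1 >= 2
     gives 2 PI^2 y^2 <= PI^2/2 <= PI^2/8 (k+1)^2. This is where [N0 = 1] is needed. *)
  destruct (partial_fractions_gen sin cos (-1) y) with (c0 := (2 * PI) ^ 2 / 18 - PI ^ 2 / 8) (N0 := 1%nat)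
    as [K [HK H]]; try lra.
  - intros; apply sin_2a.
  - intros; rewrite cos_2a_cos; ring.
  - intros; rewrite cos_2a_sin; ring.
  - apply sin_0.
  - apply is_derive_Reals; rewrite <- cos_0; apply derivable_pt_lim_sin.
  (* A difference of cosines is a product of two sines with arguments PI (k+y)/M and PI (k-y)/M up
     to sign; both have absolute value strictly between 0 and PI. *)
  - intros m k Hk.
    assert (M := pow2_pos (S m)).
    apply Rminus_not_eq.
    rewrite form2.
    assert (Hk0 : INR k <= 2 ^ S m - 1).
    { apply lt_INR in Hk; rewrite INR_pow2 in Hk.
      assert (Q := le_INR (S k) (2 ^ S m)).
      rewrite S_INR, INR_pow2 in Q. assert (INR k + 1 <= 2 ^ S m); [|lra].
      apply Q. apply INR_lt; rewrite INR_pow2; easy. }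
    replace ((2 * PI * y / 2 ^ S m - 2 * PI * INR k / 2 ^ S m) / 2)
      with (- (PI * ((INR k - y) / 2 ^ S m))) by (field; lra).
    replace ((2 * PI * y / 2 ^ S m + 2 * PI * INR k / 2 ^ S m) / 2)
      with (PI * ((INR k + y) / 2 ^ S m)) by (field; lra).
    rewrite sin_neg.
    assert (S1 : 0 < sin (PI * ((INR k + y) / 2 ^ S m))).
    { assert (0 < (INR k + y) / 2 ^ S m < 1).
      { assert (Q := pos_INR k). split; [apply Rdiv_lt_0_compat; lra|].
        apply Rlt_div_l; lra. }
      apply sin_gt_0; nra. }
    assert (S2 : sin (PI * ((INR k - y) / 2 ^ S m)) <> 0).
    { assert (M2 : 2 <= 2 ^ S m).
      { assert (1 <= 2 ^ m) by (apply pow_R1_Rle; lra). cbn [pow]; lra. }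
      destruct k as [|k].
      - replace (PI * _) with (- (PI * (y / 2 ^ S m))) by (simpl INR; field; lra).
        rewrite sin_neg. apply Ropp_neq_0_compat, Rgt_not_eq.
        assert (0 < y / 2 ^ S m < 1).
        { split; [apply Rdiv_lt_0_compat; lra|]. apply Rlt_div_l; lra. }
        apply sin_gt_0; nra.
      - apply Rgt_not_eq.
        assert (0 < (INR (S k) - y) / 2 ^ S m < 1).
        { rewrite S_INR in *; assert (Q := pos_INR k). split; [apply Rdiv_lt_0_compat; lra|].
          apply Rlt_div_l; lra. }
        apply sin_gt_0; nra. }
    intros Q. apply Rmult_integral in Q; destruct Q as [Q|Q]; [|lra].
    apply Rmult_integral in Q; destruct Q as [Q|Q]; lra.
  - intros k; rewrite S_INR; assert (Q := pos_INR k). nra.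
  - assert (0 < PI ^ 2) by (apply pow_lt; lra). nra.
  - intros m k Hk.
    assert (M := pow2_pos (S m)).
    assert (Hx : 0 <= 2 * PI * INR (S k) / 2 ^ S m <= PI).
    { assert (0 <= INR (S k)) by apply pos_INR.
      split.
      - apply Rdiv_le_0_compat; [|easy]. apply Rmult_le_pos; lra.
      - apply Rle_div_l; [easy|]. cbn [pow].
        assert (INR (S k) <= 2 ^ m) by (rewrite <- INR_pow2; apply le_INR; lia). nra. }
    assert (B := cos_one_minus_lower _ Hx).
    set (x := 2 * PI * INR (S k) / 2 ^ S m) in *.
    replace (2 * PI * y / 2 ^ S m) with (2 * (PI * y / 2 ^ S m)) by (field; lra).
    rewrite cos_2a_sin.
    assert (B' := sqr_sin_le (PI * y / 2 ^ S m)).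
    assert (E1 : (2 ^ S m) ^ 2 * (x ^ 2 / 18) = (2 * PI) ^ 2 / 18 * INR (S k) ^ 2).
    { unfold x; field; lra. }
    assert (E2 : (2 ^ S m) ^ 2 * (PI * y / 2 ^ S m) ^ 2 = PI ^ 2 * y ^ 2) by (field; lra).
    assert (M' : 0 <= (2 ^ S m) ^ 2) by apply pow2_ge_0.
    set (MM := (2 ^ S m) ^ 2) in *.
    apply Rmult_le_compat_l with (r := MM) in B; [|easy].
    apply Rmult_le_compat_l with (r := MM) in B'; [|easy].
    assert (K1 : 4 <= INR (S k) ^ 2).
    { assert (Q := le_INR 2 (S k) ltac:(lia)). simpl (INR 2) in Q. nra. }
    assert (PI ^ 2 * y ^ 2 <= PI ^ 2 * / 4) by (apply Rmult_le_compat_l; [apply pow2_ge_0|nra]).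
    assert (PI ^ 2 * 4 <= PI ^ 2 * INR (S k) ^ 2) by (apply Rmult_le_compat_l; [apply pow2_ge_0|easy]).
    lra.
  - apply is_series_of_bound with (K := K) (N0 := 1%nat).
    intros N HN HN'; specialize (H N HN HN').
    rewrite (bsum_ext _ (fun k => 2 * y / (INR (S k) ^ 2 + -1 * y ^ 2))).
    2:{ intros; f_equal; ring. }
    replace (/ y - PI * cos (PI * y) / sin (PI * y)) with
      (PI * sin (2 * PI * y) / (cos (2 * PI * y) - 1) - / (-1 * y)); [easy|].
    replace (2 * PI * y) with (2 * (PI * y)) by ring.
    rewrite cos_2a_sin, sin_2a. field.
    repeat split; try lra. intros Q; apply Hs. nra.
Qed.

(** * Improper integrals on (0, oo) *)

Definition is_RInt_pos (f : R -> R) (l : R) : Prop :=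
  is_RInt_gen f (at_right 0) (Rbar_locally p_infty) l.

Local Instance proper_at_right_0 : ProperFilter (at_right 0) := at_right_proper_filter 0.
Local Instance filter_at_right_0 : Filter (at_right 0) := filter_filter.
Local Instance proper_p_infty : ProperFilter (Rbar_locally p_infty) := Rbar_locally_filter p_infty.
Local Instance filter_p_infty : Filter (Rbar_locally p_infty) := filter_filter.

Lemma at_right_0_lt (d : R) : 0 < d -> at_right 0 (fun x => 0 < x < d).
Proof.
  intros Hd; exists (mkposreal d Hd); intros x Hx H0.
  unfold ball in Hx; simpl in Hx; unfold AbsRing_ball, abs, minus, plus, opp in Hx; simpl in Hx.
  apply Rabs_def2 in Hx; lra.
Qed.

Lemma eventually_pos_interval :
  filter_prod (at_right 0) (Rbar_locally p_infty) (fun ab => 0 < fst ab < 1 /\ 1 < snd ab).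
Proof.
  apply Filter_prod with (fun x => 0 < x < 1) (fun y => 1 < y).
  - apply at_right_0_lt; lra.
  - exists 1; auto.
  - simpl; auto.
Qed.

Lemma eventually_subset_pos (P : R -> Prop) : (forall x, 0 < x -> P x) ->
  filter_prod (at_right 0) (Rbar_locally p_infty)
   (fun ab => forall x, Rmin (fst ab) (snd ab) <= x <= Rmax (fst ab) (snd ab) -> P x).
Proof.
  intros H; generalize eventually_pos_interval; apply filter_imp.
  intros [a b]; simpl; intros [Ha Hb] x Hx; apply H.
  rewrite Rmin_left in Hx by lra; lra.
Qed.

Lemma is_RInt_pos_ext f g l : (forall x, 0 < x -> f x = g x) -> is_RInt_pos f l -> is_RInt_pos g l.
Proof.
  intros H; apply (is_RInt_gen_ext f g l).
  generalize (eventually_subset_pos _ H); apply filter_imp.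
  intros ab Q x Hx; apply Q; lra.
Qed.

Lemma is_RInt_pos_unique f l l' : is_RInt_pos f l -> is_RInt_pos f l' -> l = l'.
Proof.
  intros H H'.
  rewrite <- (is_RInt_gen_unique f l H); now apply is_RInt_gen_unique.
Qed.

Lemma is_RInt_pos_plus f g l l' : is_RInt_pos f l -> is_RInt_pos g l' ->
  is_RInt_pos (fun x => f x + g x) (l + l').
Proof. exact (is_RInt_gen_plus f g l l'). Qed.

Lemma is_RInt_pos_minus f g l l' : is_RInt_pos f l -> is_RInt_pos g l' ->
  is_RInt_pos (fun x => f x - g x) (l - l').
Proof. exact (is_RInt_gen_minus f g l l'). Qed.

Lemma is_RInt_pos_scal c f l : is_RInt_pos f l -> is_RInt_pos (fun x => c * f x) (c * l).
Proof. exact (is_RInt_gen_scal f c l). Qed.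

Lemma is_RInt_pos_bsum (f : nat -> R -> R) (l : nat -> R) n :
  (forall k, is_RInt_pos (f k) (l k)) ->
  is_RInt_pos (fun x => bsum (fun k => f k x) n) (bsum l n).
Proof.
  intros H; induction n as [|n IH]; simpl.
  - assert (Q := is_RInt_pos_scal 0 _ _ (H O)); rewrite Rmult_0_l in Q.
    revert Q; apply is_RInt_pos_ext; intros; ring.
  - now apply is_RInt_pos_plus.
Qed.

Lemma is_RInt_pos_le f g l l' : (forall x, 0 < x -> Rabs (f x) <= g x) ->
  is_RInt_pos f l -> is_RInt_pos g l' -> Rabs l <= l'.
Proof.
  intros H Hf Hg.
  apply (RInt_gen_norm (Fa := at_right 0) (Fb := Rbar_locally p_infty) f g l l'); auto.
  - generalize eventually_pos_interval; apply filter_imp; intros; lra.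
  - generalize eventually_pos_interval; apply filter_imp; intros ab Hab x Hx; apply H; lra.
Qed.

Lemma is_RInt_pos_antiderivative F f A B :
  (forall x, 0 < x -> is_derive F x (f x)) ->
  (forall x, 0 < x -> continuous f x) ->
  filterlim F (at_right 0) (locally A) ->
  filterlim F (Rbar_locally p_infty) (locally B) ->
  is_RInt_pos f (B - A).
Proof.
  intros HF Hf HA HB.
  apply is_RInt_pos_ext with (Derive F).
  { intros x Hx; apply is_derive_unique; auto. }
  apply (is_RInt_gen_Derive F A B); auto.
  - apply eventually_subset_pos; intros x Hx; exists (f x); auto.
  - apply eventually_subset_pos; intros x Hx.
    apply continuous_ext_loc with f; auto.
    assert (L : locally x (fun z => 0 < z)) by (apply open_gt; easy).
    generalize L; apply filter_imp; intros z Hz; symmetry; apply is_derive_unique; auto.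
Qed.

(** * Powers as dominating functions at 0 and at infinity *)

Lemma Rpower_pos x c : 0 < Rpower x c.
Proof. apply exp_pos. Qed.

Lemma is_derive_Rpower c x : 0 < x -> is_derive (fun t => Rpower t c) x (c * Rpower x (c - 1)).
Proof. intros H; apply is_derive_Reals, derivable_pt_lim_power; easy. Qed.

Lemma continuous_Rpower c x : 0 < x -> continuous (fun t => Rpower t c) x.
Proof.
  intros H; apply (@ex_derive_continuous R_AbsRing R_NormedModule).
  eexists; apply is_derive_Rpower; easy.
Qed.

Lemma filterlim_Rplus {T} {Fl : (T -> Prop) -> Prop} {FF : Filter Fl} (f g : T -> R) a b :
  filterlim f Fl (locally a) -> filterlim g Fl (locally b) ->
  filterlim (fun x => f x + g x) Fl (locally (a + b)).
Proof.
  intros Hf Hg; apply (filterlim_comp_2 (G := locally a) (H := locally b) f g Rplus); auto.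
  apply (filterlim_plus a b).
Qed.

Lemma filterlim_Rscal {T} {Fl : (T -> Prop) -> Prop} {FF : Filter Fl} (f : T -> R) c a :
  filterlim f Fl (locally a) -> filterlim (fun x => c * f x) Fl (locally (c * a)).
Proof.
  intros Hf; apply filterlim_comp with (1 := Hf). apply (filterlim_scal_r c a).
Qed.

Lemma filterlim_replace {T} {Fl : (T -> Prop) -> Prop} (f : T -> R) (a b : R) :
  filterlim f Fl (locally a) -> a = b -> filterlim f Fl (locally b).
Proof. intros H <-; exact H. Qed.

Lemma filterlim_Rminus {T} {Fl : (T -> Prop) -> Prop} {FF : Filter Fl} (f g : T -> R) a b :
  filterlim f Fl (locally a) -> filterlim g Fl (locally b) ->
  filterlim (fun x => f x - g x) Fl (locally (a - b)).
Proof.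
  intros Hf Hg.
  apply filterlim_ext with (fun x => f x + -1 * g x); [intros; ring|].
  apply filterlim_replace with (a + -1 * b); [|ring].
  apply filterlim_Rplus; [easy|]. now apply filterlim_Rscal.
Qed.

Lemma filterlim_Rpower_0 c : 0 < c -> filterlim (fun t => Rpower t c) (at_right 0) (locally 0).
Proof.
  intros Hc; unfold Rpower.
  apply filterlim_comp with (G := Rbar_locally m_infty); [|exact is_lim_exp_m].
  apply filterlim_comp with (G := Rbar_locally m_infty); [exact is_lim_ln_0|].
  assert (H := filterlim_Rbar_mult_l c m_infty).
  simpl in H; destruct (Rle_dec 0 c) as [h|]; [|lra].
  destruct (Rle_lt_or_eq_dec 0 c h); [exact H|lra].
Qed.

Lemma filterlim_Rpower_infty c : c < 0 -> filterlim (fun t => Rpower t c) (Rbar_locally p_infty) (locally 0).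
Proof.
  intros Hc; unfold Rpower.
  apply filterlim_comp with (G := Rbar_locally m_infty); [|exact is_lim_exp_m].
  apply filterlim_comp with (G := Rbar_locally p_infty); [exact is_lim_ln_p|].
  assert (H := filterlim_Rbar_mult_l c p_infty).
  simpl in H; destruct (Rle_dec 0 c) as [h|]; [lra|exact H].
Qed.

Lemma filterlim_of_bound {T} {Fl : (T -> Prop) -> Prop} {FF : Filter Fl} (F w : T -> R) (A K : R) :
  Fl (fun x => Rabs (F x - A) <= K * w x) -> filterlim w Fl (locally 0) ->
  filterlim F Fl (locally A).
Proof.
  intros H Hw.
  apply filterlim_locally; intros eps.
  assert (HK : 0 < Rabs K + 1) by (assert (Q := Rabs_pos K); lra).
  assert (He : 0 < eps / (Rabs K + 1)) by (apply Rdiv_lt_0_compat; [apply cond_pos|easy]).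
  assert (L := proj1 (filterlim_locally w 0) Hw (mkposreal _ He)).
  generalize (filter_and _ _ H L); apply filter_imp; intros x [H1 H2].
  unfold ball in *; simpl in *; unfold AbsRing_ball, abs, minus, plus, opp in *; simpl in *.
  rewrite Ropp_0, Rplus_0_r in H2.
  eapply Rle_lt_trans; [apply H1|].
  apply Rle_lt_trans with ((Rabs K + 1) * Rabs (w x)).
  - rewrite <- (Rabs_pos_eq (Rabs K + 1)), <- Rabs_mult by lra.
    eapply Rle_trans; [apply Rle_abs|]. rewrite !Rabs_mult.
    apply Rmult_le_compat_r; [apply Rabs_pos|]. rewrite (Rabs_pos_eq (_ + _)); lra.
  - apply Rmult_lt_compat_l with (r := Rabs K + 1) in H2; [|easy].
    replace ((Rabs K + 1) * (eps / (Rabs K + 1))) with (pos eps) in H2 by (field; lra). easy.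
Qed.

Lemma filterlim_0_of_power_bound F A K c : 0 < c ->
  (forall x, 0 < x <= 1 -> Rabs (F x - A) <= K * Rpower x c) ->
  filterlim F (at_right 0) (locally A).
Proof.
  intros Hc H; apply filterlim_of_bound with (w := fun x => Rpower x c) (K := K).
  - generalize (at_right_0_lt 1 Rlt_0_1); apply filter_imp; intros; apply H; lra.
  - now apply filterlim_Rpower_0.
Qed.

Lemma filterlim_infty_of_power_bound F A K c : c < 0 ->
  (forall x, 1 <= x -> Rabs (F x - A) <= K * Rpower x c) ->
  filterlim F (Rbar_locally p_infty) (locally A).
Proof.
  intros Hc H; apply filterlim_of_bound with (w := fun x => Rpower x c) (K := K).
  - exists 1; intros; apply H; lra.
  - now apply filterlim_Rpower_infty.
Qed.

(** The mean value theorem makes both [H - F] and [H + F] nondecreasing. This replaces integral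
    estimates whenever antiderivatives are at hand. *)
Lemma increment_le (F H f h : R -> R) x y : x <= y ->
  (forall t, x <= t <= y -> is_derive F t (f t)) ->
  (forall t, x <= t <= y -> is_derive H t (h t)) ->
  (forall t, x <= t <= y -> Rabs (f t) <= h t) ->
  Rabs (F y - F x) <= H y - H x.
Proof.
  intros Hxy HF HH Hfh.
  assert (M : forall G g, (forall t, x <= t <= y -> is_derive G t (g t)) ->
     (forall t, x <= t <= y -> 0 <= g t) -> G x <= G y).
  { intros G g HG Hg.
    destruct (MVT_gen G x y g) as [c [Hc E]].
    - intros t Ht; rewrite Rmin_left, Rmax_right in Ht by easy; apply HG; lra.
    - intros t Ht; rewrite Rmin_left, Rmax_right in Ht by easy.
      apply continuity_pt_filterlim, (@ex_derive_continuous R_AbsRing R_NormedModule).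
      eexists; apply HG; lra.
    - rewrite Rmin_left, Rmax_right in Hc by easy.
      assert (0 <= g c * (y - x)) by (apply Rmult_le_pos; [apply Hg|]; lra). lra. }
  assert (M1 := M (fun t => H t - F t) (fun t => h t - f t)).
  assert (M2 := M (fun t => H t + F t) (fun t => h t + f t)).
  simpl in M1, M2.
  apply Rabs_le; split.
  - enough (H x + F x <= H y + F y) by lra. apply M2; intros t Ht.
    + apply (is_derive_plus H F); auto.
    + assert (Q := Hfh t Ht); apply Rabs_le_between in Q; lra.
  - enough (H x - F x <= H y - F y) by lra. apply M1; intros t Ht.
    + apply (is_derive_minus H F); auto.
    + assert (Q := Hfh t Ht); apply Rabs_le_between in Q; lra.
Qed.

Lemma is_derive_Rpower_antiderivative K c x : 0 < x -> c + 1 <> 0 ->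
  is_derive (fun t => K / (c + 1) * Rpower t (c + 1)) x (K * Rpower x c).
Proof.
  intros Hx Hc.
  replace (K * Rpower x c) with (K / (c + 1) * ((c + 1) * Rpower x (c + 1 - 1))).
  - apply (is_derive_scal (fun t => Rpower t (c + 1))), is_derive_Rpower; easy.
  - replace (c + 1 - 1) with c by ring. field; easy.
Qed.

Lemma filterlim_Rle_abs {T} {Fl : (T -> Prop) -> Prop} {FF : ProperFilter Fl} (F : T -> R) A K :
  filterlim F Fl (locally A) -> Fl (fun x => Rabs (F x) <= K) -> Rabs A <= K.
Proof.
  intros HA H.
  apply (filterlim_le (F := Fl) (fun x => Rabs (F x)) (fun _ => K) (Rabs A) K); auto.
  - apply filterlim_comp with (G := locally A); [easy|]. apply continuous_Rabs.
  - apply filterlim_const.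
Qed.

(** Comparison with the antiderivatives of the powers makes the integral from 1 to x Cauchy at both
    ends. The last bound is K times the integrals of x^a over (0,1) and x^b over (1,oo). The
    antiderivative itself is exported because [mellin_kernel] composes it with u -> 1/u. *)
Lemma antiderivative_of_power_dominated (f : R -> R) (a b K : R) :
  -1 < a -> b < -1 -> 0 <= K ->
  (forall x, 0 < x -> continuous f x) ->
  (forall x, 0 < x <= 1 -> Rabs (f x) <= K * Rpower x a) ->
  (forall x, 1 <= x -> Rabs (f x) <= K * Rpower x b) ->
  exists F A B, (forall x, 0 < x -> is_derive F x (f x)) /\
    filterlim F (at_right 0) (locally A) /\
    filterlim F (Rbar_locally p_infty) (locally B) /\
    Rabs (B - A) <= K * (/ (a + 1) - / (b + 1)).
Proof.
  intros Ha Hb HK Hf H0 H1.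
  set (F := fun x => RInt f 1 x).
  assert (HF : forall x, 0 < x -> is_derive F x (f x)).
  { intros x Hx; apply is_derive_RInt with (a := 1); [|auto].
    assert (L : locally x (fun z => 0 < z)) by (apply open_gt; easy).
    generalize L; apply filter_imp; intros z Hz.
    apply (@RInt_correct R_CompleteNormedModule), ex_RInt_continuous.
    intros t Ht; apply Hf.
    revert Ht; unfold Rmin; destruct Rle_dec; lra. }
  assert (F1 : F 1 = 0) by exact (RInt_point 1 f).
  assert (B0 : forall x y, 0 < x -> x <= y -> y <= 1 ->
     Rabs (F y - F x) <= K / (a + 1) * Rpower y (a + 1) - K / (a + 1) * Rpower x (a + 1)).
  { intros x y Hx Hxy Hy.
    apply (increment_le F (fun t => K / (a + 1) * Rpower t (a + 1)) f (fun t => K * Rpower t a)); auto.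
    - intros t Ht; apply HF; lra.
    - intros t Ht; apply is_derive_Rpower_antiderivative; lra.
    - intros t Ht; apply H0; lra. }
  assert (B1 : forall x y, 1 <= x -> x <= y ->
     Rabs (F y - F x) <= K / (b + 1) * Rpower y (b + 1) - K / (b + 1) * Rpower x (b + 1)).
  { intros x y Hx Hxy.
    apply (increment_le F (fun t => K / (b + 1) * Rpower t (b + 1)) f (fun t => K * Rpower t b)); auto.
    - intros t Ht; apply HF; lra.
    - intros t Ht; apply is_derive_Rpower_antiderivative; lra.
    - intros t Ht; apply H1; lra. }
  assert (Ka : 0 <= K / (a + 1)) by (apply Rdiv_le_0_compat; lra).
  assert (Kb : 0 <= - (K / (b + 1))).
  { replace (- (K / (b + 1))) with (K / - (b + 1)) by (field; lra). apply Rdiv_le_0_compat; lra. }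
  assert (P : forall x c, 0 <= Rpower x c) by (intros; apply Rlt_le, Rpower_pos).
  assert (E0 : forall x, 0 < x <= 1 -> Rabs (F x) <= K / (a + 1)).
  { intros x Hx. specialize (B0 x 1 ltac:(lra) ltac:(lra) ltac:(lra)).
    rewrite F1, Rminus_0_l, Rabs_Ropp in B0.
    replace (Rpower 1 (a + 1)) with 1 in B0 by (unfold Rpower; rewrite ln_1, Rmult_0_r, exp_0; easy).
    assert (0 <= K / (a + 1) * Rpower x (a + 1)) by (apply Rmult_le_pos; auto). lra. }
  assert (E1 : forall x, 1 <= x -> Rabs (F x) <= - (K / (b + 1))).
  { intros x Hx. specialize (B1 1 x ltac:(lra) ltac:(lra)).
    rewrite F1, Rminus_0_r in B1.
    replace (Rpower 1 (b + 1)) with 1 in B1 by (unfold Rpower; rewrite ln_1, Rmult_0_r, exp_0; easy).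
    assert (0 <= - (K / (b + 1)) * Rpower x (b + 1)) by (apply Rmult_le_pos; auto). lra. }
  assert (L0 : exists A, filterlim F (at_right 0) (locally A)).
  { apply (@filterlim_locally_cauchy R R_CompleteSpace); [apply _|].
    intros eps.
    assert (L := filterlim_Rpower_0 (a + 1) ltac:(lra)).
    (* The added 1 keeps the divisor positive when [K = 0]. *)
    assert (He : 0 < eps / (K / (a + 1) + 1)) by (apply Rdiv_lt_0_compat; [apply cond_pos|lra]).
    assert (L' := proj1 (filterlim_locally _ _) L (mkposreal _ He)).
    eexists; split; [exact (filter_and _ _ L' (at_right_0_lt 1 Rlt_0_1))|].
    assert (W : forall u v, u <= v -> ball 0 (mkposreal _ He) (Rpower v (a + 1)) -> 0 < u < 1 -> 0 < v < 1 ->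
      Rabs (F v - F u) < eps).
    { intros u v Huv Bv Hu Hv.
      specialize (B0 u v ltac:(lra) ltac:(lra) ltac:(lra)).
      unfold ball in Bv; simpl in Bv; unfold AbsRing_ball, abs, minus, plus, opp in Bv; simpl in Bv.
      rewrite Ropp_0, Rplus_0_r, Rabs_pos_eq in Bv by auto.
      apply Rmult_lt_compat_l with (r := K / (a + 1) + 1) in Bv; [|lra].
      replace (_ * (eps / _)) with (pos eps) in Bv by (field; split; lra).
      assert (0 <= K / (a + 1) * Rpower u (a + 1)) by (apply Rmult_le_pos; auto).
      assert (Q := P v (a + 1)). lra. }
    intros u v [Bu Hu] [Bv Hv].
    unfold ball; simpl; unfold AbsRing_ball, abs, minus, plus, opp; simpl.
    destruct (Rle_dec u v).
    - apply W; auto.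
    - rewrite <- Rabs_Ropp, Ropp_plus_distr, Ropp_involutive, Rplus_comm. apply W; auto; lra. }
  assert (L1 : exists B, filterlim F (Rbar_locally p_infty) (locally B)).
  { apply (@filterlim_locally_cauchy R R_CompleteSpace); [apply _|].
    intros eps.
    assert (L := filterlim_Rpower_infty (b + 1) ltac:(lra)).
    assert (He : 0 < eps / (- (K / (b + 1)) + 1)) by (apply Rdiv_lt_0_compat; [apply cond_pos|lra]).
    assert (L' := proj1 (filterlim_locally _ _) L (mkposreal _ He)).
    assert (T1 : Rbar_locally p_infty (fun x => 1 < x)) by (exists 1; auto).
    eexists; split; [exact (filter_and _ _ L' T1)|].
    assert (W : forall u v, u <= v -> ball 0 (mkposreal _ He) (Rpower u (b + 1)) -> 1 < u -> 1 < v ->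
      Rabs (F v - F u) < eps).
    { intros u v Huv Bv Hu Hv.
      specialize (B1 u v ltac:(lra) ltac:(lra)).
      unfold ball in Bv; simpl in Bv; unfold AbsRing_ball, abs, minus, plus, opp in Bv; simpl in Bv.
      rewrite Ropp_0, Rplus_0_r, Rabs_pos_eq in Bv by auto.
      apply Rmult_lt_compat_l with (r := - (K / (b + 1)) + 1) in Bv; [|lra].
      replace (_ * (eps / _)) with (pos eps) in Bv by (field; split; lra).
      assert (0 <= - (K / (b + 1)) * Rpower v (b + 1)) by (apply Rmult_le_pos; auto).
      assert (Q := P u (b + 1)). lra. }
    intros u v [Bu Hu] [Bv Hv].
    unfold ball; simpl; unfold AbsRing_ball, abs, minus, plus, opp; simpl.
    destruct (Rle_dec u v).
    - apply W; auto.
    - rewrite <- Rabs_Ropp, Ropp_plus_distr, Ropp_involutive, Rplus_comm. apply W; auto; lra. }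
  destruct L0 as [A HA], L1 as [B HB].
  exists F, A, B; split; [easy|]. split; [easy|]. split; [easy|].
  assert (QA : Rabs A <= K / (a + 1)).
  { apply (filterlim_Rle_abs F A _ HA).
    generalize (at_right_0_lt 1 Rlt_0_1); apply filter_imp; intros; apply E0; lra. }
  assert (QB : Rabs B <= - (K / (b + 1))).
  { apply (filterlim_Rle_abs F B _ HB). exists 1; intros; apply E1; lra. }
  unfold Rminus at 1; eapply Rle_trans; [apply Rabs_triang|].
  rewrite Rabs_Ropp; unfold Rdiv in *; lra.
Qed.

Lemma ex_RInt_pos_power_dominated (f : R -> R) (a b K : R) :
  -1 < a -> b < -1 -> 0 <= K ->
  (forall x, 0 < x -> continuous f x) ->
  (forall x, 0 < x <= 1 -> Rabs (f x) <= K * Rpower x a) ->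
  (forall x, 1 <= x -> Rabs (f x) <= K * Rpower x b) ->
  exists l, is_RInt_pos f l /\ Rabs l <= K * (/ (a + 1) - / (b + 1)).
Proof.
  intros Ha Hb HK Hf H0 H1.
  destruct (antiderivative_of_power_dominated f a b K Ha Hb HK Hf H0 H1)
    as (F & A & B & HF & HA & HB & Q).
  exists (B - A); split; [|easy].
  now apply is_RInt_pos_antiderivative with F.
Qed.

Lemma is_RInt_pos_comp_scal f l c : 0 < c ->
  is_RInt_pos f l -> is_RInt_pos (fun x => c * f (c * x)) l.
Proof.
  intros Hc H P HP; specialize (H P HP).
  destruct H as [Q1 Q2 H1 H2 H].
  apply Filter_prod with (fun x => Q1 (c * x)) (fun x => Q2 (c * x)).
  - destruct H1 as [d Hd].
    assert (Hdc : 0 < d / c) by (apply Rdiv_lt_0_compat; [apply cond_pos|easy]).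
    exists (mkposreal _ Hdc); intros x Hx Hx0.
    apply Hd; [|now apply Rmult_lt_0_compat].
    unfold ball in *; simpl in *; unfold AbsRing_ball, abs, minus, plus, opp in *; simpl in *.
    rewrite Ropp_0, Rplus_0_r in *.
    rewrite Rabs_pos_eq in * by nra.
    apply Rmult_lt_compat_l with (r := c) in Hx; [|easy].
    replace (c * (d / c)) with (pos d) in Hx by (field; lra). easy.
  - destruct H2 as [M HM]; exists (M / c); intros x Hx; apply HM.
    apply Rmult_lt_compat_l with (r := c) in Hx; [|easy].
    replace (c * (M / c)) with M in Hx by (field; lra). easy.
  - intros x y Hx Hy; destruct (H _ _ Hx Hy) as [z [Hz1 Hz2]]; simpl in *.
    exists z; split; [|easy].
    assert (W := is_RInt_comp_lin f c 0 x y z).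
    rewrite !Rplus_0_r in W; specialize (W Hz1).
    apply is_RInt_ext with (2 := W); intros; rewrite Rplus_0_r; reflexivity.
Qed.

(** * The Mellin transform of t / (1 + t^2) *)

Lemma Rpower_1_l c : Rpower 1 c = 1.
Proof. unfold Rpower; rewrite ln_1, Rmult_0_r; apply exp_0. Qed.

Lemma Rpower_nat_add x c n : 0 < x -> Rpower x (INR n + c) = x ^ n * Rpower x c.
Proof. intros Hx; rewrite Rpower_plus, Rpower_pow; easy. Qed.

Lemma Rpower_shift_exp x c d n : 0 < x -> d = INR n + c -> Rpower x d = x ^ n * Rpower x c.
Proof. intros Hx ->; now apply Rpower_nat_add. Qed.

(** With an odd number of terms the term 0 stays alone and the others pair up with opposite signs;
    each pair of the cosecant series is a cotangent term at x/2 plus one at (1-x)/2. *)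
Lemma bsum_odd_pairs (h : nat -> R) J :
  bsum h (S (2 * J)) = h O + bsum (fun j => h (2 * j + 1)%nat + h (2 * j + 2)%nat) J.
Proof.
  induction J as [|J IH]; [simpl; ring|].
  replace (S (2 * S J)) with (S (S (S (2 * J)))) by lia.
  change (bsum h (S (2 * J)) + h (S (2 * J)) + h (S (S (2 * J))) =
    h O + (bsum (fun j => h (2 * j + 1)%nat + h (2 * j + 2)%nat) J
     + (h (2 * J + 1)%nat + h (2 * J + 2)%nat))).
  replace (2 * J + 1)%nat with (S (2 * J)) by lia.
  replace (2 * J + 2)%nat with (S (S (2 * J))) by lia.
  rewrite IH; ring.
Qed.

Lemma is_lim_seq_bsum_series g l : is_series g l -> is_lim_seq (bsum g) l.
Proof.
  intros H; apply is_lim_seq_incr_1.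
  apply is_lim_seq_ext with (sum_n g); [intros; apply bsum_sum_n|exact H].
Qed.

(** Half the sum of cot(PI x/2) and cot(PI (1-x)/2) = tan(PI x/2) equals 1/sin(PI x). Odd partial
    sums are enough for the later squeeze. *)
Lemma cosecant_series x : 0 < x < 1 ->
  is_lim_seq (fun J => bsum (fun k => (-1) ^ k * (/ (INR k + 1 - x) + / (INR k + x))) (S (2 * J)))
    (PI / sin (PI * x)).
Proof.
  intros Hx.
  assert (P := PI_RGT_0).
  assert (L1 := is_lim_seq_bsum_series _ _ (cot_series (x / 2) ltac:(lra))).
  assert (L2 := is_lim_seq_bsum_series _ _ (cot_series ((1 - x) / 2) ltac:(lra))).
  apply is_lim_seq_ext with (fun J => / (1 - x) + / x - / 2 *
    (bsum (fun k => 2 * (x / 2) / (INR (S k) ^ 2 - (x / 2) ^ 2)) J +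
     bsum (fun k => 2 * ((1 - x) / 2) / (INR (S k) ^ 2 - ((1 - x) / 2) ^ 2)) J)).
  - intros J; rewrite bsum_odd_pairs, <- bsum_plus.
    match goal with |- ?a - / 2 * ?b = _ => replace (a - / 2 * b) with (a + - / 2 * b) by ring end.
    rewrite <- bsum_scal.
    simpl (INR 0); f_equal.
    { simpl. field. lra. }
    apply bsum_ext; intros k Hk.
    replace (2 * k + 2)%nat with (S (2 * k + 1)) by lia.
    cbn [pow]. rewrite pow_add, pow_1, pow_1_even.
    rewrite !S_INR, plus_INR, mult_INR. simpl (INR 1). simpl (INR 2).
    assert (Q := pos_INR k).
    field. repeat split; nra.
  - apply is_lim_seq_replace with (/ (1 - x) + / x - / 2 *
      ((/ (x / 2) - PI * cos (PI * (x / 2)) / sin (PI * (x / 2))) +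
       (/ ((1 - x) / 2) - PI * cos (PI * ((1 - x) / 2)) / sin (PI * ((1 - x) / 2))))).
    + apply is_lim_seq_minus'; [apply is_lim_seq_const|].
      apply is_lim_seq_mult'; [apply is_lim_seq_const|].
      apply is_lim_seq_plus'; easy.
    + replace (PI * ((1 - x) / 2)) with (PI / 2 - PI * (x / 2)) by field.
      rewrite cos_shift, sin_shift.
      replace (PI * x) with (2 * (PI * (x / 2))) by field. rewrite sin_2a.
      assert (S1 : 0 < sin (PI * (x / 2))) by (apply sin_gt_0; nra).
      assert (C1 : 0 < cos (PI * (x / 2))) by (apply cos_gt_0; nra).
      assert (E := sin2_cos2 (PI * (x / 2))). unfold Rsqr in E.
      set (s := sin _) in *; set (c := cos _) in *.
      transitivity (PI * (s * s + c * c) / (2 * s * c)); [field; lra|].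
      rewrite E; field; lra.
Qed.

Lemma is_derive_comp_inv F f u : 0 < u -> is_derive F (/ u) (f (/ u)) ->
  is_derive (fun t => F (/ t)) u (- f (/ u) / u ^ 2).
Proof.
  intros Hu H.
  replace (- f (/ u) / u ^ 2) with (scal (- / u ^ 2) (f (/ u))).
  2:{ unfold scal; simpl; unfold mult; simpl; field; lra. }
  apply (is_derive_comp F Rinv); [easy|].
  auto_derive; [lra|]. field; lra.
Qed.

Lemma is_derive_bsum (h h' : nat -> R -> R) n x :
  (forall k, is_derive (h k) x (h' k x)) ->
  is_derive (fun t => bsum (fun k => h k t) n) x (bsum (fun k => h' k x) n).
Proof.
  intros H; induction n as [|n IH]; simpl; [apply @is_derive_const|].
  apply (is_derive_plus (fun t => bsum (fun k => h k t) n)); easy.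
Qed.

Lemma bsum_geom q n : 1 - q <> 0 -> bsum (fun k => q ^ k) n = (1 - q ^ n) / (1 - q).
Proof.
  intros H; induction n as [|n IH]; simpl; [field; easy|].
  rewrite IH; field; easy.
Qed.

Section MellinKernel.
Variable s : R.
Hypothesis Hs : 0 < s < 2.

Let f t := Rpower t (1 - s) / (1 + t ^ 2).

Lemma mellin_kernel_antiderivative : exists F A B,
    (forall x, 0 < x -> is_derive F x (f x)) /\
    filterlim F (at_right 0) (locally A) /\
    filterlim F (Rbar_locally p_infty) (locally B).
Proof.
  destruct (antiderivative_of_power_dominated f (1 - s) (-1 - s) 1) as (F & A & B & H1 & H2 & H3 & _);
    try lra.
  - intros x Hx.
    apply (continuous_mult (fun t => Rpower t (1 - s)) (fun t => / (1 + t ^ 2))).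
    + now apply continuous_Rpower.
    + apply (@ex_derive_continuous R_AbsRing R_NormedModule). auto_derive. nra.
  - intros x Hx; unfold f.
    assert (P := Rpower_pos x (1 - s)).
    assert (0 < 1 + x ^ 2) by nra.
    rewrite Rabs_pos_eq, Rmult_1_l by (apply Rdiv_le_0_compat; lra).
    apply Rle_div_l; [easy|]. nra.
  - intros x Hx; unfold f.
    assert (P := Rpower_pos x (-1 - s)).
    assert (0 < 1 + x ^ 2) by nra.
    rewrite (Rpower_shift_exp x (-1 - s) _ 2) by (try (simpl (INR 2)); lra).
    rewrite Rabs_pos_eq, Rmult_1_l by (apply Rdiv_le_0_compat; nra).
    apply Rle_div_l; [easy|]. nra.
  - exists F, A, B; auto.
Qed.

Lemma mellin_kernel : is_RInt_pos f (PI / 2 / sin (PI * s / 2)).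
Proof.
  destruct mellin_kernel_antiderivative as (F & A & B & HF & HA & HB).
  assert (HI : is_RInt_pos f (B - A)).
  { apply is_RInt_pos_antiderivative with F; auto.
    intros x Hx.
    apply (continuous_mult (fun t => Rpower t (1 - s)) (fun t => / (1 + t ^ 2))).
    + now apply continuous_Rpower.
    + apply (@ex_derive_continuous R_AbsRing R_NormedModule). auto_derive. nra. }
  enough (E : B - A = PI / 2 / sin (PI * s / 2)) by (rewrite <- E; exact HI).
  (* Inversion [u -> 1/u] folds the integral onto (0,1), where 1/(1+u^2) is expanded. *)
  set (G := fun u => F (/ u) - F u).
  set (g := fun u => - ((Rpower u (1 - s) + Rpower u (s - 1)) / (1 + u ^ 2))).
  set (h := fun (k : nat) u => (-1) ^ k / (2 * INR k + 1 - s + 1) * Rpower u (2 * INR k + 1 - s + 1)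
     + (-1) ^ k / (2 * INR k + s - 1 + 1) * Rpower u (2 * INR k + s - 1 + 1)).
  set (h' := fun (k : nat) u => (-1) ^ k * Rpower u (2 * INR k + 1 - s)
     + (-1) ^ k * Rpower u (2 * INR k + s - 1)).
  (* After [k] terms the geometric remainder is at most u^(2k) (u^(1-s) + u^(s-1)); [W k] is the
     antiderivative of this bound, nonnegative on (0,1], so [W K 1] bounds the integrated error. *)
  set (W := fun (k : nat) u => 1 / (2 * INR k + 1 - s + 1) * Rpower u (2 * INR k + 1 - s + 1)
     + 1 / (2 * INR k + s - 1 + 1) * Rpower u (2 * INR k + s - 1 + 1)).
  assert (Hh : forall k u, 0 < u -> is_derive (h k) u (h' k u)).
  { intros k u Hu; assert (Q := pos_INR k).
    apply (is_derive_plus (fun t => _ / _ * Rpower t _) (fun t => _ / _ * Rpower t _));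
     apply is_derive_Rpower_antiderivative; lra. }
  assert (HW : forall k u, 0 < u -> is_derive (W k) u (1 * Rpower u (2 * INR k + 1 - s)
     + 1 * Rpower u (2 * INR k + s - 1))).
  { intros k u Hu; assert (Q := pos_INR k).
    apply (is_derive_plus (fun t => _ / _ * Rpower t _) (fun t => _ / _ * Rpower t _));
     apply is_derive_Rpower_antiderivative; lra. }
  assert (HG : forall u, 0 < u -> is_derive G u (g u)).
  { intros u Hu; assert (Hi : 0 < / u) by now apply Rinv_0_lt_compat.
    replace (g u) with (- f (/ u) / u ^ 2 - f u).
    - apply (is_derive_minus (fun t => F (/ t)) F); [apply is_derive_comp_inv|]; auto.
    - unfold f, g.
      replace (Rpower (/ u) (1 - s)) with (Rpower u (s - 1)).
      + field. split; nra.
      + unfold Rpower; f_equal; rewrite ln_Rinv by easy; ring. }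
  assert (G1 : G 1 = 0) by (unfold G; rewrite Rinv_1; ring).
  assert (LG : filterlim G (at_right 0) (locally (B - A))).
  { apply filterlim_Rminus; [|exact HA].
    apply filterlim_comp with (2 := HB). exact filterlim_Rinv_0_right. }
  assert (Bd : forall K, Rabs (B - A - bsum (fun k => h k 1) K) <= W K 1).
  { intros K; assert (QK := pos_INR K).
    assert (N1 : forall u, 0 < u <= 1 ->
      Rabs (G u + bsum (fun k => h k u) K - bsum (fun k => h k 1) K) <= W K 1).
    { intros u Hu.
      assert (I := increment_le (fun t => G t + bsum (fun k => h k t) K) (W K)
        (fun t => g t + bsum (fun k => h' k t) K)
        (fun t => 1 * Rpower t (2 * INR K + 1 - s) + 1 * Rpower t (2 * INR K + s - 1)) u 1 ltac:(lra)).
      assert (W0 : 0 <= W K u).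
      { unfold W; assert (P1 := Rpower_pos u (2 * INR K + 1 - s + 1)).
        assert (P2 := Rpower_pos u (2 * INR K + s - 1 + 1)).
        apply Rplus_le_le_0_compat; apply Rmult_le_pos; try lra; apply Rdiv_le_0_compat; lra. }
      cbv beta in I; rewrite G1, Rplus_0_l in I.
      rewrite <- Rabs_Ropp.
      replace (- _) with (bsum (fun k => h k 1) K - (G u + bsum (fun k => h k u) K)) by ring.
      eapply Rle_trans; [apply I|lra].
      - intros t Ht; apply (is_derive_plus G); [apply HG; lra|].
        apply is_derive_bsum; intros k; apply Hh; lra.
      - intros t Ht; apply HW; lra.
      - intros t Ht.
        assert (E : forall k c, Rpower t (2 * INR k + c) = (t ^ 2) ^ k * Rpower t c).
        { intros k c; rewrite <- pow_mult. apply Rpower_shift_exp; [lra|].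
          rewrite mult_INR; simpl (INR 2); ring. }
        set (m := Rpower t (1 - s) + Rpower t (s - 1)).
        assert (Pm : 0 < m).
        { unfold m; assert (P1 := Rpower_pos t (1 - s)); assert (P2 := Rpower_pos t (s - 1)); lra. }
        assert (T2 : 0 < 1 + t ^ 2) by nra.
        assert (TK : 0 <= (t ^ 2) ^ K) by (apply pow_le; nra).
        replace (1 * Rpower t (2 * INR K + 1 - s) + 1 * Rpower t (2 * INR K + s - 1))
          with ((t ^ 2) ^ K * m).
        2:{ unfold Rminus; rewrite !Rplus_assoc, !E; unfold m, Rminus; ring. }
        replace (bsum (fun k => h' k t) K) with (m * ((1 - (- t ^ 2) ^ K) / (1 - - t ^ 2))).
        2:{ rewrite <- bsum_geom by lra. rewrite <- bsum_scal. apply bsum_ext; intros k Hk.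
            unfold h', Rminus; rewrite !Rplus_assoc, !E.
            replace (- t ^ 2) with (-1 * t ^ 2) by ring. rewrite Rpow_mult_distr.
            unfold m, Rminus; ring. }
        unfold g; fold m.
        replace (- (m / (1 + t ^ 2)) + m * ((1 - (- t ^ 2) ^ K) / (1 - - t ^ 2)))
          with (- (m * (- t ^ 2) ^ K / (1 + t ^ 2))) by (field; lra).
        rewrite Rabs_Ropp. unfold Rdiv; rewrite !Rabs_mult, <- RPow_abs, Rabs_Ropp.
        rewrite (Rabs_pos_eq m), (Rabs_pos_eq (t ^ 2)) by (try nra; lra).
        rewrite Rabs_pos_eq by (apply Rlt_le, Rinv_0_lt_compat; easy).
        change (m * (t ^ 2) ^ K / (1 + t ^ 2) <= (t ^ 2) ^ K * m).
        apply Rle_div_l; [easy|].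
        assert (0 <= (t ^ 2) ^ K * m) by (apply Rmult_le_pos; lra). nra. }
    assert (Lh : filterlim (fun u => bsum (fun k => h k u) K) (at_right 0) (locally 0)).
    { generalize K; intros n; induction n as [|n IH]; simpl; [apply filterlim_const|].
      assert (Qn := pos_INR n).
      apply filterlim_replace with (0 + ((-1) ^ n / (2 * INR n + 1 - s + 1) * 0 + (-1) ^ n / (2 * INR n + s - 1 + 1) * 0)); [|ring].
      apply filterlim_Rplus; [exact IH|].
      apply filterlim_Rplus; apply filterlim_Rscal, filterlim_Rpower_0; lra. }
    apply (filterlim_Rle_abs (Fl := at_right 0) (fun u => G u + bsum (fun k => h k u) K - bsum (fun k => h k 1) K)).
    - apply filterlim_replace with (B - A + 0 - bsum (fun k => h k 1) K); [|ring].
      apply filterlim_Rminus; [|apply filterlim_const].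
      now apply filterlim_Rplus.
    - generalize (at_right_0_lt 1 Rlt_0_1); apply filter_imp; intros u Hu; apply N1; lra. }
  (* At 1 the integrated terms are 1/(2k+2-s) + 1/(2k+s), half the cosecant terms at x = s/2. *)
  assert (L1 : is_lim_seq (fun J => bsum (fun k => h k 1) (S (2 * J))) (/ 2 * (PI / sin (PI * (s / 2))))).
  { apply is_lim_seq_ext with (fun J => / 2 * bsum (fun k => (-1) ^ k * (/ (INR k + 1 - s / 2) + / (INR k + s / 2))) (S (2 * J))).
    - intros J; rewrite <- bsum_scal; apply bsum_ext; intros k Hk.
      unfold h; rewrite !Rpower_1_l. assert (Q := pos_INR k). field. repeat split; lra.
    - apply is_lim_seq_mult'; [apply is_lim_seq_const|]. apply cosecant_series; lra. }
  assert (L2 : is_lim_seq (fun J => bsum (fun k => h k 1) (S (2 * J))) (B - A)).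
  { apply is_lim_seq_le_le with (u := fun J => B - A - 2 / INR (S J)) (w := fun J => B - A + 2 / INR (S J)).
    - intros J; specialize (Bd (S (2 * J))); apply Rabs_le_between in Bd.
      enough (W (S (2 * J)) 1 <= 2 / INR (S J)) by lra.
      unfold W; rewrite !Rpower_1_l, !S_INR, mult_INR; simpl (INR 2).
      assert (Q := pos_INR J). set (j := INR J) in *.
      assert (E : forall z, j + 1 <= z -> 1 / z * 1 <= / (j + 1)).
      { intros z Hz; replace (1 / z * 1) with (/ z) by (field; lra). apply Rinv_le_contravar; lra. }
      replace (2 / (j + 1)) with (/ (j + 1) + / (j + 1)) by (field; lra).
      apply Rplus_le_compat; apply E; lra.
    - apply is_lim_seq_replace with (B - A - 0); [|ring].
      apply is_lim_seq_minus'; [apply is_lim_seq_const|apply is_lim_seq_div_INR_S].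
    - apply is_lim_seq_replace with (B - A + 0); [|ring].
      apply is_lim_seq_plus'; [apply is_lim_seq_const|apply is_lim_seq_div_INR_S]. }
  apply is_lim_seq_unique in L1; apply is_lim_seq_unique in L2.
  rewrite L2 in L1; injection L1; intros ->.
  replace (PI * (s / 2)) with (PI * s / 2) by field. 
  unfold Rdiv; ring.
Qed.
End MellinKernel.

(** * Mellin transforms on the strip 1 < s < 2 *)

Lemma exp_le_compat x y : x <= y -> exp x <= exp y.
Proof. intros [H| ->]; [left; now apply exp_increasing|right; reflexivity]. Qed.

(** All terms are positive and at most t/(k+1)^2. Letting the upper index grow gives the bound t/N,
    with the dependence on t explicit so that it can be integrated. *)
Lemma bose_reg_tail t N : 0 < t -> (1 <= N)%nat ->
  0 <= PI * bose_reg t - bsum (fun k => t / (INR (S k) ^ 2 + t ^ 2)) N <= t / INR N.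
Proof.
  intros Ht HN.
  destruct (bose_reg_series_bound t Ht) as (K & HK & H).
  set (g := fun k => t / (INR (S k) ^ 2 + t ^ 2)).
  assert (Pk : forall k, 0 < INR (S k)) by (intros; apply lt_0_INR; lia).
  assert (Hg : forall k, 0 <= g k <= t * / INR (S k) ^ 2).
  { intros k; assert (Q := Pk k). unfold g; split.
    - apply Rdiv_le_0_compat; nra.
    - unfold Rdiv; apply Rmult_le_compat_l; [lra|]. apply Rinv_le_contravar; nra. }
  assert (L : is_lim_seq (fun n => bsum g (N + n) - bsum g N) (PI * bose_reg t - bsum g N)).
  { apply is_lim_seq_minus'; [|apply is_lim_seq_const].
    apply is_lim_seq_ext with (fun n => bsum g (n + N)); [intros; now rewrite Nat.add_comm|].
    apply (is_lim_seq_incr_n (bsum g)), is_lim_seq_incr_1.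
    apply is_lim_seq_le_le with (u := fun n => PI * bose_reg t - (K / 2) / INR (S n)) (w := fun n => PI * bose_reg t + (K / 2) / INR (S n)).
    - intros n; specialize (H (S n) ltac:(lia)).
      rewrite (bsum_ext _ (fun k => 2 * g k)) in H by (intros; unfold g, Rdiv; ring).
      rewrite bsum_scal in H. apply Rabs_le_between in H.
      replace (K / 2 / INR (S n)) with (K / INR (S n) / 2) by (field; assert (Q := Pk n); lra). lra.
    - apply is_lim_seq_replace with (PI * bose_reg t - 0); [|ring].
      apply is_lim_seq_minus'; [apply is_lim_seq_const|apply is_lim_seq_div_INR_S].
    - apply is_lim_seq_replace with (PI * bose_reg t + 0); [|ring].
      apply is_lim_seq_plus'; [apply is_lim_seq_const|apply is_lim_seq_div_INR_S]. }
  assert (B : forall n, 0 <= bsum g (N + n) - bsum g N <= t / INR N).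
  { intros n. rewrite bsum_split.
    replace (_ + _ - _) with (bsum (fun k => g (N + k)%nat) n) by ring.
    assert (U : Rabs (bsum (fun k => g (N + k)%nat) n) <= bsum (fun k => t * / INR (S (N + k)) ^ 2) n).
    { apply bsum_Rabs_le; intros k Hk; rewrite Rabs_pos_eq; apply Hg. }
    rewrite bsum_scal in U.
    assert (T := bsum_inv_sqr_tail N n HN).
    assert (0 < / INR (N + n)) by (apply Rinv_0_lt_compat, lt_0_INR; lia).
    split.
    - clear -Hg; induction n as [|n IH]; simpl; [lra|]. assert (Q := Hg (N + n)%nat); lra.
    - eapply Rle_trans; [apply Rle_abs|]. eapply Rle_trans; [apply U|].
      unfold Rdiv; apply Rmult_le_compat_l; lra. }
  split.
  - apply (is_lim_seq_le (fun _ => 0) _ 0 _ (fun n => proj1 (B n))) in L; [exact L|apply is_lim_seq_const].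
  - apply (is_lim_seq_le _ (fun _ => t / INR N) _ (t / INR N) (fun n => proj2 (B n))) in L; [exact L|apply is_lim_seq_const].
Qed.

Lemma bose_reg_nonneg_le t : 0 < t -> 0 <= bose_reg t <= t.
Proof.
  intros Ht; assert (B := bose_reg_tail t 1 Ht (le_n 1)). simpl in B.
  assert (P := PI2_3_2).
  assert (Q : 0 <= t / (1 * (1 * 1) + t * (t * 1)) <= t).
  { split; [apply Rdiv_le_0_compat; nra|]. apply Rle_div_l; nra. }
  nra.
Qed.

Lemma bose_reg_le_half t : 0 < t -> bose_reg t <= / 2.
Proof.
  intros Ht; unfold bose_reg, bose.
  assert (P := PI_RGT_0).
  assert (H : 0 < 2 * PI * t) by (apply Rmult_lt_0_compat; lra).
  assert (E := exp_ineq1 (2 * PI * t) ltac:(lra)).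
  assert (/ (exp (2 * PI * t) - 1) <= / (2 * PI * t)) by (apply Rinv_le_contravar; lra).
  lra.
Qed.

(** Interpolation: the tail is at most t/N and also at most PI/2 <= 2, hence at most 2 (t/N)^theta.
    A fractional exponent is needed because t^(1-s) is not integrable at infinity for s < 2, while a
    bound without N would not tend to 0. *)
Lemma bose_reg_tail_power t N theta : 0 < t -> (1 <= N)%nat -> 0 <= theta <= 1 ->
  Rabs (PI * bose_reg t - bsum (fun k => t / (INR (S k) ^ 2 + t ^ 2)) N)
  <= 2 * Rpower (INR N) (- theta) * Rpower t theta.
Proof.
  intros Ht HN Hth.
  assert (B := bose_reg_tail t N Ht HN).
  rewrite Rabs_pos_eq by apply B.
  assert (PN : 0 < INR N) by (apply lt_0_INR; lia).
  replace (2 * _ * _) with (2 * Rpower (t / INR N) theta).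
  2:{ unfold Rdiv; rewrite <- Rpower_mult_distr by (try apply Rinv_0_lt_compat; easy).
      replace (Rpower (/ INR N) theta) with (Rpower (INR N) (- theta)); [ring|].
      unfold Rpower; f_equal; rewrite ln_Rinv by easy; ring. }
  destruct (Rle_dec t (INR N)) as [H|H].
  - assert (Hq : 0 < t / INR N <= 1).
    { split; [now apply Rdiv_lt_0_compat|]. apply Rle_div_l; lra. }
    set (q := t / INR N) in *.
    assert (q <= Rpower q theta).
    { rewrite <- (Rpower_1 q) at 1 by easy. unfold Rpower.
      assert (ln q <= 0). { rewrite <- ln_1. apply ln_le; lra. }
      apply exp_le_compat; nra. }
    lra.
  - assert (Hq : 1 <= t / INR N) by (apply Rle_div_r; lra).
    set (q := t / INR N) in *.
    assert (1 <= Rpower q theta).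
    { rewrite <- exp_0. unfold Rpower.
      assert (0 <= ln q). { rewrite <- ln_1. apply ln_le; lra. }
      apply exp_le_compat; nra. }
    assert (P4 := PI_4). assert (PP := PI_RGT_0).
    assert (Q := bose_reg_le_half t Ht).
    assert (G : 0 <= bsum (fun k => t / (INR (S k) ^ 2 + t ^ 2)) N).
    { clear -Ht; induction N as [|N IH]; simpl bsum; [lra|].
      apply Rplus_le_le_0_compat; [easy|]. apply Rdiv_le_0_compat; [lra|].
      assert (Q := pow2_ge_0 (INR (S N))). nra. }
    nra.
Qed.

Lemma continuous_bose_reg t : 0 < t -> continuous bose_reg t.
Proof.
  intros Ht; apply (@ex_derive_continuous R_AbsRing R_NormedModule).
  unfold bose_reg, bose; auto_derive.
  assert (E := exp_2PI_gt_1 t Ht). assert (P := PI_RGT_0).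
  assert (0 < 2 * PI * t) by (apply Rmult_lt_0_compat; lra).
  repeat split; lra.
Qed.

Lemma continuous_Rmult (f g : R -> R) x : continuous f x -> continuous g x ->
  continuous (fun t => f t * g t) x.
Proof. apply (@continuous_mult R_UniformSpace R_AbsRing). Qed.

Lemma mellin_scaled_kernel s n : 0 < s < 2 -> 0 < n ->
  is_RInt_pos (fun t => Rpower t (- s) * (t / (n ^ 2 + t ^ 2)))
    (Rpower n (- s) * (PI / 2 / sin (PI * s / 2))).
Proof.
  intros Hs Hn.
  assert (Hi : 0 < / n) by now apply Rinv_0_lt_compat.
  assert (H := is_RInt_pos_scal (Rpower n (- s)) _ _
     (is_RInt_pos_comp_scal _ _ (/ n) Hi (mellin_kernel s Hs))).
  revert H; apply is_RInt_pos_ext; intros t Ht; cbv beta.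
  rewrite <- Rpower_mult_distr by easy.
  replace (Rpower (/ n) (1 - s)) with (/ n * Rpower n s).
  2:{ replace (1 - s) with (1 + - s) by ring. rewrite Rpower_plus, Rpower_1 by easy.
      f_equal. unfold Rpower; f_equal; rewrite ln_Rinv by easy; ring. }
  rewrite (Rpower_shift_exp t (- s) (1 - s) 1) by (simpl; lra).
  replace (Rpower n (- s)) with (/ Rpower n s) by (symmetry; apply Rpower_Ropp).
  assert (Q := Rpower_pos n s).
  field. repeat split; nra.
Qed.

(** The first [N] partial fractions integrate to multiples of n^(-s) by [mellin_scaled_kernel], and
    the integral of the tail is O(N^(-theta)), which justifies the exchange. *)
Lemma mellin_bose_reg s Z : 1 < s < 2 ->
  is_series (fun k => Rpower (INR (S k)) (- s)) Z ->
  is_RInt_pos (fun t => Rpower t (- s) * bose_reg t) (Z * (/ 2 / sin (PI * s / 2))).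
Proof.
  intros Hs HZ.
  assert (P := PI_RGT_0).
  destruct (ex_RInt_pos_power_dominated (fun t => Rpower t (- s) * bose_reg t) (1 - s) (- s) 1)
    as (V & HV & _); try lra.
  - intros t Ht; apply continuous_Rmult; [now apply continuous_Rpower|now apply continuous_bose_reg].
  - intros t Ht; rewrite (Rpower_shift_exp t (- s) (1 - s) 1) by (simpl; lra).
    assert (Q := Rpower_pos t (- s)); assert (B := bose_reg_nonneg_le t ltac:(lra)).
    rewrite Rabs_pos_eq; [nra|]. apply Rmult_le_pos; lra.
  - intros t Ht.
    assert (Q := Rpower_pos t (- s)); assert (B := bose_reg_nonneg_le t ltac:(lra)).
    assert (B' := bose_reg_le_half t ltac:(lra)).
    rewrite Rabs_pos_eq; [nra|]. apply Rmult_le_pos; lra.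
  - enough (E : V = Z * (/ 2 / sin (PI * s / 2))) by (rewrite <- E; exact HV).
    set (c := PI / 2 / sin (PI * s / 2)).
    (* Any value strictly between 0 and s - 1 serves: then t^(-s+theta) is integrable at infinity
       and N^(-theta) tends to 0. *)
    set (theta := (s - 1) / 2).
    set (r := fun N t => Rpower t (- s) * (PI * bose_reg t - bsum (fun k => t / (INR (S k) ^ 2 + t ^ 2)) N)).
    assert (Hr : forall N, is_RInt_pos (r N) (PI * V - bsum (fun k => Rpower (INR (S k)) (- s) * c) N)).
    { intros N.
      assert (H := is_RInt_pos_minus _ _ _ _ (is_RInt_pos_scal PI _ _ HV)
        (is_RInt_pos_bsum (fun k t => Rpower t (- s) * (t / (INR (S k) ^ 2 + t ^ 2))) _ N
          (fun k => mellin_scaled_kernel s (INR (S k)) ltac:(lra) ltac:(apply lt_0_INR; lia)))).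
      revert H; apply is_RInt_pos_ext; intros t Ht.
      unfold r; rewrite bsum_scal; ring. }
    assert (Bd : forall N, (1 <= N)%nat ->
      Rabs (PI * V - bsum (fun k => Rpower (INR (S k)) (- s) * c) N)
        <= 2 * Rpower (INR N) (- theta) * (/ (2 - s) + 2 / (s - 1))).
    { intros N HN.
      assert (PN : 1 <= INR N) by (apply (le_INR 1); easy).
      assert (Q0 := Rpower_pos (INR N) (- theta)).
      destruct (ex_RInt_pos_power_dominated (r N) (1 - s) (- s + theta) (2 * Rpower (INR N) (- theta))) as (l & Hl & Bl);
       try lra; try (unfold theta; lra).
      - intros t Ht; apply continuous_Rmult; [now apply continuous_Rpower|].
        apply (continuous_minus (fun t => PI * bose_reg t)).
        + apply continuous_Rmult; [apply continuous_const|now apply continuous_bose_reg].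
        + clear -Ht; induction N as [|N IH]; [apply continuous_const|].
          apply (continuous_plus (fun t => bsum (fun k => t / (INR (S k) ^ 2 + t ^ 2)) N)); [easy|].
          apply (@ex_derive_continuous R_AbsRing R_NormedModule).
          auto_derive. assert (Q := pow2_ge_0 (INR (S N))). 
          change (INR (S N) ^ 2 + t ^ 2 <> 0). nra.
      (* Near 0 the exponent must be 1, since t^(-s+theta) is not integrable there; N^(-1) <=
         N^(-theta) then unifies the constants. *)
      - intros t Ht; unfold r.
        assert (B := bose_reg_tail_power t N 1 ltac:(lra) HN ltac:(lra)).
        assert (M : Rpower (INR N) (- (1)) <= Rpower (INR N) (- theta)).
        { apply Rle_Rpower; [easy|]. unfold theta; lra. }
        rewrite Rpower_1 in B by lra.
        rewrite (Rpower_shift_exp t (- s) (1 - s) 1) by (simpl; lra).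
        assert (Q := Rpower_pos t (- s)).
        rewrite Rabs_mult, (Rabs_pos_eq (Rpower _ _)) by lra.
        apply Rle_trans with (Rpower t (- s) * (2 * Rpower (INR N) (- theta) * t)); [|simpl; lra].
        apply Rmult_le_compat_l; [lra|]. nra.
      - intros t Ht; unfold r.
        assert (B := bose_reg_tail_power t N theta ltac:(lra) HN ltac:(unfold theta; lra)).
        rewrite Rpower_plus.
        assert (Q := Rpower_pos t (- s)).
        rewrite Rabs_mult, (Rabs_pos_eq (Rpower _ _)) by lra.
        nra.
      - rewrite (is_RInt_pos_unique _ _ _ (Hr N) Hl).
        replace (/ (2 - s) + 2 / (s - 1)) with (/ (1 - s + 1) - / (- s + theta + 1)); [easy|].
        unfold theta; field; lra. }
    assert (LN : is_lim_seq (fun n => Rpower (INR (S n)) (- theta)) 0).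
    { apply (is_lim_seq_incr_1 (fun n => Rpower (INR n) (- theta))).
      assert (L := filterlim_Rpower_infty (- theta) ltac:(unfold theta; lra)).
      apply filterlim_comp with (2 := L). apply is_lim_seq_INR. }
    assert (L1 : is_lim_seq (fun n => bsum (fun k => Rpower (INR (S k)) (- s) * c) (S n)) (PI * V)).
    { set (D := / (2 - s) + 2 / (s - 1)).
      apply is_lim_seq_le_le with (u := fun n => PI * V - 2 * D * Rpower (INR (S n)) (- theta))
       (w := fun n => PI * V + 2 * D * Rpower (INR (S n)) (- theta)).
      - intros n; specialize (Bd (S n) ltac:(lia)); fold D in Bd; apply Rabs_le_between in Bd; lra.
      - apply is_lim_seq_replace with (PI * V - 2 * D * 0); [|ring].
        apply is_lim_seq_minus'; [apply is_lim_seq_const|].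
        apply is_lim_seq_mult'; [apply is_lim_seq_const|easy].
      - apply is_lim_seq_replace with (PI * V + 2 * D * 0); [|ring].
        apply is_lim_seq_plus'; [apply is_lim_seq_const|].
        apply is_lim_seq_mult'; [apply is_lim_seq_const|easy]. }
    assert (L2 : is_lim_seq (fun n => bsum (fun k => Rpower (INR (S k)) (- s) * c) (S n)) (c * Z)).
    { apply is_lim_seq_ext with (fun n => c * sum_n (fun k => Rpower (INR (S k)) (- s)) n).
      - intros n; rewrite bsum_sum_n, <- bsum_scal; apply bsum_ext; intros; ring.
      - apply is_lim_seq_mult'; [apply is_lim_seq_const|exact HZ]. }
    apply is_lim_seq_unique in L1; apply is_lim_seq_unique in L2.
    rewrite L2 in L1; injection L1; intros E.
    apply Rmult_eq_reg_l with PI; [|lra].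
    rewrite <- E; unfold c, Rdiv; ring.
Qed.

(* (atan t)/pi and t/(2 pi (1 + t^2)) have the Mellin transforms of 1/(s-1) and 1/2 up to the
   common factor 2 sin(pi s/2); together they cancel 1/2 - 1/(2 pi t) up to O(t^(-3)) at infinity. *)
Definition bose_rem (t : R) := bose_reg t - atan t / PI - t / (2 * PI * (1 + t ^ 2)).
Definition bose_main (t : R) := (atan t - PI / 2) / PI + t / (2 * PI * (1 + t ^ 2)) + / (2 * PI * t).

Lemma bose_decomp t : 0 < t -> bose t = bose_rem t + bose_main t.
Proof.
  intros Ht; assert (P := PI_RGT_0). unfold bose_rem, bose_main, bose_reg.
  field. repeat split; try nra.
Qed.

Lemma atan_bounds v : 0 <= v -> v - v ^ 3 / 3 <= atan v <= v.
Proof.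
  intros Hv.
  assert (D : forall t, is_derive atan t (/ (1 + t ^ 2))).
  { intros t; apply is_derive_Reals. apply derivable_pt_lim_atan. }
  assert (A0 := atan_0).
  assert (I1 := increment_le atan (fun t => t) (fun t => / (1 + t ^ 2)) (fun _ => 1) 0 v Hv).
  assert (I2 := increment_le (fun t => t - atan t) (fun t => t ^ 3 / 3) (fun t => 1 - / (1 + t ^ 2)) (fun t => t ^ 2) 0 v Hv).
  assert (B1 : Rabs (atan v - atan 0) <= v - 0).
  { apply I1.
    - intros; apply D.
    - intros; auto_derive; auto.
    - intros t Ht. rewrite Rabs_pos_eq.
      + rewrite <- Rinv_1. apply Rinv_le_contravar; nra.
      + apply Rlt_le, Rinv_0_lt_compat; nra. }
  assert (B2 : Rabs ((v - atan v) - (0 - atan 0)) <= v ^ 3 / 3 - 0 ^ 3 / 3).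
  { apply I2.
    - intros t Ht. apply (is_derive_minus (fun t => t) atan); [apply (@is_derive_id R_AbsRing)|apply D].
    - intros t Ht; auto_derive; auto. field.
    - intros t Ht.
      replace (1 - / (1 + t ^ 2)) with (t ^ 2 / (1 + t ^ 2)) by (field; nra).
      rewrite Rabs_pos_eq by (apply Rdiv_le_0_compat; nra).
      apply Rle_div_l; nra. }
  apply Rabs_le_between in B1; apply Rabs_le_between in B2.
  rewrite A0 in *. lra.
Qed.

(** In v = 1/t the bracket is -atan v + v/(2(1+v^2)) + v/2. The linear terms cancel, which is why
    t/(1+t^2) carries the weight 1/(2 PI), and only O(v^3) remains. *)
Lemma bose_main_bound t : 1 <= t -> Rabs (bose_main t) <= / t ^ 3.
Proof.
  intros Ht; assert (P := PI2_3_2).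
  assert (Hv : 0 < / t) by (apply Rinv_0_lt_compat; lra).
  assert (E : bose_main t = (- atan (/ t) + / t / (2 * (1 + (/ t) ^ 2)) + / t / 2) / PI).
  { unfold bose_main; rewrite atan_inv by lra. field. repeat split; nra. }
  rewrite E, <- pow_inv. set (v := / t) in *.
  assert (B := atan_bounds v ltac:(lra)).
  assert (B1 : (v - v ^ 3) / 2 <= v / (2 * (1 + v ^ 2)) <= v / 2).
  { assert (V3 : 0 < v ^ 3) by (apply pow_lt; easy).
    assert (V5 : 0 < v ^ 5) by (apply pow_lt; easy).
    split.
    - apply (proj1 (Rle_div_r _ _ (2 * (1 + v ^ 2)) ltac:(nra))). replace ((v - v ^ 3) / 2 * (2 * (1 + v ^ 2))) with (v - v ^ 5) by field. lra.
    - apply (proj2 (Rle_div_l _ _ (2 * (1 + v ^ 2)) ltac:(nra))). replace (v / 2 * (2 * (1 + v ^ 2))) with (v + v ^ 3) by field. lra. }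
  assert (V3 : 0 < v ^ 3) by (apply pow_lt; easy).
  unfold Rdiv at 1; rewrite Rabs_mult, (Rabs_pos_eq (/ PI)) by (apply Rlt_le, Rinv_0_lt_compat; lra).
  apply Rle_div_l; [lra|].
  apply Rabs_le; split; nra.
Qed.

Lemma bose_pos t : 0 < t -> 0 < bose t.
Proof. intros Ht; apply Rinv_0_lt_compat. assert (E := exp_2PI_gt_1 t Ht); lra. Qed.

(** Splitting the exponent into thirds: e^(2 PI t/3) >= 1 + 2t because PI > 3, and (1+2t)^3 >= 1 +
    t^3. *)
Lemma bose_cube_bound t : 0 < t -> bose t <= / t ^ 3.
Proof.
  intros Ht; assert (P := PI2_3_2).
  apply Rinv_le_contravar; [now apply pow_lt|].
  replace (2 * PI * t) with (2 * PI * t / 3 + 2 * PI * t / 3 + 2 * PI * t / 3) by field.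
  rewrite !exp_plus.
  assert (T : 0 < t * PI) by (apply Rmult_lt_0_compat; lra).
  assert (E := exp_ineq1 (2 * PI * t / 3) ltac:(nra)).
  set (z := exp _) in *.
  assert (H : 1 + 2 * t <= z) by nra.
  assert (Z2 : (1 + 2 * t) * (1 + 2 * t) <= z * z) by (apply Rmult_le_compat; lra).
  assert (Z3 : (1 + 2 * t) * (1 + 2 * t) * (1 + 2 * t) <= z * z * z) by (apply Rmult_le_compat; nra).
  assert (0 < t ^ 2) by now apply pow_lt. assert (0 < t ^ 3) by now apply pow_lt.
  nra.
Qed.

Lemma bose_rem_bound_0 t : 0 < t <= 1 -> Rabs (bose_rem t) <= 3 * t.
Proof.
  intros Ht; assert (P := PI2_3_2).
  assert (B := bose_reg_nonneg_le t ltac:(lra)).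
  assert (A := atan_bounds t ltac:(lra)).
  assert (0 <= t - t ^ 3 / 3).
  { assert (t ^ 2 <= 1) by nra. simpl in *. nra. }
  assert (A1 : 0 <= atan t / PI <= t).
  { split; [apply Rdiv_le_0_compat; lra|]. apply Rle_div_l; nra. }
  assert (A2 : 0 <= t / (2 * PI * (1 + t ^ 2)) <= t).
  { assert (0 < 2 * PI * (1 + t ^ 2)) by (apply Rmult_lt_0_compat; nra).
    split; [apply Rdiv_le_0_compat; lra|]. apply Rle_div_l; [easy|].
    assert (1 <= 2 * PI * (1 + t ^ 2)) by nra. nra. }
  unfold bose_rem; apply Rabs_le; lra.
Qed.

Lemma bose_rem_bound_infty t : 1 <= t -> Rabs (bose_rem t) <= 3 * Rpower t (-3).
Proof.
  intros Ht.
  assert (E : Rpower t (-3) = / t ^ 3).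
  { replace (-3) with (- INR 3) by (simpl; ring). rewrite Rpower_Ropp, Rpower_pow by lra. reflexivity. }
  rewrite E.
  replace (bose_rem t) with (bose t - bose_main t) by (rewrite bose_decomp by lra; ring).
  assert (B1 := bose_main_bound t Ht). assert (B2 := bose_cube_bound t ltac:(lra)).
  assert (B3 := bose_pos t ltac:(lra)).
  apply Rabs_le_between in B1. apply Rabs_le; lra.
Qed.

Lemma continuous_bose_rem t : 0 < t -> continuous bose_rem t.
Proof.
  intros Ht; apply (@ex_derive_continuous R_AbsRing R_NormedModule).
  unfold bose_rem, bose_reg, bose; auto_derive.
  assert (E := exp_2PI_gt_1 t Ht). assert (P := PI_RGT_0).
  assert (0 < 2 * PI * t) by (apply Rmult_lt_0_compat; lra).
  assert (0 < 2 * PI * (1 + t ^ 2)) by (apply Rmult_lt_0_compat; nra).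
  simpl in *. repeat split; lra.
Qed.

Lemma atan_lt_2 t : Rabs (atan t) <= 2.
Proof.
  assert (B := atan_bound t); assert (P := PI_4). apply Rabs_le; lra.
Qed.

(** Integration by parts: the boundary term t^(1-s) atan t/(1-s) vanishes at both ends exactly
    because 1 < s < 2, and what remains is [mellin_kernel] divided by s - 1. *)
Lemma mellin_atan s : 1 < s < 2 ->
  is_RInt_pos (fun t => Rpower t (- s) * atan t) (PI / 2 / sin (PI * s / 2) / (s - 1)).
Proof.
  intros Hs.
  set (c := PI / 2 / sin (PI * s / 2)).
  set (F := fun t => / (1 - s) * (Rpower t (1 - s) * atan t)).
  set (f := fun t => Rpower t (- s) * atan t + / (1 - s) * (Rpower t (1 - s) / (1 + t ^ 2))).
  assert (Hf : is_RInt_pos f (0 - 0)).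
  { apply is_RInt_pos_antiderivative with F.
    - intros x Hx.
      unfold F, f.
      replace (Rpower x (- s) * atan x + / (1 - s) * (Rpower x (1 - s) / (1 + x ^ 2)))
       with (/ (1 - s) * ((1 - s) * Rpower x (1 - s - 1) * atan x + Rpower x (1 - s) * / (1 + x ^ 2))).
      2:{ replace (1 - s - 1) with (- s) by ring. field. split; nra. }
      apply (is_derive_scal (fun t => Rpower t (1 - s) * atan t)).
      apply (is_derive_mult (fun t => Rpower t (1 - s)) atan).
      + now apply is_derive_Rpower.
      + apply is_derive_Reals. apply derivable_pt_lim_atan.
      + intros; apply Rmult_comm.
    - intros x Hx; unfold f.
      apply (continuous_plus (fun t => Rpower t (- s) * atan t)).
      + apply continuous_Rmult; [now apply continuous_Rpower|].
        apply (@ex_derive_continuous R_AbsRing R_NormedModule); auto_derive; auto.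
      + apply continuous_Rmult; [apply continuous_const|].
        apply continuous_Rmult; [now apply continuous_Rpower|].
        apply (@ex_derive_continuous R_AbsRing R_NormedModule); auto_derive; nra.
    - apply filterlim_0_of_power_bound with (K := / (s - 1)) (c := 2 - s); [lra|].
      intros x Hx; unfold F; rewrite Rminus_0_r.
      assert (Q := Rpower_pos x (1 - s)).
      assert (A := atan_bounds x ltac:(lra)).
      assert (0 <= x - x ^ 3 / 3).
      { assert (x ^ 2 <= 1) by nra. simpl in *. nra. }
      rewrite (Rpower_shift_exp x (1 - s) (2 - s) 1) by (simpl; lra).
      replace (/ (1 - s)) with (- / (s - 1)) by (field; lra).
      assert (0 < / (s - 1)) by (apply Rinv_0_lt_compat; lra).
      rewrite Rabs_mult, Rabs_Ropp, (Rabs_pos_eq (/ _)) by lra.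
      apply Rmult_le_compat_l; [lra|].
      rewrite Rabs_pos_eq by (apply Rmult_le_pos; lra). simpl; nra.
    - apply filterlim_infty_of_power_bound with (K := 2 * / (s - 1)) (c := 1 - s); [lra|].
      intros x Hx; unfold F; rewrite Rminus_0_r.
      assert (Q := Rpower_pos x (1 - s)).
      assert (A := atan_lt_2 x).
      replace (/ (1 - s)) with (- / (s - 1)) by (field; lra).
      assert (0 < / (s - 1)) by (apply Rinv_0_lt_compat; lra).
      rewrite !Rabs_mult, Rabs_Ropp, (Rabs_pos_eq (/ _)), (Rabs_pos_eq (Rpower _ _)) by lra.
      rewrite (Rmult_comm 2), Rmult_assoc. apply Rmult_le_compat_l; [lra|]. nra. }
  assert (H := is_RInt_pos_minus _ _ _ _ Hf (is_RInt_pos_scal (/ (1 - s)) _ _ (mellin_kernel s ltac:(lra)))).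
  replace (c / (s - 1)) with (0 - 0 - / (1 - s) * c) by (field; lra).
  revert H; apply is_RInt_pos_ext; intros t Ht; unfold f; ring.
Qed.

Lemma mellin_bose_rem s Z : 1 < s < 2 ->
  is_series (fun k => Rpower (INR (S k)) (- s)) Z ->
  is_RInt_pos (fun t => Rpower t (- s) * bose_rem t)
    ((Z - / (s - 1) - / 2) * (/ 2 / sin (PI * s / 2))).
Proof.
  intros Hs HZ; assert (P := PI_RGT_0).
  assert (S0 : 0 < sin (PI * s / 2)) by (apply sin_gt_0; nra).
  assert (H1 := mellin_bose_reg s Z Hs HZ).
  assert (H2 := is_RInt_pos_scal (/ PI) _ _ (mellin_atan s Hs)).
  assert (H3 := is_RInt_pos_scal (/ (2 * PI)) _ _ (mellin_kernel s ltac:(lra))).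
  assert (H := is_RInt_pos_minus _ _ _ _ (is_RInt_pos_minus _ _ _ _ H1 H2) H3).
  replace ((Z - / (s - 1) - / 2) * (/ 2 / sin (PI * s / 2))) with
   (Z * (/ 2 / sin (PI * s / 2)) - / PI * (PI / 2 / sin (PI * s / 2) / (s - 1)) -
     / (2 * PI) * (PI / 2 / sin (PI * s / 2))) by (field; lra).
  revert H; apply is_RInt_pos_ext; intros t Ht; unfold bose_rem.
  rewrite (Rpower_shift_exp t (- s) (1 - s) 1) by (simpl; lra).
  simpl pow. field. split; [nra|lra].
Qed.

(** * The complex exponential *)

Definition cexp (w : C) : C := (exp (Re w) * cos (Im w), exp (Re w) * sin (Im w)).

Lemma cexp_plus z w : cexp (z + w)%C = (cexp z * cexp w)%C.
Proof.
  unfold cexp, Cplus, Cmult, Re, Im; simpl; rewrite exp_plus, cos_plus, sin_plus.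
  f_equal; ring.
Qed.

Lemma Cmod_cexp w : Cmod (cexp w) = exp (Re w).
Proof.
  unfold cexp, Cmod, Re, Im; simpl.
  assert (E := sin2_cos2 (snd w)); unfold Rsqr in E.
  replace (_ + _) with (exp (fst w) ^ 2 * (sin (snd w) * sin (snd w) + cos (snd w) * cos (snd w))) by ring.
  rewrite E, Rmult_1_r. apply sqrt_pow2, Rlt_le, exp_pos.
Qed.

Lemma im_abs_le z : Rabs (Im z) <= Cmod z.
Proof.
  replace (Im z) with (Re (- Ci * z)%C) by (unfold Re, Im, Ci, Cmult, Copp; simpl; ring).
  eapply Rle_trans; [apply re_le_Cmod|].
  rewrite Cmod_mult, Cmod_opp, Cmod_Ci; lra.
Qed.

Lemma Cmod_le_re_im z : Cmod z <= Rabs (Re z) + Rabs (Im z).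
Proof.
  replace z with (RtoC (Re z) + Ci * RtoC (Im z))%C at 1.
  2:{ unfold RtoC, Ci, Re, Im, Cplus, Cmult; destruct z; simpl; f_equal; ring. }
  eapply Rle_trans; [apply Cmod_triangle|].
  rewrite Cmod_mult, Cmod_Ci, !Cmod_R; lra.
Qed.

Lemma pow_div_fact_le_exp n : forall x, 0 <= x -> x ^ n / INR (Factorial.fact n) <= exp x.
Proof.
  induction n as [|n IH]; intros x Hx.
  { simpl; rewrite Rdiv_1_r, <- exp_0; now apply exp_le_compat. }
  assert (P := INR_fact_lt_0 n). assert (P' := INR_fact_lt_0 (S n)).
  assert (Ps : 0 < INR (S n)) by (apply lt_0_INR; lia).
  assert (I : Rabs (x ^ S n / INR (Factorial.fact (S n)) - 0 ^ S n / INR (Factorial.fact (S n))) <= exp x - exp 0).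
  { apply (increment_le (fun t => t ^ S n / INR (Factorial.fact (S n))) exp (fun t => t ^ n / INR (Factorial.fact n)) exp); auto.
    - intros t Ht.
      apply is_derive_ext with (fun t => / INR (Factorial.fact (S n)) * t ^ S n); [intros; apply Rmult_comm|].
      replace (t ^ n / INR (Factorial.fact n)) with (/ INR (Factorial.fact (S n)) * (INR (S n) * t ^ n)).
      + apply (is_derive_scal (fun t => t ^ S n)), is_derive_Reals, (derivable_pt_lim_pow t (S n)).
      + rewrite fact_simpl, mult_INR. field. split; lra.
    - intros t Ht; apply is_derive_exp.
    - intros t Ht; rewrite Rabs_pos_eq; [apply IH; lra|].
      apply Rdiv_le_0_compat; [apply pow_le; lra|easy]. }
  rewrite pow_ne_zero in I by easy. rewrite exp_0 in I.
  apply Rabs_le_between in I. unfold Rdiv in *; lra.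
Qed.

Lemma pow_n_Cpow (z : C) n : @pow_n C_Ring z n = (z ^ n)%C.
Proof. induction n as [|n IH]; simpl; [reflexivity|rewrite IH; reflexivity]. Qed.

Definition exp_partial (w : C) (N : nat) : C :=
  sum_n (fun k => (w ^ k / RtoC (INR (Factorial.fact k)))%C) N.

(** A real function of a real parameter, so that the real Taylor-Lagrange formula applies to the
    complex exponential; [c = 1] and [c = - Ci] recover the real and imaginary parts of the
    remainder. *)
Definition ray (c w : C) (t : R) : R := Re (c * cexp (RtoC t * w))%C.

Lemma is_derive_ray c w t : is_derive (ray c w) t (ray (c * w)%C w t).
Proof.
  apply is_derive_ext with (fun t => Re c * (exp (t * Re w) * cos (t * Im w)) - Im c * (exp (t * Re w) * sin (t * Im w))).
  { intros u; unfold ray, cexp, Re, Im, Cmult, RtoC; simpl.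
    rewrite !Rmult_0_l, Rminus_0_r, Rplus_0_r; ring. }
  auto_derive; [easy|].
  unfold ray, cexp, Re, Im, Cmult, RtoC; simpl.
  rewrite !Rmult_0_l, Rminus_0_r, Rplus_0_r; ring.
Qed.

Lemma Derive_n_ray c w k : forall t, Derive_n (ray c w) k t = ray (c * w ^ k)%C w t.
Proof.
  induction k as [|k IH]; intros t; simpl.
  - rewrite Cmult_1_r; reflexivity.
  - rewrite (Derive_ext _ (ray (c * w ^ k)%C w)) by (intros; apply IH).
    erewrite is_derive_unique by apply is_derive_ray.
    f_equal; ring.
Qed.

Lemma ex_derive_n_ray c w k t : ex_derive_n (ray c w) k t.
Proof.
  destruct k as [|k]; simpl; [easy|].
  apply ex_derive_ext with (ray (c * w ^ k)%C w); [intros; symmetry; apply Derive_n_ray|].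
  eexists; apply is_derive_ray.
Qed.

Lemma Re_sum_n (f : nat -> C) N : Re (sum_n f N) = sum_f_R0 (fun k => Re (f k)) N.
Proof.
  induction N as [|N IH]; [rewrite sum_O; reflexivity|].
  rewrite sum_Sn; simpl; rewrite <- IH; reflexivity.
Qed.

Lemma Cmult_sum_n_l c (f : nat -> C) N : (c * sum_n f N)%C = sum_n (fun k => (c * f k)%C) N.
Proof.
  induction N as [|N IH]; [rewrite !sum_O; reflexivity|].
  rewrite !sum_Sn, <- IH. apply Cmult_plus_distr_l.
Qed.

Lemma Re_exp_remainder c w N :
  Rabs (Re (c * (cexp w - exp_partial w N))%C) <=
  Cmod c * (Cmod w ^ S N / INR (Factorial.fact (S N)) * exp (Cmod w)).
Proof.
  destruct (Taylor_Lagrange (ray c w) N 0 1 Rlt_0_1) as (z & Hz & E).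
  { intros; apply ex_derive_n_ray. }
  assert (P := INR_fact_lt_0 (S N)).
  assert (E0 : ray c w 1 = Re (c * cexp w)%C).
  { unfold ray; rewrite Cmult_1_l; reflexivity. }
  assert (E1 : sum_f_R0 (fun m => (1 - 0) ^ m / INR (Factorial.fact m) * Derive_n (ray c w) m 0) N
    = Re (c * exp_partial w N)%C).
  { unfold exp_partial; rewrite Cmult_sum_n_l, Re_sum_n.
    apply sum_eq; intros k Hk. rewrite Derive_n_ray, Rminus_0_r, pow1.
    assert (Pk := INR_fact_lt_0 k).
    unfold ray. replace (cexp (0 * w)%C) with (RtoC 1).
    2:{ rewrite Cmult_0_l; unfold cexp, RtoC; simpl. rewrite exp_0, cos_0, sin_0; f_equal; ring. }
    replace (c * (w ^ k / INR (Factorial.fact k)))%C with (RtoC (/ INR (Factorial.fact k)) * (c * w ^ k * 1))%C.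
    - unfold Re at 2; simpl. unfold Re; simpl. field. lra.
    - rewrite RtoC_inv by lra. unfold Cdiv; ring. }
  rewrite E0, E1, Derive_n_ray, Rminus_0_r, pow1 in E.
  replace (Re (c * (cexp w - exp_partial w N))%C) with (Re (c * cexp w)%C - Re (c * exp_partial w N)%C).
  2:{ unfold Re, Cmult, Cminus, Cplus, Copp; simpl; ring. }
  rewrite E.
  replace (_ + _ - _) with (1 / INR (Factorial.fact (S N)) * ray (c * w ^ S N) w z) by ring.
  unfold ray.
  rewrite Rabs_mult, Rabs_pos_eq by (apply Rdiv_le_0_compat; lra).
  apply Rle_trans with (1 / INR (Factorial.fact (S N)) * (Cmod c * Cmod w ^ S N * exp (Cmod w))).
  2:{ right; field; lra. }
  apply Rmult_le_compat_l; [apply Rdiv_le_0_compat; lra|].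
  eapply Rle_trans; [apply re_le_Cmod|].
  rewrite !Cmod_mult, Cmod_pow, Cmod_cexp.
  apply Rmult_le_compat_l.
  { apply Rmult_le_pos; [apply Cmod_ge_0|]. apply pow_le, Cmod_ge_0. }
  apply exp_le_compat.
  assert (B := re_le_Cmod w). assert (B' := Cmod_ge_0 w).
  replace (Re (z * w)%C) with (z * Re w) by (unfold Re, Cmult, RtoC; simpl; ring).
  apply Rabs_le_between in B. nra.
Qed.

(** The bound (2|w|)^(N+1)/(N+1)! <= e^(2|w|) trades the factorial for the geometric factor
    2^(-(N+1)); real and imaginary parts together cancel one factor 1/2. The price is e^(3|w|), the
    origin of the factor 3 in [is_pseries_laplace]. *)
Lemma exp_remainder w N :
  Cmod (cexp w - exp_partial w N)%C <= (/ 2) ^ N * exp (3 * Cmod w).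
Proof.
  set (u := (cexp w - exp_partial w N)%C).
  assert (H1 := Re_exp_remainder 1 w N). assert (H2 := Re_exp_remainder (- Ci)%C w N).
  fold u in H1, H2.
  rewrite Cmod_1 in H1. rewrite Cmod_opp, Cmod_Ci in H2.
  replace (1 * u)%C with u in H1 by ring.
  replace (Re (- Ci * u)%C) with (Im u) in H2 by (unfold Re, Im, Ci, Cmult, Copp; simpl; ring).
  eapply Rle_trans; [apply Cmod_le_re_im|].
  assert (B := pow_div_fact_le_exp (S N) (2 * Cmod w)).
  assert (P := Cmod_ge_0 w). assert (PF := INR_fact_lt_0 (S N)).
  specialize (B ltac:(lra)).
  set (m := Cmod w) in *.
  assert (E : m ^ S N / INR (Factorial.fact (S N)) <= (/ 2) ^ S N * exp (2 * m)).
  { replace (m ^ S N / INR (Factorial.fact (S N))) with ((/ 2) ^ S N * ((2 * m) ^ S N / INR (Factorial.fact (S N)))).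
    - apply Rmult_le_compat_l; [apply pow_le; lra|easy].
    - rewrite Rpow_mult_distr. rewrite pow_inv. field. split; [lra|apply pow_nonzero; lra]. }
  assert (Q := exp_pos m).
  apply Rmult_le_compat_r with (r := exp m) in E; [|lra].
  replace (3 * m) with (2 * m + m) by ring; rewrite exp_plus.
  simpl pow in E at 2.
  replace ((/ 2) ^ N * (exp (2 * m) * exp m)) with (2 * (/ 2 * (/ 2) ^ N * exp (2 * m) * exp m)) by field.
  lra.
Qed.

(** * Power series of complex Laplace integrals *)

Definition is_CInt (f : R -> C) (l : C) : Prop :=
  is_RInt_pos (fun t => Re (f t)) (Re l) /\ is_RInt_pos (fun t => Im (f t)) (Im l).

Lemma is_CInt_ext f g l : (forall t, 0 < t -> f t = g t) -> is_CInt f l -> is_CInt g l.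
Proof.
  intros H [H1 H2]; split; [revert H1|revert H2]; apply is_RInt_pos_ext;
    intros; rewrite H; auto.
Qed.

Lemma is_CInt_unique f l l' : is_CInt f l -> is_CInt f l' -> l = l'.
Proof.
  intros [H1 H2] [H1' H2'].
  assert (E1 := is_RInt_pos_unique _ _ _ H1 H1'). assert (E2 := is_RInt_pos_unique _ _ _ H2 H2').
  destruct l, l'; unfold Re, Im in *; simpl in *; subst; reflexivity.
Qed.

Definition CInt (f : R -> C) : C :=
  (RInt_gen (fun t => Re (f t)) (at_right 0) (Rbar_locally p_infty),
   RInt_gen (fun t => Im (f t)) (at_right 0) (Rbar_locally p_infty)).

Lemma CInt_unique f l : is_CInt f l -> CInt f = l.
Proof.
  intros [H1 H2]; unfold CInt.
  rewrite (is_RInt_gen_unique _ _ H1), (is_RInt_gen_unique _ _ H2).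
  symmetry; apply surjective_pairing.
Qed.

Lemma CInt_correct f l : is_CInt f l -> is_CInt f (CInt f).
Proof. intros H; rewrite (CInt_unique _ _ H); exact H. Qed.

Lemma is_CInt_plus f g l l' : is_CInt f l -> is_CInt g l' -> is_CInt (fun t => f t + g t)%C (l + l')%C.
Proof. intros [H1 H2] [H1' H2']; split; now apply is_RInt_pos_plus. Qed.

Lemma is_CInt_scal c f l : is_CInt f l -> is_CInt (fun t => c * f t)%C (c * l)%C.
Proof.
  intros [H1 H2]; split.
  - apply (is_RInt_pos_minus _ _ _ _ (is_RInt_pos_scal (Re c) _ _ H1) (is_RInt_pos_scal (Im c) _ _ H2)).
  - apply (is_RInt_pos_plus _ _ _ _ (is_RInt_pos_scal (Re c) _ _ H2) (is_RInt_pos_scal (Im c) _ _ H1)).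
Qed.

Lemma is_CInt_minus f g l l' : is_CInt f l -> is_CInt g l' -> is_CInt (fun t => f t - g t)%C (l - l')%C.
Proof.
  intros H H'. assert (Q := is_CInt_plus _ _ _ _ H (is_CInt_scal (- (1))%C _ _ H')).
  replace (l - l')%C with (l + - (1) * l')%C by ring.
  revert Q; apply is_CInt_ext; intros; ring.
Qed.

Lemma is_CInt_sum_n (f : nat -> R -> C) (l : nat -> C) N :
  (forall k, is_CInt (f k) (l k)) -> is_CInt (fun t => sum_n (fun k => f k t) N) (sum_n l N).
Proof.
  intros H; induction N as [|N IH].
  - rewrite sum_O. apply is_CInt_ext with (f O); [intros; rewrite sum_O; reflexivity|apply H].
  - rewrite sum_Sn. apply is_CInt_ext with (fun t => sum_n (fun k => f k t) N + f (S N) t)%C.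
    + intros; rewrite sum_Sn; reflexivity.
    + now apply is_CInt_plus.
Qed.

Definition Ccontinuous (f : R -> C) t : Prop :=
  continuous (fun t => Re (f t)) t /\ continuous (fun t => Im (f t)) t.

Lemma Ccontinuous_mult f g t : Ccontinuous f t -> Ccontinuous g t -> Ccontinuous (fun t => f t * g t)%C t.
Proof.
  intros [H1 H2] [H1' H2']; split.
  - apply (continuous_minus (fun t => Re (f t) * Re (g t)) (fun t => Im (f t) * Im (g t))); now apply continuous_Rmult.
  - apply (continuous_plus (fun t => Re (f t) * Im (g t)) (fun t => Im (f t) * Re (g t))); now apply continuous_Rmult.
Qed.

Lemma Ccontinuous_const c t : Ccontinuous (fun _ => c) t.
Proof. split; apply continuous_const. Qed.

Lemma Ccontinuous_RtoC f t : continuous f t -> Ccontinuous (fun t => RtoC (f t)) t.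
Proof. intros H; split; [exact H|apply continuous_const]. Qed.

Lemma Ccontinuous_pow f k t : Ccontinuous f t -> Ccontinuous (fun t => f t ^ k)%C t.
Proof.
  intros H; induction k as [|k IH]; simpl; [apply Ccontinuous_const|now apply Ccontinuous_mult].
Qed.

Lemma Ccontinuous_cexp f t : Ccontinuous f t -> Ccontinuous (fun t => cexp (f t)) t.
Proof.
  intros [H1 H2]; unfold cexp; split; apply continuous_Rmult.
  - apply (continuous_comp (fun t => Re (f t)) exp); [easy|apply continuous_exp].
  - apply (continuous_comp (fun t => Im (f t)) cos); [easy|apply continuous_cos].
  - apply (continuous_comp (fun t => Re (f t)) exp); [easy|apply continuous_exp].
  - apply (continuous_comp (fun t => Im (f t)) sin); [easy|apply continuous_sin].
Qed.

Lemma Ccontinuous_plus f g t : Ccontinuous f t -> Ccontinuous g t -> Ccontinuous (fun t => f t + g t)%C t.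
Proof.
  intros [H1 H2] [H1' H2']; split.
  - now apply (continuous_plus (fun t => Re (f t)) (fun t => Re (g t))).
  - now apply (continuous_plus (fun t => Im (f t)) (fun t => Im (g t))).
Qed.

Lemma Ccontinuous_minus f g t : Ccontinuous f t -> Ccontinuous g t -> Ccontinuous (fun t => f t - g t)%C t.
Proof.
  intros [H1 H2] [H1' H2']; split.
  - now apply (continuous_minus (fun t => Re (f t)) (fun t => Re (g t))).
  - now apply (continuous_minus (fun t => Im (f t)) (fun t => Im (g t))).
Qed.

Lemma Ccontinuous_sum_n (f : nat -> R -> C) N t : (forall k, Ccontinuous (f k) t) ->
  Ccontinuous (fun t => sum_n (fun k => f k t) N) t.
Proof.
  intros H; induction N as [|N IH].
  - destruct (H O) as [H1 H2]; split; [revert H1|revert H2]; apply continuous_ext; intros; rewrite sum_O; reflexivity.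
  - destruct (Ccontinuous_plus _ _ _ IH (H (S N))) as [H1 H2].
    split; [revert H1|revert H2]; apply continuous_ext; intros; rewrite sum_Sn; reflexivity.
Qed.

Lemma ex_CInt_power_dominated (f : R -> C) (a b K : R) :
  -1 < a -> b < -1 -> 0 <= K ->
  (forall x, 0 < x -> Ccontinuous f x) ->
  (forall x, 0 < x <= 1 -> Cmod (f x) <= K * Rpower x a) ->
  (forall x, 1 <= x -> Cmod (f x) <= K * Rpower x b) ->
  exists l, is_CInt f l /\ Cmod l <= 2 * K * (/ (a + 1) - / (b + 1)).
Proof.
  intros Ha Hb HK Hc H0 H1.
  destruct (ex_RInt_pos_power_dominated (fun t => Re (f t)) a b K) as (u & Hu & Bu); auto.
  - intros; now apply Hc.
  - intros; eapply Rle_trans; [apply re_le_Cmod|auto].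
  - intros; eapply Rle_trans; [apply re_le_Cmod|auto].
  - destruct (ex_RInt_pos_power_dominated (fun t => Im (f t)) a b K) as (v & Hv & Bv); auto.
    + intros; now apply Hc.
    + intros; eapply Rle_trans; [apply im_abs_le|auto].
    + intros; eapply Rle_trans; [apply im_abs_le|auto].
    + exists (u, v); split; [split; easy|].
      eapply Rle_trans; [apply Cmod_le_re_im|]. unfold Re, Im; simpl. lra.
Qed.

(* exp (s * lam al t) = t^(-s) * exp (i s al): the factor sin(pi s/2) is absorbed by al = pi/2, -pi/2. *)
Definition lam (al t : R) : C := (- ln t, al).

Lemma Cmod_lam al t : Cmod (lam al t) <= Rabs (ln t) + Rabs al.
Proof. eapply Rle_trans; [apply Cmod_le_re_im|]. unfold lam, Re, Im; simpl. rewrite Rabs_Ropp; lra. Qed.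

Lemma Ccontinuous_lam al t : 0 < t -> Ccontinuous (lam al) t.
Proof.
  intros Ht; split; [|apply continuous_const].
  apply (@ex_derive_continuous R_AbsRing R_NormedModule). unfold lam, Re; simpl. auto_derive; easy.
Qed.

(** [r] is the room for expansion around [p]: exp(r |ln t|) costs t^(-r) near 0 and t^r at infinity.
    Against [bose_rem], which is O(t) and O(t^(-3)), integrability requires 1 - Re p - r > -1 and -3
    - Re p + r < -1, which is what [Hp] ensures. *)
Section Laplace.
Variables (al : R) (p : C) (r : R).
Hypothesis Hr : 0 < r.
Hypothesis Hp : Rabs (Re p) + r < 2.

Let K0 := 3 * exp ((r + Cmod p) * Rabs al).

Let weight t := (cexp (p * lam al t) * RtoC (bose_rem t))%C.

Lemma weight_bound t : 0 < t ->
  exp (r * Cmod (lam al t)) * Cmod (weight t) <=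
  exp ((r + Cmod p) * Rabs al) * (exp (r * Rabs (ln t)) * Rpower t (- Re p)) * Rabs (bose_rem t).
Proof.
  intros Ht; unfold weight.
  rewrite Cmod_mult, Cmod_R, Cmod_cexp, <- Rmult_assoc.
  apply Rmult_le_compat_r; [apply Rabs_pos|].
  unfold Rpower; rewrite <- !exp_plus. apply exp_le_compat.
  assert (B := Cmod_lam al t).
  replace (Re (p * lam al t)%C) with (- Re p * ln t - Im p * al) by (unfold lam, Re, Im, Cmult; simpl; ring).
  assert (B1 := im_abs_le p).
  assert (B2 : - Im p * al <= Cmod p * Rabs al).
  { eapply Rle_trans; [apply Rle_abs|]. rewrite Rabs_mult, Rabs_Ropp.
    apply Rmult_le_compat_r; [apply Rabs_pos|easy]. }
  assert (r * Cmod (lam al t) <= r * (Rabs (ln t) + Rabs al)) by (apply Rmult_le_compat_l; lra).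
  lra.
Qed.

(** The bound is linear in [M], so it serves both for the existence of the integrals and, with M =
    2^(-N), for the convergence of the power series. *)
Lemma ex_CInt_weighted (f : R -> C) (M : R) : 0 <= M ->
  (forall t, 0 < t -> Ccontinuous f t) ->
  (forall t, 0 < t -> Cmod (f t) <= M * exp (r * Cmod (lam al t))) ->
  exists l, is_CInt (fun t => f t * weight t)%C l /\
    Cmod l <= M * (2 * K0 * (/ (2 - Re p - r) + / (2 + Re p - r))).
Proof.
  intros HM Hf Bf.
  assert (HRp : - Rabs (Re p) <= Re p <= Rabs (Re p)) by (apply Rabs_le_between; lra).
  assert (PK : 0 < exp ((r + Cmod p) * Rabs al)) by apply exp_pos.
  assert (W : forall t, 0 < t -> Cmod (f t * weight t)%C <= M * (exp ((r + Cmod p) * Rabs al) * (exp (r * Rabs (ln t)) * Rpower t (- Re p)) * Rabs (bose_rem t))).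
  { intros t Ht. eapply Rle_trans; [|apply Rmult_le_compat_l; [easy|apply weight_bound; easy]].
    rewrite Cmod_mult, <- Rmult_assoc. apply Rmult_le_compat_r; [apply Cmod_ge_0|auto]. }
  destruct (ex_CInt_power_dominated (fun t => f t * weight t)%C (1 - Re p - r) (-3 - Re p + r) (M * K0))
    as (l & Hl & Bl).
  - lra.
  - lra.
  - unfold K0; apply Rmult_le_pos; lra.
  - intros t Ht; apply Ccontinuous_mult; [auto|].
    apply Ccontinuous_mult.
    + apply Ccontinuous_cexp, Ccontinuous_mult; [apply Ccontinuous_const|now apply Ccontinuous_lam].
    + apply Ccontinuous_RtoC, continuous_bose_rem; easy.
  - intros t Ht. eapply Rle_trans; [apply W; lra|].
    rewrite (Rmult_assoc M K0); apply Rmult_le_compat_l; [easy|].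
    unfold K0; rewrite (Rmult_comm 3), !Rmult_assoc. apply Rmult_le_compat_l; [lra|].
    assert (B := bose_rem_bound_0 t Ht).
    replace (exp (r * Rabs (ln t))) with (Rpower t (- r)).
    2:{ unfold Rpower; f_equal. rewrite Rabs_left1; [ring|]. rewrite <- ln_1. apply ln_le; lra. }
    replace (3 * Rpower t (1 - Re p - r)) with (Rpower t (- r) * (Rpower t (- Re p) * (3 * t))).
    2:{ replace (1 - Re p - r) with (- r + (- Re p + 1)) by ring.
        rewrite !Rpower_plus, Rpower_1 by lra; ring. }
    apply Rmult_le_compat_l; [apply Rlt_le, Rpower_pos|].
    apply Rmult_le_compat_l; [apply Rlt_le, Rpower_pos|easy].
  - intros t Ht. eapply Rle_trans; [apply W; lra|].
    rewrite (Rmult_assoc M K0); apply Rmult_le_compat_l; [easy|].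
    unfold K0; rewrite (Rmult_comm 3), !Rmult_assoc. apply Rmult_le_compat_l; [lra|].
    assert (B := bose_rem_bound_infty t Ht).
    replace (exp (r * Rabs (ln t))) with (Rpower t r).
    2:{ unfold Rpower; f_equal. rewrite Rabs_pos_eq; [ring|]. rewrite <- ln_1. apply ln_le; lra. }
    replace (3 * Rpower t (-3 - Re p + r)) with (Rpower t r * (Rpower t (- Re p) * (3 * Rpower t (-3)))).
    2:{ replace (-3 - Re p + r) with (r + (- Re p + -3)) by ring.
        rewrite !Rpower_plus; ring. }
    apply Rmult_le_compat_l; [apply Rlt_le, Rpower_pos|].
    apply Rmult_le_compat_l; [apply Rlt_le, Rpower_pos|easy].
  - exists l; split; [easy|].
    replace (M * (2 * K0 * (/ (2 - Re p - r) + / (2 + Re p - r)))) with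
     (2 * (M * K0) * (/ (1 - Re p - r + 1) - / (-3 - Re p + r + 1))); [easy|].
    field. lra.
Qed.

(** The Taylor coefficient at [p] obtained by expanding exp(z lam) under the integral. *)
Definition laplace_coef k := CInt (fun t => lam al t ^ k / RtoC (INR (Factorial.fact k)) * weight t)%C.

Lemma is_CInt_laplace_coef k :
  is_CInt (fun t => lam al t ^ k / RtoC (INR (Factorial.fact k)) * weight t)%C (laplace_coef k).
Proof.
  assert (PF := INR_fact_lt_0 k).
  (* One term of the exponential series of r |lam| bounds |lam|^k/k! by r^(-k) e^(r |lam|). *)
  destruct (ex_CInt_weighted (fun t => lam al t ^ k / RtoC (INR (Factorial.fact k)))%C ((/ r) ^ k)) as (l & Hl & _).
  - apply pow_le, Rlt_le, Rinv_0_lt_compat; easy.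
  - intros t Ht; apply Ccontinuous_mult; [|apply Ccontinuous_const].
    apply Ccontinuous_pow, Ccontinuous_lam; easy.
  - intros t Ht.
    assert (NF : RtoC (INR (Factorial.fact k)) <> 0) by (intros Q; apply RtoC_inj in Q; lra).
    rewrite Cmod_div, Cmod_pow, Cmod_R, Rabs_pos_eq by (try lra; easy).
    assert (B := pow_div_fact_le_exp k (r * Cmod (lam al t))).
    rewrite Rpow_mult_distr in B. rewrite pow_inv.
    assert (Pr : 0 < r ^ k) by now apply pow_lt.
    apply Rmult_le_reg_l with (r ^ k); [easy|].
    replace (r ^ k * (/ r ^ k * exp (r * Cmod (lam al t)))) with (exp (r * Cmod (lam al t))) by (field; lra).
    unfold Rdiv in *; rewrite <- Rmult_assoc; apply B.
    apply Rmult_le_pos; [lra|apply Cmod_ge_0].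
  - apply (CInt_correct _ _ Hl).
Qed.

Lemma is_pseries_laplace z : 3 * Cmod z <= r ->
  let F := CInt (fun t => cexp ((p + z) * lam al t) * RtoC (bose_rem t))%C in
  is_CInt (fun t => cexp ((p + z) * lam al t) * RtoC (bose_rem t))%C F /\
  @is_pseries C_AbsRing C_NormedModule laplace_coef z F.
Proof.
  intros Hz F.
  assert (H0 : is_CInt (fun t => cexp ((p + z) * lam al t) * RtoC (bose_rem t))%C F).
  { destruct (ex_CInt_weighted (fun t => cexp (z * lam al t)) 1) as (l & Hl & _); [lra| | |].
    - intros t Ht; apply Ccontinuous_cexp, Ccontinuous_mult; [apply Ccontinuous_const|now apply Ccontinuous_lam].
    - intros t Ht. rewrite Cmod_cexp, Rmult_1_l. apply exp_le_compat.
      eapply Rle_trans; [apply Rle_abs|]. eapply Rle_trans; [apply re_le_Cmod|].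
      rewrite Cmod_mult. apply Rmult_le_compat_r; [apply Cmod_ge_0|]. assert (Q := Cmod_ge_0 z); lra.
    - apply (CInt_correct _ l). revert Hl; apply is_CInt_ext; intros t Ht.
      unfold weight. rewrite Cmult_plus_distr_r, cexp_plus. ring. }
  split; [exact H0|].
  set (D := 2 * K0 * (/ (2 - Re p - r) + / (2 + Re p - r))).
  assert (B : forall N, Cmod (F - sum_n (fun k => z ^ k * laplace_coef k)%C N)%C <= (/ 2) ^ N * D).
  { intros N.
    assert (HS : is_CInt (fun t => (cexp (z * lam al t) - exp_partial (z * lam al t) N) * weight t)%C
       (F - sum_n (fun k => z ^ k * laplace_coef k)%C N)%C).
    { assert (Q := is_CInt_minus _ _ _ _ H0 (is_CInt_sum_n (fun k t => z ^ k * (lam al t ^ k / RtoC (INR (Factorial.fact k)) * weight t))%C _ N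
        (fun k => is_CInt_scal (z ^ k)%C _ _ (is_CInt_laplace_coef k)))).
      revert Q; apply is_CInt_ext; intros t Ht.
      replace (sum_n _ N) with (weight t * exp_partial (z * lam al t) N)%C.
      - unfold weight. rewrite Cmult_plus_distr_r, cexp_plus. ring.
      - unfold exp_partial; rewrite Cmult_sum_n_l. apply sum_n_ext; intros k.
        match goal with |- @eq _ ?a ?b => change (@eq C a b) end.
        rewrite Cpow_mult_l. unfold Cdiv. ring. }
    destruct (ex_CInt_weighted (fun t => cexp (z * lam al t) - exp_partial (z * lam al t) N)%C ((/ 2) ^ N)) as (l & Hl & Bl).
    - apply pow_le; lra.
    - intros t Ht.
      assert (Cz : Ccontinuous (fun t => z * lam al t)%C t).
      { apply Ccontinuous_mult; [apply Ccontinuous_const|now apply Ccontinuous_lam]. }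
      apply Ccontinuous_minus; [now apply Ccontinuous_cexp|].
      unfold exp_partial; apply Ccontinuous_sum_n; intros k.
      apply Ccontinuous_mult; [|apply Ccontinuous_const]. now apply Ccontinuous_pow.
    - intros t Ht. eapply Rle_trans; [apply exp_remainder|].
      apply Rmult_le_compat_l; [apply pow_le; lra|]. apply exp_le_compat.
      rewrite Cmod_mult, <- Rmult_assoc. apply Rmult_le_compat_r; [apply Cmod_ge_0|easy].
    - rewrite (is_CInt_unique _ _ _ HS Hl); exact Bl. }
  unfold is_pseries, is_series.
  apply (filterlim_locally_ball_norm (K := C_AbsRing) (U := C_NormedModule)).
  intros eps.
  assert (L : is_lim_seq (fun n => (/ 2) ^ n * D) 0).
  { apply is_lim_seq_replace with (0 * D); [|ring].
    apply is_lim_seq_mult'; [|apply is_lim_seq_const].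
    apply is_lim_seq_geom; rewrite Rabs_pos_eq; lra. }
  apply is_lim_seq_spec in L; destruct (L eps) as [N HN]; exists N; intros n Hn.
  specialize (HN n Hn); rewrite Rminus_0_r in HN.
  unfold ball_norm.
  eapply Rle_lt_trans; [|exact HN].
  eapply Rle_trans; [|apply Rle_abs]. eapply Rle_trans; [|apply B].
  right. change (Cmod (sum_n (fun k => scal (@pow_n C_Ring z k) (laplace_coef k)) n - F)%C = 
     Cmod (F - sum_n (fun k => (z ^ k * laplace_coef k)%C) n)%C).
  rewrite <- Cmod_opp. f_equal.
  rewrite (sum_n_ext (fun k => scal (@pow_n C_Ring z k) (laplace_coef k)) (fun k => (z ^ k * laplace_coef k)%C)).
  - change (@sum_n (ModuleSpace.AbelianMonoid C_Ring C_ModuleSpace)) with (@sum_n C_AbelianMonoid). ring.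
  - intros k. rewrite pow_n_Cpow. reflexivity.
Qed.
End Laplace.

(** * The identity theorem along a segment *)

(** [analytic_at] with its coefficients exposed: they are carried through sums so that the
    derivative can be read off as the coefficient of index 1. *)
Definition analytic_with (a : nat -> C) (f : C -> C) (p : C) : Prop :=
  exists r : R, 0 < r /\ forall s : C, Cmod (s - p)%C < r ->
    @is_pseries C_AbsRing C_NormedModule a (s - p)%C (f s).

Lemma analytic_at_with a f p : analytic_with a f p -> analytic_at f p.
Proof. intros [r H]; exists a, r; exact H. Qed.

Lemma analytic_at_ex f p : analytic_at f p -> exists a, analytic_with a f p.
Proof. intros (a & r & H); exists a, r; exact H. Qed.

Lemma analytic_with_plus a b f g p : analytic_with a f p -> analytic_with b g p ->
  analytic_with (fun k => a k + b k)%C (fun s => f s + g s)%C p.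
Proof.
  intros (r & Hr & H) (r' & Hr' & H').
  exists (Rmin r r'); split; [now apply Rmin_glb_lt|].
  intros s Hs.
  apply (@is_pseries_plus C_AbsRing C_NormedModule a b).
  - apply H; eapply Rlt_le_trans; [exact Hs|apply Rmin_l].
  - apply H'; eapply Rlt_le_trans; [exact Hs|apply Rmin_r].
Qed.

Lemma analytic_with_scal c a f p : analytic_with a f p ->
  analytic_with (fun k => c * a k)%C (fun s => c * f s)%C p.
Proof.
  intros (r & Hr & H); exists r; split; [easy|]. intros s Hs.
  apply (@is_pseries_scal C_AbsRing C_NormedModule c a); [apply Cmult_comm|auto].
Qed.

Lemma is_Cseries_of_bound (f : nat -> C) (l : C) (u : nat -> R) :
  (forall n, Cmod (sum_n f n - l)%C <= u n) -> is_lim_seq u 0 ->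
  @is_series C_AbsRing C_NormedModule f l.
Proof.
  intros H L. unfold is_series.
  apply (filterlim_locally_ball_norm (K := C_AbsRing) (U := C_NormedModule)).
  intros eps; apply is_lim_seq_spec in L; destruct (L eps) as [N HN]; exists N; intros n Hn.
  specialize (HN n Hn); rewrite Rminus_0_r in HN.
  unfold ball_norm. eapply Rle_lt_trans; [|exact HN].
  eapply Rle_trans; [apply (H n)|apply Rle_abs].
Qed.

Lemma is_series_Re (f : nat -> C) l :
  @is_series C_AbsRing C_NormedModule f l -> is_series (fun k => Re (f k)) (Re l).
Proof.
  intros H. change (is_lim_seq (sum_n (fun k => Re (f k))) (Re l)).
  apply is_lim_seq_spec; intros eps.
  assert (L := proj1 (filterlim_locally_ball_norm (K := C_AbsRing) (U := C_NormedModule) _ _) H eps).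
  revert L; apply filter_imp; intros n Hn.
  eapply Rle_lt_trans; [|exact Hn].
  replace (sum_n (fun k => Re (f k)) n - Re l) with (Re (sum_n f n - l)%C).
  - apply (re_le_Cmod (sum_n f n - l)%C).
  - change (Re (sum_n f n - l)%C) with (Re (sum_n f n) - Re l).
    rewrite Re_sum_n, sum_n_Reals; reflexivity.
Qed.

Lemma is_Cseries_geom q : Cmod q < 1 -> @is_series C_AbsRing C_NormedModule (fun k => q ^ k)%C (/ (1 - q))%C.
Proof.
  intros Hq.
  assert (N : (1 - q)%C <> 0).
  { intros Q. assert (E : q = 1). { replace q with (1 - (1 - q))%C by ring. rewrite Q; ring. }
    rewrite E, Cmod_1 in Hq; lra. }
  assert (P := Cmod_ge_0 q).
  apply is_Cseries_of_bound with (fun n => Cmod q ^ S n * / Cmod (1 - q)%C).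
  - intros n.
    assert (E : sum_n (fun k => q ^ k)%C n = ((1 - q ^ S n) / (1 - q))%C).
    { induction n as [|n IH]; [rewrite sum_O; simpl; field; easy|].
      rewrite sum_Sn, IH. change (@plus C_AbelianMonoid) with Cplus. simpl. field. easy. }
    rewrite E.
    replace ((1 - q ^ S n) / (1 - q) - / (1 - q))%C with (- (q ^ S n / (1 - q)))%C by (field; easy).
    rewrite Cmod_opp, Cmod_div, Cmod_pow by easy. lra.
  - apply is_lim_seq_replace with (0 * / Cmod (1 - q)%C); [|ring].
    apply is_lim_seq_mult'; [|apply is_lim_seq_const].
    apply (is_lim_seq_incr_1 (fun n => Cmod q ^ n)), is_lim_seq_geom.
    rewrite Rabs_pos_eq; easy.
Qed.

Lemma analytic_with_Cinv c p : p <> c ->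
  analytic_with (fun k => (-1) ^ k / (p - c) ^ S k)%C (fun s => / (s - c))%C p.
Proof.
  intros Hp.
  assert (N : (p - c)%C <> 0).
  { intros Q; apply Hp. replace p with ((p - c) + c)%C by ring. rewrite Q; ring. }
  assert (P : 0 < Cmod (p - c)%C) by now apply Cmod_gt_0.
  exists (Cmod (p - c)%C); split; [easy|]. intros s Hs.
  set (z := (s - p)%C) in *.
  set (q := (- z / (p - c))%C).
  assert (Hq : Cmod q < 1).
  { unfold q; rewrite Cmod_div, Cmod_opp by easy. apply Rlt_div_l; lra. }
  assert (N2 : (1 - q)%C <> 0).
  { intros Q. assert (E : q = 1). { replace q with (1 - (1 - q))%C by ring. rewrite Q; ring. }
    rewrite E, Cmod_1 in Hq; lra. }
  assert (H := is_series_scal (K := C_AbsRing) (V := C_NormedModule) (/ (p - c))%C _ _ (is_Cseries_geom q Hq)).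
  replace (/ (s - c))%C with (/ (p - c) * / (1 - q))%C.
  2:{ assert (E : ((p - c) * (1 - q))%C = (s - c)%C) by (unfold q, z; field; easy).
      rewrite <- E. field. split; [exact N2|exact N]. }
  revert H; apply is_series_ext; intros n.
  match goal with |- @eq _ ?a ?b => change (@eq C a b) end.
  change (/ (p - c) * q ^ n = z ^ n * ((-1) ^ n / (p - c) ^ S n))%C.
  unfold q. replace (- z / (p - c))%C with ((-1) * z * / (p - c))%C by (field; easy).
  rewrite !Cpow_mult_l, Cpow_inv by easy. simpl. field. split; [apply Cpow_nz|]; easy.
Qed.

Lemma pseries_head_zero (b : nat -> R) r : 0 < r ->
  (forall t, 0 < t < r -> is_pseries b t 0) -> b O = 0.
Proof.
  intros Hr H.
  assert (CV : Rbar_lt 0 (CV_radius b)).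
  { destruct (Rbar_lt_le_dec (CV_radius b) (Rabs (r / 2))) as [L|L].
    - exfalso. apply (CV_disk_outside b (r / 2) L).
      apply ex_series_lim_0. exists 0. apply is_pseries_R, H; lra.
    - eapply Rbar_lt_le_trans; [|exact L]. simpl. rewrite Rabs_pos_eq; lra. }
  assert (C0 : continuity_pt (PSeries b) 0).
  { apply PSeries_continuity. rewrite Rabs_R0; exact CV. }
  rewrite <- (PSeries_0 b).
  apply continuity_pt_filterlim in C0.
  assert (L : filterlim (PSeries b) (at_right 0) (locally (PSeries b 0))).
  { intros P HP; specialize (C0 P HP). destruct C0 as [d Hd]; exists d; intros; now apply Hd. }
  assert (L2 : filterlim (PSeries b) (at_right 0) (locally 0)).
  { apply filterlim_ext_loc with (fun _ => 0); [|apply filterlim_const].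
    generalize (at_right_0_lt r Hr); apply filter_imp; intros t Ht.
    symmetry; apply is_pseries_unique, H; lra. }
  apply (filterlim_locally_unique _ _ _ L L2).
Qed.

(** Once the constant term is 0, dividing by t > 0 gives the shifted series, which again vanishes on
    the interval. *)
Lemma pseries_zero_on_ray (b : nat -> R) r : 0 < r ->
  (forall t, 0 < t < r -> is_pseries b t 0) -> forall k, b k = 0.
Proof.
  intros Hr H k; revert b H; induction k as [|k IH]; intros b H.
  - now apply pseries_head_zero with r.
  - change (b (S k)) with (PS_decr_1 b k). apply IH.
    intros t Ht.
    assert (B0 := pseries_head_zero b r Hr H).
    assert (Q := is_pseries_decr_1 b t (/ t) 0 (Rinv_l t ltac:(lra)) (H t Ht)).
    rewrite B0 in Q. revert Q. match goal with |- is_pseries _ _ ?x -> _ => replace x with 0; [easy|] end.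
    unfold scal, plus, opp; simpl; unfold mult; simpl. ring.
Qed.

Definition zero_near (h : C -> C) (p : C) : Prop :=
  exists r : R, 0 < r /\ forall s : C, Cmod (s - p)%C < r -> h s = 0.

Lemma is_series_Im (f : nat -> C) l :
  @is_series C_AbsRing C_NormedModule f l -> is_series (fun k => Im (f k)) (Im l).
Proof.
  intros H.
  assert (E : forall z : C, Re (- Ci * z)%C = Im z) by (intros; unfold Re, Im, Ci, Cmult, Copp; simpl; ring).
  assert (Q := is_series_Re _ _ (is_series_scal (K := C_AbsRing) (V := C_NormedModule) (- Ci)%C _ _ H)).
  change (Re (scal (- Ci)%C l)) with (Re (- Ci * l)%C) in Q. rewrite E in Q.
  revert Q; apply is_series_ext; intros n. apply (E (f n)).
Qed.

Lemma is_series_const_0 (f : nat -> C) (l : C) : (forall k, f k = 0) ->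
  @is_series C_AbsRing C_NormedModule f l -> l = 0.
Proof.
  intros Hf H.
  assert (A := is_series_Re _ _ H); assert (B := is_series_Im _ _ H).
  assert (Z : forall g : nat -> R, (forall k, g k = 0) -> Series g = 0).
  { intros g Hg. apply is_series_unique.
    apply is_series_ext with (fun _ => 0); [intros; now rewrite Hg|].
    change (is_lim_seq (sum_n (fun _ => 0)) 0).
    apply is_lim_seq_ext with (fun _ => 0); [|apply is_lim_seq_const].
    intros n; rewrite sum_n_const; ring. }
  apply is_series_unique in A; apply is_series_unique in B.
  rewrite Z in A by (intros; rewrite Hf; reflexivity).
  rewrite Z in B by (intros; rewrite Hf; reflexivity).
  destruct l as [x y]; unfold Re, Im in *; simpl in *; subst; reflexivity.
Qed.

(** On the ray, h is a power series in the real parameter u with coefficients a_k e^k. Their real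
    and imaginary parts vanish by the real result, and e^k is invertible, so vanishing on one
    half-line forces all a_k to be 0. *)
Lemma zero_near_of_ray h q (e : C) (eps : R) : analytic_at h q -> e <> RtoC 0 -> 0 < eps ->
  (forall u : R, 0 < u < eps -> h (q + RtoC u * e)%C = 0) -> zero_near h q.
Proof.
  intros Ha He Heps Hz.
  destruct (analytic_at_ex _ _ Ha) as (a & r & Hr & H).
  assert (Pe : 0 < Cmod e) by now apply Cmod_gt_0.
  set (d := Rmin eps (r / Cmod e)).
  assert (Hd : 0 < d) by (apply Rmin_glb_lt; [easy|]; now apply Rdiv_lt_0_compat).
  assert (HS : forall u, 0 < u < d ->
     @is_series C_AbsRing C_NormedModule (fun k => RtoC (u ^ k) * (a k * e ^ k))%C (RtoC 0)).
  { intros u Hu.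
    assert (U1 : u < eps) by (eapply Rlt_le_trans; [apply Hu|apply Rmin_l]).
    assert (U2 : u < r / Cmod e) by (eapply Rlt_le_trans; [apply Hu|apply Rmin_r]).
    assert (Q := H (q + RtoC u * e)%C).
    replace (q + RtoC u * e - q)%C with (RtoC u * e)%C in Q by ring.
    rewrite Hz in Q by lra.
    rewrite Cmod_mult, Cmod_R, Rabs_pos_eq in Q by lra.
    apply Rlt_div_r in U2; [|easy].
    specialize (Q U2). revert Q; apply is_series_ext; intros n.
    rewrite pow_n_Cpow. change ((RtoC u * e) ^ n * a n = RtoC (u ^ n) * (a n * e ^ n))%C.
    rewrite Cpow_mult_l, RtoC_pow. ring. }
  assert (Hk : forall k, a k = RtoC 0).
  { intros k.
    assert (E : (a k * e ^ k)%C = RtoC 0).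
    { assert (R0 : Re (a k * e ^ k)%C = 0).
      { apply (pseries_zero_on_ray (fun k => Re (a k * e ^ k)%C) d Hd).
        intros t Ht. apply is_pseries_R.
        generalize (is_series_Re _ _ (HS t Ht)); apply is_series_ext; intros n.
        unfold Re, Cmult, RtoC; simpl; ring. }
      assert (I0 : Im (a k * e ^ k)%C = 0).
      { apply (pseries_zero_on_ray (fun k => Im (a k * e ^ k)%C) d Hd).
        intros t Ht. apply is_pseries_R.
        generalize (is_series_Im _ _ (HS t Ht)); apply is_series_ext; intros n.
        unfold Im, Cmult, RtoC; simpl; ring. }
      destruct (a k * e ^ k)%C as [x y]; unfold Re, Im in *; simpl in *; subst; reflexivity. }
    replace (a k) with (a k * e ^ k * / e ^ k)%C by (field; now apply Cpow_nz).
    rewrite E; ring. }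
  exists r; split; [easy|]. intros s Hs.
  apply (is_series_const_0 _ _) with (2 := H s Hs).
  intros k; rewrite Hk. apply (@scal_zero_r C_Ring C_ModuleSpace).
Qed.

(** Connectedness of [0,1] through a supremum: being zero near a point is an open condition, and
    [zero_near_of_ray] makes it closed. *)
Lemma zero_near_segment h p (d : C) : d <> RtoC 0 ->
  (forall t : R, 0 <= t <= 1 -> analytic_at h (p + RtoC t * d)%C) ->
  zero_near h p -> zero_near h (p + d)%C.
Proof.
  intros Hd Ha H0.
  assert (Pd : 0 < Cmod d) by now apply Cmod_gt_0.
  set (Z := fun t : R => zero_near h (p + RtoC t * d)%C).
  assert (Z0 : Z 0).
  { unfold Z; replace (p + RtoC 0 * d)%C with p by ring; easy. }
  assert (Open : forall t, Z t -> exists eta, 0 < eta /\ forall u, Rabs (u - t) < eta -> Z u).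
  { intros t (r & Hr & H).
    exists (r / 2 / Cmod d); split; [apply Rdiv_lt_0_compat; lra|].
    intros u Hu. exists (r / 2); split; [lra|]. intros s Hs. apply H.
    replace (s - (p + RtoC t * d))%C with ((s - (p + RtoC u * d)) + RtoC (u - t) * d)%C
      by (rewrite RtoC_minus; ring).
    eapply Rle_lt_trans; [apply Cmod_triangle|].
    rewrite Cmod_mult, Cmod_R. apply Rlt_div_r in Hu; [|easy]. lra. }
  set (E := fun t => 0 <= t <= 1 /\ forall u, 0 <= u <= t -> Z u).
  destruct (completeness E) as [T [HT1 HT2]].
  { exists 1; intros t [Ht _]; lra. }
  { exists 0; split; [lra|]. intros u Hu; replace u with 0 by lra; easy. }
  assert (T0 : 0 <= T).
  { apply HT1; split; [lra|]. intros u Hu; replace u with 0 by lra; easy. }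
  assert (T1 : T <= 1) by (apply HT2; intros t [Ht _]; lra).
  assert (Hlt : forall u, 0 <= u < T -> Z u).
  { intros u Hu.
    destruct (Classical_Prop.classic (exists t, E t /\ u < t)) as [(t & [_ Ht] & Hut)|N].
    - apply Ht; lra.
    - exfalso. enough (T <= u) by lra. apply HT2; intros t Ht.
      destruct (Rle_dec t u); [easy|]. exfalso; apply N; exists t; split; [easy|lra]. }
  assert (ZT : Z T).
  (* The supremum is reached by looking back along [- d], where h is already known to vanish. *)
  { destruct (Req_dec T 0) as [->|NT]; [easy|].
    apply zero_near_of_ray with (e := (- d)%C) (eps := T).
    - apply Ha; lra.
    - intros Q; apply Hd. replace d with (- - d)%C by ring. rewrite Q; ring.
    - lra.
    - intros u Hu. destruct (Hlt (T - u) ltac:(lra)) as (r & Hr & H).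
      apply H. rewrite RtoC_minus.
      match goal with |- Cmod ?x < _ => replace x with (RtoC 0) by ring end.
      rewrite Cmod_0; easy. }
  destruct (Rle_lt_or_eq_dec T 1 T1) as [L| ->].
  - exfalso. destruct (Open T ZT) as (eta & Heta & Ho).
    set (t := T + Rmin (eta / 2) (1 - T)).
    assert (M1 := Rmin_l (eta / 2) (1 - T)). assert (M2 := Rmin_r (eta / 2) (1 - T)).
    assert (M3 : 0 < Rmin (eta / 2) (1 - T)) by (apply Rmin_glb_lt; lra).
    enough (t <= T) by (unfold t in *; lra).
    apply HT1; split; [unfold t; lra|]. intros u Hu.
    destruct (Rlt_le_dec u T); [apply Hlt; lra|].
    apply Ho. unfold t in Hu; rewrite Rabs_pos_eq; lra.
  - unfold Z in ZT. replace (p + RtoC 1 * d)%C with (p + d)%C in ZT by ring; easy.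
Qed.

Lemma is_lim_difference_quotient (f g : R -> R) (p l : R) (a : nat -> R) (r : R) : 0 < r ->
  (forall t, Rabs t < r -> is_pseries a t (f (p + t))) ->
  (forall x, x <> p -> g x = (f x - f p) / (x - p)) ->
  l = a 1%nat -> is_lim g p l.
Proof.
  intros Hr H Hg ->.
  assert (CV : Rbar_lt 0 (CV_radius a)).
  { destruct (Rbar_lt_le_dec (CV_radius a) (Rabs (r / 2))) as [L|L].
    - exfalso. apply (CV_disk_outside a (r / 2) L).
      apply ex_series_lim_0. exists (f (p + r / 2)). apply is_pseries_R, H. rewrite Rabs_pos_eq; lra.
    - eapply Rbar_lt_le_trans; [|exact L]. simpl. rewrite Rabs_pos_eq; lra. }
  assert (D := is_derive_PSeries a 0). rewrite Rabs_R0 in D. specialize (D CV).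
  rewrite PSeries_0 in D. unfold PS_derive in D.
  replace (INR 1 * a 1%nat) with (a 1%nat) in D by (simpl; ring).
  apply is_derive_Reals in D.
  apply is_lim_spec; intros eps.
  destruct (D eps (cond_pos eps)) as [del Hdel].
  assert (Hm : 0 < Rmin r del) by (apply Rmin_glb_lt; [easy|apply cond_pos]).
  exists (mkposreal _ Hm); intros x Hx Nx.
  unfold ball in Hx; simpl in Hx; unfold AbsRing_ball, abs, minus, plus, opp in Hx; simpl in Hx.
  change (Rabs (x - p) < Rmin r del) in Hx.
  assert (X1 : Rabs (x - p) < r) by (eapply Rlt_le_trans; [exact Hx|apply Rmin_l]).
  assert (X2 : Rabs (x - p) < del) by (eapply Rlt_le_trans; [exact Hx|apply Rmin_r]).
  specialize (Hdel (x - p) ltac:(lra) X2).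
  assert (F1 := is_pseries_unique _ _ _ (H (x - p) X1)).
  assert (F0 := is_pseries_unique _ _ _ (H 0 ltac:(rewrite Rabs_R0; easy))).
  rewrite Rplus_0_l, F1, F0 in Hdel.
  replace (p + (x - p)) with x in Hdel by (symmetry; apply Rplus_minus). rewrite Rplus_0_r in Hdel.
  rewrite Hg by easy. exact Hdel.
Qed.

Lemma C_derive_of_pseries h a (p : R) : analytic_with a h (RtoC p) -> C_derive h (RtoC p) = a 1%nat.
Proof.
  intros (r & Hr & H).
  assert (HS : forall t : R, Rabs t < r ->
     @is_series C_AbsRing C_NormedModule (fun k => RtoC (t ^ k) * a k)%C (h (RtoC (p + t)))).
  { intros t Ht. assert (Q := H (RtoC (p + t))).
    replace (RtoC (p + t) - RtoC p)%C with (RtoC t) in Q by (rewrite RtoC_plus; ring).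
    rewrite Cmod_R in Q; specialize (Q Ht). revert Q; apply is_series_ext; intros n.
    rewrite pow_n_Cpow, RtoC_pow. reflexivity. }
  assert (Q : forall x : R, x <> p ->
    (((h (RtoC x) - h (RtoC p)) / (RtoC x - RtoC p))%C =
      ((Re (h (RtoC x)) - Re (h (RtoC p))) / (x - p), (Im (h (RtoC x)) - Im (h (RtoC p))) / (x - p)))).
  { intros x Hx. rewrite <- RtoC_minus. unfold Cdiv. rewrite <- RtoC_inv by lra.
    unfold Cminus, Cmult, Cplus, Copp, RtoC, Re, Im; simpl. unfold Rdiv, Rminus. f_equal; ring. }
  (* [C_lim] takes the limits of both components along the horizontal line through the point, so
     real difference quotients suffice. *)
  unfold C_derive, C_lim. change (fst (RtoC p)) with p. change (snd (RtoC p)) with 0.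
  rewrite (surjective_pairing (a 1%nat)). f_equal.
  - rewrite (is_lim_unique _ _ (fst (a 1%nat))); [reflexivity|].
    apply (is_lim_difference_quotient (fun x => Re (h (RtoC x)))) with (a := fun k => Re (a k)) (r := r); auto.
    + intros t Ht; apply is_pseries_R.
      generalize (is_series_Re _ _ (HS t Ht)); apply is_series_ext; intros n.
      unfold Re, Cmult, RtoC; simpl; ring.
    + intros x Hx. change (x, 0) with (RtoC x). change (p, 0) with (RtoC p). rewrite Q by easy. reflexivity.
  - rewrite (is_lim_unique _ _ (snd (a 1%nat))); [reflexivity|].
    apply (is_lim_difference_quotient (fun x => Im (h (RtoC x)))) with (a := fun k => Im (a k)) (r := r); auto.
    + intros t Ht; apply is_pseries_R.
      generalize (is_series_Im _ _ (HS t Ht)); apply is_series_ext; intros n.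
      unfold Im, Cmult, RtoC; simpl; ring.
    + intros x Hx. change (x, 0) with (RtoC x). change (p, 0) with (RtoC p). rewrite Q by easy. reflexivity.
Qed.

(** * Explicit integrals *)

Lemma filterlim_at_right_0_of_continuous (F : R -> R) (l : R) : continuous F 0 -> F 0 = l -> filterlim F (at_right 0) (locally l).
Proof.
  intros H <- P HP; specialize (H P HP); destruct H as [d Hd]; exists d; intros; now apply Hd.
Qed.

Lemma Rpower_neg1 x : 0 < x -> Rpower x (-1) = / x.
Proof.
  intros Hx; replace (-1) with (- (1)) by ring. rewrite Rpower_Ropp, Rpower_1; easy.
Qed.

Lemma exp_taylor_3 x : 0 <= x -> 
  Rabs (exp x - (1 + x + x ^ 2 / 2 + x ^ 3 / 6)) <= x ^ 4 / 24 * exp x.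
Proof.
  intros Hx; assert (H := Re_exp_remainder 1 (RtoC x) 3).
  rewrite Cmod_1, Cmod_R, (Rabs_pos_eq x), Rmult_1_l in H by easy.
  replace (INR (Factorial.fact 4)) with 24 in H by (simpl; ring).
  replace (exp x - _) with (Re (1 * (cexp x - exp_partial x 3))%C); [exact H|].
  rewrite Cmult_1_l.
  change (Re (cexp x - exp_partial x 3)%C) with (Re (cexp x) - Re (exp_partial x 3)).
  unfold exp_partial; rewrite Re_sum_n. simpl sum_f_R0.
  unfold cexp, Re, Im; simpl. rewrite cos_0. field.
Qed.

(** From 1/(e^x-1) = 1/x - 1/2 + x/12 + ... with x = 2 PI t, the coefficient being 2 PI/12. The
    constant 4 PI^2 arises because the error is at most 2 PI x for x <= 1. *)
Lemma bose_reg_limit_0 : filterlim (fun t => bose_reg t / t) (at_right 0) (locally (PI / 6)).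
Proof.
  assert (P := PI_RGT_0). assert (P4 := PI_4).
  apply filterlim_of_bound with (w := fun t => t) (K := 4 * PI ^ 2).
  2:{ apply filterlim_at_right_0_of_continuous; [apply continuous_id|easy]. }
  assert (HP : 0 < / (2 * PI)) by (apply Rinv_0_lt_compat; lra).
  generalize (at_right_0_lt _ HP); apply filter_imp; intros t Ht.
  unfold bose_reg, bose.
  set (x := 2 * PI * t).
  assert (Hx : 0 < x <= 1).
  { unfold x; split; [apply Rmult_lt_0_compat; lra|].
    replace 1 with (2 * PI * / (2 * PI)) by (field; lra). apply Rmult_le_compat_l; lra. }
  assert (T := exp_taylor_3 x ltac:(lra)).
  assert (E3 : exp x <= 3).
  { apply Rle_trans with (exp 1); [apply exp_le_compat; lra|apply exp_le_3]. }
  assert (X4 : 0 < x ^ 4) by now apply pow_lt.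
  assert (X3 : 0 < x ^ 3) by now apply pow_lt.
  assert (X2 : 0 < x ^ 2) by now apply pow_lt.
  assert (X43 : x ^ 4 <= x ^ 3) by (simpl in *; nra).
  set (rho := exp x - (1 + x + x ^ 2 / 2 + x ^ 3 / 6)) in *.
  assert (Br : Rabs rho <= x ^ 4 / 8).
  { eapply Rle_trans; [exact T|]. nra. }
  apply Rabs_le_between in Br.
  assert (EE : exp x - 1 = x + x ^ 2 / 2 + x ^ 3 / 6 + rho) by (unfold rho; ring).
  assert (EL : x <= exp x - 1) by (assert (Q := exp_ineq1 x ltac:(lra)); lra).
  set (E := exp x - 1) in *.
  replace ((/ E + / 2 - / x) / t - PI / 6) with (2 * PI * ((6 * (2 * x + (x - 2) * E) - x ^ 2 * E) / (12 * x ^ 2 * E))).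
  2:{ replace t with (x / (2 * PI)) by (unfold x; field; lra). field. lra. }
  (* The powers up to x^3 cancel; this leaves an O(x^4) numerator over a denominator of order
     x^3. *)
  replace (6 * (2 * x + (x - 2) * E) - x ^ 2 * E) with
    (x ^ 4 / 2 - x ^ 5 / 6 + (6 * x - 12 - x ^ 2) * rho) by (rewrite EE; field).
  assert (D : 12 * x ^ 3 <= 12 * x ^ 2 * E).
  { replace (12 * x ^ 3) with (12 * x ^ 2 * x) by ring. apply Rmult_le_compat_l; lra. }
  rewrite Rabs_mult, (Rabs_pos_eq (2 * PI)) by lra.
  replace (4 * PI ^ 2 * t) with (2 * PI * x) by (unfold x; ring).
  apply Rmult_le_compat_l; [lra|].
  unfold Rdiv at 1; rewrite Rabs_mult, (Rabs_pos_eq (/ _)) by (apply Rlt_le, Rinv_0_lt_compat; lra).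
  apply (proj2 (Rle_div_l _ _ (12 * x ^ 2 * E) ltac:(lra))).
  apply Rle_trans with (x * (12 * x ^ 3)).
  2:{ apply Rmult_le_compat_l; lra. }
  replace (x * (12 * x ^ 3)) with (12 * x ^ 4) by ring.
  assert (X5 : 0 <= x ^ 5 <= x ^ 4).
  { replace (x ^ 5) with (x * x ^ 4) by ring. nra. }
  assert (Bm : -13 <= 6 * x - 12 - x ^ 2 <= 0) by nra.
  assert (Rabs ((6 * x - 12 - x ^ 2) * rho) <= 13 * (x ^ 4 / 8)).
  { rewrite Rabs_mult. apply Rmult_le_compat; try apply Rabs_pos; apply Rabs_le; lra. }
  match goal with H : Rabs _ <= 13 * _ |- _ => apply Rabs_le_between in H end.
  apply Rabs_le; lra.
Qed.

(** Dividing [bose_reg_tail] by t and letting t tend to 0 turns the partial fractions into the sum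
    of 1/n^2, with value PI times the limit PI/6 and the tail bound preserved. *)
Lemma basel_partial N : (1 <= N)%nat ->
  0 <= PI ^ 2 / 6 - bsum (fun k => / INR (S k) ^ 2) N <= / INR N.
Proof.
  intros HN.
  assert (Pk : forall k, 0 < INR (S k)) by (intros; apply lt_0_INR; lia).
  assert (L : filterlim (fun t => PI * (bose_reg t / t) - bsum (fun k => / (INR (S k) ^ 2 + t ^ 2)) N)
    (at_right 0) (locally (PI ^ 2 / 6 - bsum (fun k => / INR (S k) ^ 2) N))).
  { apply filterlim_Rminus.
    - apply filterlim_replace with (PI * (PI / 6)); [|field]. apply filterlim_Rscal, bose_reg_limit_0.
    - clear HN; induction N as [|N IH]; [simpl; apply filterlim_const|].
      apply (filterlim_Rplus (fun t => bsum (fun k => / (INR (S k) ^ 2 + t ^ 2)) N) (fun t => / (INR (S N) ^ 2 + t ^ 2))); [exact IH|].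
      assert (Q := Pk N).
      apply filterlim_at_right_0_of_continuous.
      + apply (@ex_derive_continuous R_AbsRing R_NormedModule). auto_derive.
        change (INR (S N) ^ 2 + 0 ^ 2 <> 0). nra.
      + f_equal; ring. }
  assert (B : at_right 0 (fun t => 0 <= PI * (bose_reg t / t) - bsum (fun k => / (INR (S k) ^ 2 + t ^ 2)) N <= / INR N)).
  { generalize (at_right_0_lt 1 Rlt_0_1); apply filter_imp; intros t Ht.
    assert (T := bose_reg_tail t N ltac:(lra) HN).
    replace (bsum (fun k => t / (INR (S k) ^ 2 + t ^ 2)) N) with (t * bsum (fun k => / (INR (S k) ^ 2 + t ^ 2)) N) in T
      by (rewrite <- bsum_scal; reflexivity).
    replace (PI * bose_reg t - t * bsum (fun k => / (INR (S k) ^ 2 + t ^ 2)) N)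
      with (t * (PI * (bose_reg t / t) - bsum (fun k => / (INR (S k) ^ 2 + t ^ 2)) N)) in T by (field; lra).
    destruct T as [T1 T2]; split.
    - apply Rmult_le_reg_l with t; lra.
    - apply Rmult_le_reg_l with t; [lra|]. exact T2. }
  split.
  - apply (filterlim_le (F := at_right 0) (fun _ => 0) _ 0 (PI ^ 2 / 6 - bsum (fun k => / INR (S k) ^ 2) N)) with (3 := L).
    + revert B; apply filter_imp; intros; lra.
    + apply filterlim_const.
  - apply (filterlim_le (F := at_right 0) _ (fun _ => / INR N) (PI ^ 2 / 6 - bsum (fun k => / INR (S k) ^ 2) N) (/ INR N)) with (2 := L).
    + revert B; apply filter_imp; intros; lra.
    + apply filterlim_const.
Qed.

Lemma integral_t_exp c : 0 < c -> is_RInt_pos (fun t => t * exp (- c * t)) (/ c ^ 2).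
Proof.
  intros Hc.
  set (F := fun t => - (t / c + / c ^ 2) * exp (- c * t)).
  assert (Pc2 : 0 < c ^ 2) by now apply pow_lt.
  assert (Pc3 : 0 < c ^ 3) by now apply pow_lt.
  replace (/ c ^ 2) with (0 - - / c ^ 2) by ring.
  apply is_RInt_pos_antiderivative with F.
  - intros x Hx; unfold F; auto_derive; [easy|]. field. lra.
  - intros x Hx; apply (@ex_derive_continuous R_AbsRing R_NormedModule). auto_derive; easy.
  - apply filterlim_at_right_0_of_continuous.
    + apply (@ex_derive_continuous R_AbsRing R_NormedModule). unfold F; auto_derive; easy.
    + unfold F. rewrite Rmult_0_r, exp_0. field. lra.
  - apply filterlim_infty_of_power_bound with (K := (/ c + / c ^ 2) * (6 / c ^ 3)) (c := -2); [lra|].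
    intros x Hx; unfold F; rewrite Rminus_0_r.
    assert (Pcx : 0 < c * x) by (apply Rmult_lt_0_compat; lra).
    assert (B := pow_div_fact_le_exp 3 (c * x) ltac:(lra)).
    replace (INR (Factorial.fact 3)) with 6 in B by (simpl; ring).
    assert (Px3 : 0 < x ^ 3) by (apply pow_lt; lra).
    replace (Rpower x (-2)) with (/ x ^ 2).
    2:{ replace (-2) with (- INR 2) by (simpl; ring). rewrite Rpower_Ropp, Rpower_pow by lra. reflexivity. }
    assert (Ee : exp (- c * x) <= 6 / c ^ 3 * / x ^ 3).
    { replace (- c * x) with (- (c * x)) by ring. rewrite exp_Ropp.
      replace (6 / c ^ 3 * / x ^ 3) with (/ ((c * x) ^ 3 / 6)) by (field; lra).
      apply Rinv_le_contravar; [|exact B]. apply Rdiv_lt_0_compat; [now apply pow_lt|lra]. }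
    assert (Pe := exp_pos (- c * x)).
    assert (Pi : 0 < / c) by now apply Rinv_0_lt_compat.
    assert (Pi2 : 0 < / c ^ 2) by now apply Rinv_0_lt_compat.
    assert (Pxc : 0 < x / c) by (apply Rdiv_lt_0_compat; lra).
    rewrite Rabs_mult, Rabs_Ropp, !Rabs_pos_eq by lra.
    apply Rle_trans with ((x * (/ c + / c ^ 2)) * (6 / c ^ 3 * / x ^ 3)).
    + apply Rmult_le_compat; try lra. unfold Rdiv; nra.
    + right; field; lra.
Qed.

Lemma integral_exp_neg c : 0 < c -> is_RInt_pos (fun t => exp (- c * t)) (/ c).
Proof.
  intros Hc.
  replace (/ c) with (0 - - / c) by ring.
  apply is_RInt_pos_antiderivative with (fun t => - / c * exp (- c * t)).
  - intros x Hx; auto_derive; [easy|]. field. lra.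
  - intros x Hx; apply (@ex_derive_continuous R_AbsRing R_NormedModule). auto_derive; easy.
  - apply filterlim_at_right_0_of_continuous.
    + apply (@ex_derive_continuous R_AbsRing R_NormedModule). auto_derive; easy.
    + rewrite Rmult_0_r, exp_0. ring.
  - apply filterlim_infty_of_power_bound with (K := / c * / c) (c := -1); [lra|].
    intros x Hx; rewrite Rminus_0_r.
    assert (Pcx : 0 < c * x) by (apply Rmult_lt_0_compat; lra).
    assert (B := exp_ineq1 (c * x) ltac:(lra)).
    rewrite Rpower_neg1 by lra.
    assert (Pe := exp_pos (- c * x)).
    assert (Pi : 0 < / c) by now apply Rinv_0_lt_compat.
    rewrite Rabs_mult, Rabs_Ropp, !Rabs_pos_eq, Rmult_assoc by lra.
    apply Rmult_le_compat_l; [lra|].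
    rewrite <- Rinv_mult.
    replace (- c * x) with (- (c * x)) by ring. rewrite exp_Ropp.
    apply Rinv_le_contravar; lra.
Qed.

Lemma t_bose_le t : 0 < t -> 0 <= t * bose t <= / (2 * PI).
Proof.
  intros Ht. assert (P := PI_RGT_0). assert (B := bose_pos t Ht).
  split; [nra|].
  assert (H : 0 < 2 * PI * t) by (apply Rmult_lt_0_compat; lra).
  assert (E := exp_ineq1 (2 * PI * t) ltac:(lra)).
  replace (/ (2 * PI)) with (t * / (2 * PI * t)) by (field; lra).
  apply Rmult_le_compat_l; [lra|]. apply Rinv_le_contravar; lra.
Qed.

Lemma continuous_bose t : 0 < t -> continuous bose t.
Proof.
  intros Ht; apply (@ex_derive_continuous R_AbsRing R_NormedModule).
  unfold bose; auto_derive. assert (E := exp_2PI_gt_1 t Ht). lra.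
Qed.

(** The geometric expansion of [bose] has the exact remainder b(t) e^(-2 PI N t). As t b(t) <= 1/(2
    PI), its contribution is at most 1/(2 PI) times 1/(2 PI N), and the finite sums are compared
    with PI^2/6 by [basel_partial]. *)
Lemma integral_t_bose : is_RInt_pos (fun t => t * bose t) (/ 24).
Proof.
  assert (P := PI_RGT_0). assert (P2 := PI2_3_2).
  destruct (ex_RInt_pos_power_dominated (fun t => t * bose t) 0 (-2) 1) as (V & HV & _); try lra.
  - intros t Ht; apply continuous_Rmult; [apply continuous_id|now apply continuous_bose].
  - intros t Ht. assert (B := t_bose_le t ltac:(lra)).
    rewrite Rpower_O by lra. rewrite Rabs_pos_eq by apply B.
    apply Rle_trans with (1 := proj2 B). rewrite Rmult_1_r, <- Rinv_1. apply Rinv_le_contravar; lra.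
  - intros t Ht. assert (B := t_bose_le t ltac:(lra)).
    rewrite Rabs_pos_eq by apply B.
    replace (Rpower t (-2)) with (/ t ^ 2).
    2:{ replace (-2) with (- INR 2) by (simpl; ring). rewrite Rpower_Ropp, Rpower_pow by lra. reflexivity. }
    assert (C3 := bose_cube_bound t ltac:(lra)).
    replace (1 * / t ^ 2) with (t * / t ^ 3) by (field; lra). apply Rmult_le_compat_l; lra.
  - enough (E : V = / 24) by (rewrite <- E; exact HV).
    assert (Hc : forall k, 0 < 2 * PI * INR (S k)).
    { intros k; apply Rmult_lt_0_compat; [lra|]. apply lt_0_INR; lia. }
    assert (Bd : forall N, Rabs (V - bsum (fun k => / (2 * PI * INR (S k)) ^ 2) (S N)) <= / (2 * PI) * / (2 * PI * INR (S N))).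
    { intros N.
      apply (is_RInt_pos_le _ _ _ _) with
       (2 := is_RInt_pos_minus _ _ _ _ HV (is_RInt_pos_bsum (fun k t => t * exp (- (2 * PI * INR (S k)) * t)) _ (S N) (fun k => integral_t_exp _ (Hc k))))
       (3 := is_RInt_pos_scal (/ (2 * PI)) _ _ (integral_exp_neg _ (Hc N))).
      intros t Ht. assert (B := t_bose_le t Ht). assert (E := exp_2PI_gt_1 t Ht).
      assert (PE := exp_pos (- (2 * PI * INR (S N)) * t)).
      replace (t * bose t - bsum (fun k => t * exp (- (2 * PI * INR (S k)) * t)) (S N))
        with (t * bose t * exp (- (2 * PI * INR (S N)) * t)).
      - rewrite Rabs_pos_eq by (apply Rmult_le_pos; lra). apply Rmult_le_compat_r; lra.
      - assert (I : forall n, t * bose t - bsum (fun k => t * exp (- (2 * PI * INR (S k)) * t)) n = t * bose t * exp (- (2 * PI * INR n) * t)).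
        { induction n as [|n IH].
          - simpl. rewrite Rmult_0_r, Ropp_0, Rmult_0_l, exp_0; ring.
          - cbn [bsum].
            replace (t * bose t - _) with (t * bose t - bsum (fun k => t * exp (- (2 * PI * INR (S k)) * t)) n - t * exp (- (2 * PI * INR (S n)) * t)) by ring.
            rewrite IH.
            replace (- (2 * PI * INR n) * t) with (2 * PI * t + - (2 * PI * INR (S n)) * t) by (rewrite S_INR; ring).
            rewrite exp_plus. unfold bose. field. lra. }
        symmetry; apply I. }

    assert (L : is_lim_seq (fun N => Rabs (V - / 24)) 0).
    { apply is_lim_seq_le_le with (u := fun _ => 0) (w := fun N => (/ (2 * PI) * / (2 * PI) + / (2 * PI) ^ 2) / INR (S N)).
      - intros N; split; [apply Rabs_pos|].
        assert (B1 := Bd N). assert (B2 := basel_partial (S N) ltac:(lia)).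
        rewrite (bsum_ext _ (fun k => / (2 * PI) ^ 2 * / INR (S k) ^ 2)) in B1.
        2:{ intros k Hk; assert (Q := lt_0_INR (S k) ltac:(lia)). field. lra. }
        rewrite bsum_scal in B1.
        set (b := bsum _ _) in *.
        assert (Q := lt_0_INR (S N) ltac:(lia)).
        assert (C0 : 0 < / (2 * PI) ^ 2) by (apply Rinv_0_lt_compat, pow_lt; lra).
        replace (V - / 24) with ((V - / (2 * PI) ^ 2 * b) - / (2 * PI) ^ 2 * (PI ^ 2 / 6 - b)) by (field; lra).
        unfold Rminus at 1. eapply Rle_trans; [apply Rabs_triang|].
        rewrite Rabs_Ropp, Rabs_mult, (Rabs_pos_eq (/ _)), (Rabs_pos_eq (PI ^ 2 / 6 - b)) by lra.
        replace ((/ (2 * PI) * / (2 * PI) + / (2 * PI) ^ 2) / INR (S N)) with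
          (/ (2 * PI) * / (2 * PI * INR (S N)) + / (2 * PI) ^ 2 * / INR (S N)) by (field; lra).
        apply Rplus_le_compat; [exact B1|]. apply Rmult_le_compat_l; lra.
      - apply is_lim_seq_const.
      - apply is_lim_seq_div_INR_S. }
    apply is_lim_seq_unique in L. rewrite Lim_seq_const in L. injection L; intros Q.
    destruct (Req_dec (V - / 24) 0) as [Z|Z]; [lra|]. apply Rabs_no_R0 in Z; lra.
Qed.

Lemma Rabs_ln_le_sqrt_inv t : 0 < t <= 1 -> Rabs (ln t) <= 2 * Rpower t (- / 2).
Proof.
  intros Ht. rewrite Rabs_left1 by (rewrite <- ln_1; apply ln_le; lra).
  unfold Rpower. assert (E := exp_ineq1_le (- / 2 * ln t)). lra.
Qed.

Lemma integral_t_ln_bose_main : is_RInt_pos (fun t => t * ln t * bose_main t) (- / 8).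
Proof.
  assert (P := PI_RGT_0).
  (* Integration by parts with t^2/2 ln t - t^2/4, an antiderivative of t ln t. The product rule
     yields t^2 ln t/(2(1+t^2)), exactly the second term of PI t ln t [bose_main], so no dilogarithm
     appears; t/4 - atan t/4 and (t ln t - t)/2 integrate what is left. *)
  set (Phi := fun t => / PI * ((t ^ 2 / 2 * ln t - t ^ 2 / 4) * (atan t - PI / 2) + t / 4 - atan t / 4 + t * ln t / 2 - t / 2)).
  replace (- / 8) with (/ PI * (- (PI / 8)) - / PI * 0) by (field; lra).
  apply is_RInt_pos_antiderivative with Phi.
  - intros x Hx; unfold Phi, bose_main. auto_derive; [easy|].
    assert (1 + x ^ 2 <> 0) by nra. unfold Rsqr. field. repeat split; nra.
  - intros x Hx; apply (@ex_derive_continuous R_AbsRing R_NormedModule).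
    unfold bose_main; auto_derive.
    assert (0 < 2 * PI * (1 + x ^ 2)) by (apply Rmult_lt_0_compat; nra).
    assert (0 < 2 * PI * x) by (apply Rmult_lt_0_compat; lra).
    simpl in *. repeat split; lra.
  - unfold Phi; apply filterlim_Rscal.
    apply filterlim_0_of_power_bound with (K := 6) (c := / 2); [lra|].
    intros x Hx; rewrite Rminus_0_r.
    assert (L := Rabs_ln_le_sqrt_inv x Hx).
    assert (A := atan_lt_2 x). assert (A' := atan_bounds x ltac:(lra)).
    assert (0 <= x - x ^ 3 / 3).
    { assert (x ^ 2 <= 1) by nra. simpl in *. nra. }
    (* With q the square root of x, |x ln x| <= 2q bounds every term of [Phi] by a multiple of q. *)
    set (q := Rpower x (/ 2)).
    assert (Pq : 0 < q) by apply Rpower_pos.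
    assert (Eq : x = q * q).
    { unfold q; rewrite <- Rpower_plus. replace (/ 2 + / 2) with 1 by field. now rewrite Rpower_1. }
    assert (Hq : q <= 1) by nra.
    assert (Xq : x <= q) by nra.
    assert (L2 : Rabs (x * ln x) <= 2 * q).
    { rewrite Rabs_mult, (Rabs_pos_eq x) by lra.
      apply Rle_trans with (x * (2 * Rpower x (- / 2))); [apply Rmult_le_compat_l; lra|].
      right. rewrite Rpower_Ropp. fold q. rewrite Eq at 1. field. lra. }
    assert (B : Rabs (atan x - PI / 2) <= 2).
    { assert (Q := atan_bound x). assert (P4 := PI_4). apply Rabs_le; lra. }
    replace ((x ^ 2 / 2 * ln x - x ^ 2 / 4) * (atan x - PI / 2) + x / 4 - atan x / 4 + x * ln x / 2 - x / 2)
      with (x * ((x * ln x) / 2 - x / 4) * (atan x - PI / 2) + (- x / 4 - atan x / 4 + (x * ln x) / 2)) by field.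
    set (m := x * ln x) in *.
    assert (M1 : Rabs (m / 2 - x / 4) <= 5 / 4 * q).
    { apply Rabs_le_between in L2. apply Rabs_le; lra. }
    assert (M2 : Rabs (x * (m / 2 - x / 4) * (atan x - PI / 2)) <= 5 / 2 * q).
    { rewrite !Rabs_mult, (Rabs_pos_eq x) by lra.
      assert (Q1 := Rabs_pos (m / 2 - x / 4)).
      assert (x * Rabs (m / 2 - x / 4) <= 5 / 4 * q) by nra.
      apply Rle_trans with (5 / 4 * q * 2); [|lra].
      apply Rmult_le_compat; try lra; try apply Rabs_pos. apply Rmult_le_pos; lra. }
    apply Rabs_le_between in L2. apply Rabs_le_between in M2. apply Rabs_le; lra.
  - unfold Phi; apply filterlim_Rscal.
    apply filterlim_of_bound with (w := fun t => ln t / t + / t) (K := 1).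
    + exists 1; intros x Hx.
      assert (Hv : 0 < / x) by (apply Rinv_0_lt_compat; lra).
      assert (A := atan_bounds (/ x) ltac:(lra)).
      assert (Ei : atan x = PI / 2 - atan (/ x)) by (rewrite atan_inv by lra; ring).
      (* The linear part of atan v cancels the growing terms in x ln x and x. Only e = O(v^3) meets
         x^2 ln x, leaving O(ln x/x), and - atan x/4 accounts for the limit -PI/8. *)
      set (v := / x) in *. set (e := v - atan v).
      assert (He : 0 <= e <= v ^ 3 / 3) by (unfold e; lra).
      assert (Ll : 0 <= ln x) by (rewrite <- ln_1; apply ln_le; lra).
      assert (Xv : x * v = 1) by (unfold v; field; lra).
      replace (_ - - (PI / 8)) with ((x ^ 2 / 2 * ln x - x ^ 2 / 4) * e + atan v / 4).
      2:{ rewrite Ei. unfold e. 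
          transitivity ((x ^ 2 / 2 * ln x - x ^ 2 / 4) * (- atan v) + (x ^ 2 / 2 * ln x - x ^ 2 / 4) * v + atan v / 4); [ring|].
          replace ((x ^ 2 / 2 * ln x - x ^ 2 / 4) * v) with ((x * v) * (x / 2 * ln x - x / 4)) by field.
          rewrite Xv. field. }
      assert (X2 : x ^ 2 * (v ^ 3) = v) by (replace (x ^ 2 * v ^ 3) with ((x * v) ^ 2 * v) by ring; rewrite Xv; ring).
      assert (X2p : 0 <= x ^ 2) by apply pow2_ge_0.
      assert (E1 : 0 <= x ^ 2 * e <= v / 3).
      { split; [apply Rmult_le_pos; lra|]. replace (v / 3) with (x ^ 2 * (v ^ 3 / 3)) by lra. apply Rmult_le_compat_l; lra. }
      replace (ln x / x) with (ln x * v) by (unfold v; field; lra).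
      replace ((x ^ 2 / 2 * ln x - x ^ 2 / 4) * e) with ((x ^ 2 * e) * ln x / 2 - (x ^ 2 * e) / 4) by field.
      set (y := x ^ 2 * e) in *.
      assert (0 <= y * ln x <= v / 3 * ln x) by (split; [apply Rmult_le_pos; lra|apply Rmult_le_compat_r; lra]).
      assert (0 <= v * ln x) by (apply Rmult_le_pos; lra).
      assert (0 <= atan v). { assert (v <= 1). { unfold v; rewrite <- Rinv_1; apply Rinv_le_contravar; lra. }
        assert (v ^ 2 <= 1) by nra. simpl in *; nra. }
      apply Rabs_le; lra.
    + apply filterlim_replace with (0 + 0); [|ring].
      apply filterlim_Rplus; [exact is_lim_div_ln_p|].
      apply filterlim_ext_loc with (fun t => Rpower t (-1)).
      * exists 0; intros x Hx. now apply Rpower_neg1.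
      * apply filterlim_Rpower_infty; lra.
Qed.

(** * The continuation of zeta and its derivative at -1 *)

Definition laplace (al : R) (s : C) : C :=
  CInt (fun t => cexp (s * lam al t) * RtoC (bose_rem t))%C.

(* [- Ci] times the difference of the two Laplace integrals is 2 sin(pi s/2) int t^(-s) bose_rem(t) dt. *)
Definition zeta_model (s : C) : C :=
  (/ (s - 1) + RtoC (/ 2) + - Ci * (laplace (PI / 2) s + - (1) * laplace (- (PI / 2)) s))%C.

Lemma analytic_with_laplace al p : Rabs (Re p) < 2 ->
  analytic_with (laplace_coef al p) (laplace al) p.
Proof.
  (* Half the distance to the boundary of the strip keeps |Re p| + r < 2; the radius r/3 matches the
     condition of [is_pseries_laplace]. *)
  intros Hp. set (r := (2 - Rabs (Re p)) / 2).
  assert (Hr : 0 < r) by (unfold r; lra).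
  exists (r / 3); split; [lra|]. intros s Hs.
  destruct (is_pseries_laplace al p r Hr ltac:(unfold r; lra) (s - p)%C ltac:(lra)) as [_ H].
  cbv zeta in H. replace (p + (s - p))%C with s in H by ring. exact H.
Qed.

Lemma analytic_with_const c p :
  analytic_with (fun k => match k with O => c | S _ => RtoC 0 end) (fun _ => c) p.
Proof.
  exists 1; split; [lra|]. intros s _.
  apply is_Cseries_of_bound with (fun _ => 0); [|apply is_lim_seq_const].
  intros n.
  match goal with |- Cmod (?x - c)%C <= 0 => replace x with c end.
  - replace (c - c)%C with (RtoC 0) by ring. rewrite Cmod_0; lra.
  - induction n as [|n IH].
    + rewrite sum_O. symmetry; apply Cmult_1_l.
    + rewrite sum_Sn, <- IH. symmetry.
      change (c + @pow_n C_Ring (s - p)%C (S n) * 0 = c)%C. ring.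
Qed.

Lemma analytic_with_zeta_model p : Rabs (Re p) < 2 -> p <> RtoC 1 ->
  analytic_with (fun k => (-1) ^ k / (p - 1) ^ S k + match k with O => RtoC (/ 2) | S _ => RtoC 0 end
     + - Ci * (laplace_coef (PI / 2) p k + - (1) * laplace_coef (- (PI / 2)) p k))%C zeta_model p.
Proof.
  intros Hp H1.
  apply analytic_with_plus.
  - apply analytic_with_plus; [now apply analytic_with_Cinv|apply analytic_with_const].
  - apply analytic_with_scal, analytic_with_plus; [now apply analytic_with_laplace|].
    apply analytic_with_scal; now apply analytic_with_laplace.
Qed.

Lemma is_RInt_pos_0 : is_RInt_pos (fun _ => 0) 0.
Proof.
  assert (Q := is_RInt_pos_scal 0 _ _ integral_t_bose). rewrite Rmult_0_l in Q.
  revert Q; apply is_RInt_pos_ext; intros; ring.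
Qed.

Lemma is_CInt_RtoC f N : is_RInt_pos f N -> is_CInt (fun t => RtoC (f t)) (RtoC N).
Proof. intros H; split; [exact H|exact is_RInt_pos_0]. Qed.

Lemma laplace_real al s N : is_RInt_pos (fun t => Rpower t (- s) * bose_rem t) N ->
  laplace al (RtoC s) = ((cos (s * al), sin (s * al)) * RtoC N)%C.
Proof.
  intros H; apply CInt_unique.
  assert (Q := is_CInt_scal (cos (s * al), sin (s * al)) _ _ (is_CInt_RtoC _ _ H)).
  revert Q; apply is_CInt_ext; intros t Ht.
  unfold cexp, lam, Rpower, Cmult, RtoC, Re, Im; simpl.
  replace (s * - ln t - 0 * al) with (- s * ln t) by ring.
  replace (s * al + 0 * - ln t) with (s * al) by ring.
  f_equal; ring.
Qed.

Lemma zeta_real zeta s : is_Riemann_zeta zeta -> 1 < s ->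
  exists Z, zeta (RtoC s) = RtoC Z /\ is_series (fun k => Rpower (INR (S k)) (- s)) Z.
Proof.
  intros [H _] Hs; specialize (H (RtoC s) Hs).
  assert (E : forall n, Rpow_C (INR (S n)) (- RtoC s)%C = RtoC (Rpower (INR (S n)) (- s))).
  { intros n. unfold Rpow_C, Rpower, RtoC, Re, Im, Copp; simpl fst; simpl snd.
    rewrite Ropp_0, Rmult_0_l, cos_0, sin_0. f_equal; ring. }
  exists (Re (zeta (RtoC s))); split.
  - assert (I := is_series_Im _ _ H).
    assert (I0 : Im (zeta (RtoC s)) = 0).
    { apply is_series_unique in I. rewrite <- I.
      apply is_series_unique. apply is_series_ext with (fun _ => 0); [intros n; now rewrite E|].
      change (is_lim_seq (sum_n (fun _ => 0)) 0).
      apply is_lim_seq_ext with (fun _ => 0); [|apply is_lim_seq_const].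
      intros n; rewrite sum_n_const; ring. }
    rewrite (surjective_pairing (zeta (RtoC s))). unfold Im in I0; rewrite I0. reflexivity.
  - generalize (is_series_Re _ _ H); apply is_series_ext; intros n; rewrite E; reflexivity.
Qed.

Lemma zeta_model_real zeta s : is_Riemann_zeta zeta -> 1 < s < 2 ->
  zeta (RtoC s) = zeta_model (RtoC s).
Proof.
  intros Hz Hs.
  destruct (zeta_real zeta s Hz ltac:(lra)) as (Z & EZ & HZ).
  assert (P := PI_RGT_0).
  assert (S0 : 0 < sin (PI * s / 2)) by (apply sin_gt_0; nra).
  assert (H := mellin_bose_rem s Z Hs HZ).
  unfold zeta_model; rewrite EZ, !(laplace_real _ _ _ H).
  replace (s * - (PI / 2)) with (- (PI * s / 2)) by field.
  replace (s * (PI / 2)) with (PI * s / 2) by field.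
  rewrite cos_neg, sin_neg.
  set (N := (Z - / (s - 1) - / 2) * (/ 2 / sin (PI * s / 2))).
  rewrite <- RtoC_minus, <- RtoC_inv by lra.
  assert (EN : 2 * sin (PI * s / 2) * N = Z - / (s - 1) - / 2) by (unfold N; field; lra).
  unfold Ci, Cplus, Cmult, Copp, RtoC; simpl. f_equal; [|ring].
  match goal with |- _ = ?x => replace x with (/ (s - 1) + / 2 + 2 * sin (PI * s / 2) * N) by ring end.
  lra.
Qed.

Lemma analytic_at_zeta_diff zeta p : is_Riemann_zeta zeta -> Rabs (Re p) < 2 -> p <> RtoC 1 ->
  analytic_at (fun s => zeta s + - (1) * zeta_model s)%C p.
Proof.
  intros [_ Hz] Hp H1.
  destruct (analytic_at_ex _ _ (Hz p H1)) as [a Ha].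
  eapply analytic_at_with, analytic_with_plus; [exact Ha|].
  apply analytic_with_scal. now apply analytic_with_zeta_model.
Qed.

(* The segments 3/2 -> i -> -1 avoid the pole and stay in the strip |Re s| < 2. *)
Lemma zeta_eq_model_near_m1 zeta : is_Riemann_zeta zeta ->
  zero_near (fun s => zeta s + - (1) * zeta_model s)%C (RtoC (-1)).
Proof.
  intros Hz. set (h := fun s => (zeta s + - (1) * zeta_model s)%C).
  assert (Z1 : zero_near h (RtoC (3 / 2))).
  (* The comparison is needed only on the real interval (3/2, 2), where the Dirichlet series and the
     Mellin formula are both available. *)
  { apply zero_near_of_ray with (e := RtoC 1) (eps := / 2).
    - apply analytic_at_zeta_diff; auto.
      + unfold Re; simpl. rewrite Rabs_pos_eq; lra.
      + intros Q; apply RtoC_inj in Q; lra.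
    - intros Q; apply RtoC_inj in Q; lra.
    - lra.
    - intros u Hu. replace (RtoC (3 / 2) + RtoC u * 1)%C with (RtoC (3 / 2 + u)) by (rewrite RtoC_plus; ring).
      unfold h. rewrite (zeta_model_real zeta) by (auto; lra). ring. }
  assert (Z2 : zero_near h (RtoC (3 / 2) + (Ci - RtoC (3 / 2)))%C).
  { apply zero_near_segment; auto.
    - intros Q. apply (f_equal Im) in Q. unfold Im, Ci, Cminus, Cplus, Copp, RtoC in Q; simpl in Q; lra.
    - intros t Ht. apply analytic_at_zeta_diff; auto.
      + unfold Re, Ci, Cminus, Cplus, Copp, Cmult, RtoC; simpl. apply Rabs_def1; lra.
      + intros Q. assert (Q1 := f_equal Im Q). assert (Q2 := f_equal Re Q).
        unfold Re, Im, Ci, Cminus, Cplus, Copp, Cmult, RtoC in Q1, Q2; simpl in Q1, Q2. lra. }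
  replace (RtoC (3 / 2) + (Ci - RtoC (3 / 2)))%C with Ci in Z2 by ring.
  replace (RtoC (-1)) with (Ci + (RtoC (-1) - Ci))%C by ring.
  apply zero_near_segment; auto.
  - intros Q. apply (f_equal Im) in Q. unfold Im, Ci, Cminus, Cplus, Copp, RtoC in Q; simpl in Q; lra.
  - intros t Ht. apply analytic_at_zeta_diff; auto.
    + unfold Re, Ci, Cminus, Cplus, Copp, Cmult, RtoC; simpl. apply Rabs_def1; lra.
    + intros Q. assert (Q1 := f_equal Im Q). assert (Q2 := f_equal Re Q).
      unfold Re, Im, Ci, Cminus, Cplus, Copp, Cmult, RtoC in Q1, Q2; simpl in Q1, Q2. lra.
Qed.

Lemma is_CInt_laplace_coef_1 al : is_CInt (fun t => lam al t * (cexp (- lam al t) * RtoC (bose_rem t)))%C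
  (laplace_coef al (RtoC (-1)) 1).
Proof.
  assert (Q : Rabs (Re (RtoC (-1))) + / 2 < 2).
  { unfold Re; simpl. rewrite Rabs_left1; lra. }
  generalize (is_CInt_laplace_coef al (RtoC (-1)) (/ 2) ltac:(lra) Q 1).
  apply is_CInt_ext; intros t Ht.
  replace (RtoC (-1) * lam al t)%C with (- lam al t)%C by ring.
  simpl. field.
Qed.

(** At -1 the exponentials are -i t and i t, so the two integrands are PI t/2 + i t ln t and PI t/2
    - i t ln t, times [bose_rem]. The parts without logarithm cancel in the difference, and - Ci
    times 2i gives the factor 2; -1/4 is the derivative of 1/(s-1). *)
Lemma C_derive_zeta_m1 zeta : is_Riemann_zeta zeta -> exists J,
  is_RInt_pos (fun t => t * ln t * bose_rem t) J /\
  C_derive zeta (RtoC (-1)) = RtoC (- / 4 + 2 * J).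
Proof.
  intros Hz.
  assert (Hm1 : RtoC (-1) <> RtoC 1) by (intros Q; apply RtoC_inj in Q; lra).
  assert (Hre : Rabs (Re (RtoC (-1))) < 2) by (unfold Re; simpl; rewrite Rabs_left1; lra).
  destruct (analytic_with_zeta_model (RtoC (-1)) Hre Hm1) as (r1 & Hr1 & H1).
  destruct (zeta_eq_model_near_m1 zeta Hz) as (r2 & Hr2 & H2).
  assert (HA : analytic_with (fun k => (-1) ^ k / (RtoC (-1) - 1) ^ S k + match k with O => RtoC (/ 2) | S _ => RtoC 0 end
     + - Ci * (laplace_coef (PI / 2) (RtoC (-1)) k + - (1) * laplace_coef (- (PI / 2)) (RtoC (-1)) k))%C zeta (RtoC (-1))).
  { exists (Rmin r1 r2); split; [now apply Rmin_glb_lt|]. intros s Hs.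
    assert (E : zeta s = zeta_model s).
    { assert (Q := H2 s ltac:(eapply Rlt_le_trans; [exact Hs|apply Rmin_r])).
      cbv beta in Q. replace (zeta s) with ((zeta s + - (1) * zeta_model s) + zeta_model s)%C by ring.
      rewrite Q; ring. }
    rewrite E. apply H1. eapply Rlt_le_trans; [exact Hs|apply Rmin_l]. }
  rewrite (C_derive_of_pseries _ _ _ HA). clear HA H1 H2.
  destruct (is_CInt_laplace_coef_1 (PI / 2)) as [Rp Ip].
  destruct (is_CInt_laplace_coef_1 (- (PI / 2))) as [Rm Im'].
  set (ap := laplace_coef (PI / 2) (RtoC (-1)) 1) in *.
  set (am := laplace_coef (- (PI / 2)) (RtoC (-1)) 1) in *.
  assert (Ep : forall t, 0 < t -> (lam (PI / 2) t * (cexp (- lam (PI / 2) t) * RtoC (bose_rem t)))%C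
     = (PI / 2 * t * bose_rem t, t * ln t * bose_rem t)).
  { intros t Ht. unfold cexp, lam, Cmult, Copp, RtoC, Re, Im; simpl.
    rewrite Ropp_involutive, exp_ln by easy. rewrite cos_neg, sin_neg, cos_PI2, sin_PI2. f_equal; ring. }
  assert (Em : forall t, 0 < t -> (lam (- (PI / 2)) t * (cexp (- lam (- (PI / 2)) t) * RtoC (bose_rem t)))%C
     = (PI / 2 * t * bose_rem t, - (t * ln t * bose_rem t))).
  { intros t Ht. unfold cexp, lam, Cmult, Copp, RtoC, Re, Im; simpl.
    rewrite !Ropp_involutive, exp_ln by easy. rewrite cos_PI2, sin_PI2. f_equal; ring. }
  apply is_RInt_pos_ext with (g := fun t => PI / 2 * t * bose_rem t) in Rp;
    [|intros; rewrite Ep; easy].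
  apply is_RInt_pos_ext with (g := fun t => PI / 2 * t * bose_rem t) in Rm;
    [|intros; rewrite Em; easy].
  apply is_RInt_pos_ext with (g := fun t => t * ln t * bose_rem t) in Ip;
    [|intros; rewrite Ep; easy].
  apply is_RInt_pos_ext with (g := fun t => -1 * (t * ln t * bose_rem t)) in Im';
    [|intros; rewrite Em by easy; unfold Im; simpl; ring].
  assert (E1 := is_RInt_pos_unique _ _ _ Rp Rm).
  assert (E2 := is_RInt_pos_unique _ _ _ (is_RInt_pos_scal (-1) _ _ Ip) Im').
  exists (Im ap); split; [exact Ip|].
  destruct ap as [x y], am as [x' y']; unfold Re, Im in *; simpl fst in *; simpl snd in *.
  subst x' y'.
  replace ((-1) ^ 1 / (RtoC (-1) - 1) ^ 2)%C with (RtoC (- / 4)).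
  2:{ replace (RtoC (-1) - 1)%C with (RtoC (-2)) by (rewrite <- RtoC_minus; f_equal; ring).
      simpl. rewrite !Cmult_1_r, <- RtoC_mult. unfold Cdiv. rewrite <- RtoC_inv by lra. 
      rewrite <- RtoC_mult; f_equal; field. }
  unfold Ci, Cplus, Cmult, Copp, RtoC; simpl. f_equal; ring.
Qed.

Theorem mainTheorem8 :
  forall (zeta : C -> C) (A : R),
    is_Riemann_zeta zeta ->
    is_Glaisher_Kinkelin zeta A ->
    ex_RInt_gen (fun x : R => x * ln x / (exp x - 1))
      (at_right 0) (Rbar_locally p_infty) /\
    ln A = (1 + ln (2 * PI)) / 12
           - 1 / (2 * PI ^ 2) *
             RInt_gen (fun x : R => x * ln x / (exp x - 1))
               (at_right 0) (Rbar_locally p_infty).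
Proof.
  intros zeta A Hz [HA0 HA].
  assert (P := PI_RGT_0).
  destruct (C_derive_zeta_m1 zeta Hz) as (J & HJ & E).
  rewrite E, <- RtoC_minus in HA. apply RtoC_inj in HA.
  (* Then -1/4 + 2J = 2L: the constant from 1/(s-1) is exactly twice the integral of t ln t
     [bose_main], so [L] is the integral against [bose] itself. *)
  set (L := J + - / 8).
  assert (HL : is_RInt_pos (fun t => t * ln t * bose t) L).
  { assert (Q := is_RInt_pos_plus _ _ _ _ HJ integral_t_ln_bose_main).
    revert Q; apply is_RInt_pos_ext; intros t Ht; rewrite bose_decomp by easy; ring. }
  (* With x = 2 PI t one has ln x = ln t + ln(2 PI), and x dx contributes (2 PI)^2 = 4 PI^2; the
     value 1/24 multiplies ln(2 PI). *)
  assert (HI : is_RInt_pos (fun x => x * ln x / (exp x - 1)) (4 * PI ^ 2 * (L + ln (2 * PI) * / 24))).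
  { assert (Hi : 0 < / (2 * PI)) by (apply Rinv_0_lt_compat; lra).
    assert (Q := is_RInt_pos_comp_scal _ _ _ Hi (is_RInt_pos_scal (4 * PI ^ 2) _ _
      (is_RInt_pos_plus _ _ _ _ HL (is_RInt_pos_scal (ln (2 * PI)) _ _ integral_t_bose)))).
    revert Q; apply is_RInt_pos_ext; intros x Hx.
    unfold bose. replace (2 * PI * (/ (2 * PI) * x)) with x by (field; lra).
    rewrite ln_mult, ln_Rinv by lra.
    assert (Ex := exp_ineq1 x ltac:(lra)).
    field. lra. }
  split; [eexists; exact HI|].
  rewrite (is_RInt_gen_unique _ _ HI).
  rewrite HA. unfold L. field. lra.
Qed.
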